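(* Let $\mathbf w=w_0w_1w_2\cdots$ be an automatic (resp. morphic) infinite word over $\Sigma_b=\{0,1,\ldots,b-1\}$ ($b\ge2$), and let $x\in\Sigma_b^+$ be a nonempty finite word. Assume $\mathbf w$ has no suffix of the form $x^\omega$ and contains infinitely many maximal $x$-blocks. For $k\ge0$ let $(i_k,j_k)$ be the starting and ending positions of the $k$-th maximal $x$-block in $\mathbf w$. Then $\limsup_{k\to\infty} j_k/i_k$ is finite and rational (resp. algebraic).
   Context: Positions are indexed from $0$. A factor $y=w_i\cdots w_j$ of $\mathbf w$ is an $x$-block if there exist a proper (possibly empty) suffix $x'$ of $x$ and a proper (possibly empty) prefix $x''$ of $x$ such that $y=x'x^nx''$ for some integer $n\ge1$. Such an $x$-block is maximal if $x''w_{j+1}$ is not a prefix of $x$, and either $i=0$ or $w_{i-1}x'$ is not a suffix of $x$. Maximal $x$-blocks are enumerated in increasing order of starting position. Morphic/automatic words: Let $\Sigma$ be a finite alphabet. A morphism $h:\Sigma^*\to\Sigma^*$ is prolongable on $a\in\Sigma$ if $h(a)=ax$ with $x\in\Sigma^+$ and $h^n(x)$ nonempty for all $n\ge0$; then $h^n(a)$ converges to the infinite word $h^\omega(a)=a\,x\,h(x)\,h^2(x)\cdots$, called a pure morphic word. A coding is a letter-to-letter morphism. An infinite word is morphic if it is the image under a coding of a pure morphic word, and automatic if it is the image under a coding of a pure morphic word $h^\omega(a)$ with $h$ uniform (all $|h(c)|$ equal). *)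

(* Defs.v *)
From Stdlib Require Import Reals ZArith Arith List.
Import ListNotations.
Open Scope R_scope.

Definition word_over (b : nat) (w : nat -> nat) : Prop := forall n, (w n < b)%nat.
Definition fword_over (b : nat) (x : list nat) : Prop := forall y, In y x -> (y < b)%nat.

Definition hlist (h : nat -> list nat) (s : list nat) : list nat := flat_map h s.

Definition morphism_on (c : nat) (h : nat -> list nat) : Prop :=
  forall l, (l < c)%nat -> forall y, In y (h l) -> (y < c)%nat.

Definition uniform_on (c : nat) (h : nat -> list nat) : Prop :=
  exists m, forall l, (l < c)%nat -> length (h l) = m.

Definition prolongable (c : nat) (h : nat -> list nat) (a : nat) : Prop :=
  (a < c)%nat /\
  exists x, h a = a :: x /\ x <> [] /\ forall n, Nat.iter n (hlist h) x <> [].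

Definition is_fixed_point_word (h : nat -> list nat) (a : nat) (u : nat -> nat) : Prop :=
  forall n i, (i < length (Nat.iter n (hlist h) [a]))%nat ->
    u i = nth i (Nat.iter n (hlist h) [a]) 0%nat.

Definition morphic (w : nat -> nat) : Prop :=
  exists (c : nat) (h : nat -> list nat) (a : nat) (u : nat -> nat) (tau : nat -> nat),
    morphism_on c h /\ prolongable c h a /\ is_fixed_point_word h a u /\
    forall n, w n = tau (u n).

Definition automatic (w : nat -> nat) : Prop :=
  exists (c : nat) (h : nat -> list nat) (a : nat) (u : nat -> nat) (tau : nat -> nat),
    morphism_on c h /\ uniform_on c h /\ prolongable c h a /\
    is_fixed_point_word h a u /\ forall n, w n = tau (u n).

Definition factor (w : nat -> nat) (i j : nat) : list nat := map w (seq i (S j - i)).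
Definition is_prefix (p x : list nat) : Prop := exists v, x = p ++ v.
Definition is_suffix (s x : list nat) : Prop := exists u, x = u ++ s.
Definition proper_prefix (p x : list nat) : Prop := exists v, v <> [] /\ x = p ++ v.
Definition proper_suffix (s x : list nat) : Prop := exists u, u <> [] /\ x = u ++ s.
Definition lpow (x : list nat) (n : nat) : list nat := concat (repeat x n).

Definition x_block (w : nat -> nat) (x : list nat) (i j : nat) : Prop :=
  (i <= j)%nat /\
  exists x' x'' n, proper_suffix x' x /\ proper_prefix x'' x /\ (1 <= n)%nat /\
    factor w i j = x' ++ lpow x n ++ x''.

Definition maximal_x_block (w : nat -> nat) (x : list nat) (i j : nat) : Prop :=
  (i <= j)%nat /\
  exists x' x'' n, proper_suffix x' x /\ proper_prefix x'' x /\ (1 <= n)%nat /\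
    factor w i j = x' ++ lpow x n ++ x'' /\
    ~ is_prefix (x'' ++ [w (S j)]) x /\
    (i = 0%nat \/ ~ is_suffix (w (i - 1)%nat :: x') x).

Definition enumerates_maximal_blocks (w : nat -> nat) (x : list nat)
    (ib jb : nat -> nat) : Prop :=
  (forall k, (ib k < ib (S k))%nat) /\
  (forall k, maximal_x_block w x (ib k) (jb k)) /\
  (forall s t, maximal_x_block w x s t -> exists k, ib k = s /\ jb k = t).

Definition has_suffix_xomega (w : nat -> nat) (x : list nat) : Prop :=
  exists N, forall n, w (N + n)%nat = nth (n mod length x) x 0%nat.

Definition infinitely_many_maximal_blocks (w : nat -> nat) (x : list nat) : Prop :=
  forall N, exists s t, (N <= s)%nat /\ maximal_x_block w x s t.

Definition is_finite_limsup (a : nat -> R) (L : R) : Prop :=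
  (forall eps, eps > 0 -> exists N, forall k, (N <= k)%nat -> a k < L + eps) /\
  (forall eps, eps > 0 -> forall N, exists k, (N <= k)%nat /\ L - eps < a k).

Definition is_rational (r : R) : Prop :=
  exists p q : Z, q <> 0%Z /\ r = IZR p / IZR q.

(* coefficients listed from constant term upward *)
Definition zpoly_eval (cs : list Z) (r : R) : R :=
  fold_right (fun c acc => IZR c + r * acc) 0 cs.

Definition is_algebraic (r : R) : Prop :=
  exists cs : list Z, (exists c, In c cs /\ c <> 0%Z) /\ zpoly_eval cs r = 0.

(* Main.v *)
(** Call a position [t] bad if the factor of length [|x|] of [w] at [t] is not a rotation of [x].
    Up to bounded errors, the maximal [x]-blocks are the long stretches between consecutive bad
    positions, so the limsup is the threshold [L] such that for [rho > L], but not for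
    [1 <= rho < L], every interval from [t] to [rho t] with [t] large meets a bad position.

    A finite transducer detects bad positions.  For a suitable power of the morphism its effect on
    the image [h^n c] does not depend on [n >= 1], so badness becomes a marking of the letters of
    another fixed point, of a morphism [H] for which [c] is marked iff [H c] contains a marked
    letter.  Each block [H^n X] of the fixed point [a X (H X) (H^2 X) ...] contains a mark, hence
    [L] is finite, and [L = 1] unless [|H^n a|] grows geometrically.  If [L > 1], a long gap is the
    [n]-fold image of one of finitely many gaps, and its end points are lengths of [n]-fold images
    of words over an enlarged alphabet.

    Along [n = k P + r] such lengths are asymptotic to [C binomial(k, d) theta^k]
    (Perron-Frobenius on each strongly connected component), so their ratios converge, and [L] is
    such a limit.  The limits lie in the field generated by the dominant eigenvalue [theta] of an
    integer matrix, which is algebraic in general and an integer for uniform morphisms. *)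

Require Defs.
From Stdlib Require List PeanoNat Rdefinitions Raxioms RIneq.
From mathcomp Require all_boot all_order all_algebra all_classical all_reals ring lra zify.
From mathcomp Require topology normedtype sequences derive Rstruct.

(** Rationality and algebraicity enter only through a subfield [S] of the reals: the core result
    puts [L] into every [S] that contains the growth limits of [A (n.+1 * P) / A (n * P)], where
    [A n] is the length of the [n]-fold image of the first letter. The constants [C] of the
    asymptotics arise as limits of infinite processes and are out of arithmetic reach. Only ratios
    are tractable: they are coordinates of an eigenvector that linear algebra over the field of
    theta can write down. No extremal gap is exhibited. Gaps of ratio close to [L] descend from a
    finite set of pairs that does not depend on the precision. Each pair, with each residue of [n]
    modulo [P], gives a sequence converging in [S], so [L] must be one of these finitely many
    limits. The enlarged alphabet is forced because a gap runs from the last marked letter of one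
    image block to the first marked letter of another, and these are not block boundaries. Powers of
    the morphism are taken twice: once to make marks hereditary, once to make the occurrence
    relation between letters transitive, which removes periodicity. *)

Module Gaps.

Import all_boot all_order all_algebra all_classical all_reals ring lra zify.
Import topology normedtype sequences derive Rstruct.
Import Order.TTheory GRing.Theory Num.Theory.
Import numFieldNormedType.Exports.
Set Implicit Arguments.
Unset Strict Implicit.
Unset Printing Implicit Defensive.
Local Open Scope ring_scope.
Local Open Scope classical_set_scope.

(** * Sequences of regular growth *)

Section Growth.
Variable R : realType.
Implicit Types (f g s u : R^nat).

Lemma near_cvg f g (l : R) :
  (\forall n \near \oo, f n = g n) -> f @ \oo --> l -> g @ \oo --> l.
Proof. by move=> fg; apply: cvg_trans; apply: near_eq_cvg; apply: filterS fg. Qed.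

Lemma cvg_inv f (l : R) : l != 0 -> f @ \oo --> l -> (fun n => (f n)^-1) @ \oo --> l^-1.
Proof. by move=> l0 h; exact: cvgV. Qed.

Lemma cvg_mul f g (a b : R) : f @ \oo --> a -> g @ \oo --> b ->
  (fun n => f n * g n) @ \oo --> a * b.
Proof. exact: cvgM. Qed.

Lemma cvg_add f g (a b : R) : f @ \oo --> a -> g @ \oo --> b ->
  (fun n => f n + g n) @ \oo --> a + b.
Proof. exact: cvgD. Qed.

Lemma geometric_bound u (e : R) : 0 < e ->
  (\forall n \near \oo, u n.+1 <= e * u n) ->
  exists K, 0 <= K /\ \forall n \near \oo, u n <= K * e ^+ n.
Proof.
move=> e0 [N _ h]; exists (`|u N| / e ^+ N); split.
  by rewrite divr_ge0 // exprn_ge0 // ltW.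
exists N => // n /= /subnK <-; elim: (n - N)%N => [|k IH].
  by rewrite add0n divfK ?expf_neq0 ?gt_eqF // ler_norm.
rewrite addSn exprS mulrCA; apply: le_trans (h _ _) _; first exact: leq_addl.
by rewrite ler_pM2l.
Qed.

Lemma geometric_decay u (e : R) : 0 < e < 1 ->
  (\forall n \near \oo, 0 <= u n /\ u n.+1 <= e * u n) -> u @ \oo --> 0.
Proof.
move=> /andP[e0 e1] h.
have [||K [K0 hK]] := @geometric_bound u e => //.
  by apply: filterS h => n [].
apply: (@squeeze_cvgr _ _ _ _ (fun=> 0) (fun n => K * e ^+ n)).
- by near=> n; apply/andP; split; [have [] : 0 <= u n /\ u n.+1 <= e * u n by near: n | near: n].
- exact: cvg_cst.
- by apply: cvg_geometric; rewrite ger0_norm // ltW.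
Unshelve. all: by end_near. Qed.

Definition binR (n k : nat) : R := 'C(n, k)%:R.

Lemma binR_gt0 n k : (k <= n)%N -> 0 < binR n k.
Proof. by move=> h; rewrite ltr0n bin_gt0. Qed.

Lemma near_binR_gt0 k : \forall n \near \oo, 0 < binR n k.
Proof. by exists k => // n /=; apply: binR_gt0. Qed.

Lemma cvg_invn (a : nat) : (fun n => (n%:R - a%:R : R)^-1) @ \oo --> (0 : R).
Proof.
have h : (fun n => (n.+1%:R : R)^-1) @ \oo --> (0 : R) by exact: cvg_harmonic.
rewrite -(cvg_shiftn a.+1); apply: near_cvg h.
by near=> n; rewrite /= addnS -addSn natrD addrK.
Unshelve. all: by end_near. Qed.

Lemma cvg_binS k : (fun n => binR n.+1 k / binR n k) @ \oo --> (1 : R).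
Proof.
have h : (fun n => 1 - k%:R * (n.+1%:R - 0%:R : R)^-1) @ \oo --> (1 - k%:R * 0 : R).
  apply: cvgB; first exact: cvg_cst.
  apply: cvgMl_tmp; rewrite (@cvg_shiftS _ (fun n => (n%:R - 0%:R : R)^-1)); exact: cvg_invn.
rewrite mulr0 subr0 in h.
have := cvg_inv (oner_neq0 _) h; rewrite invr1; apply: near_cvg.
exists k => // n /= kn.
have e : (n.+1%:R - k%:R : R) * binR n.+1 k = n.+1%:R * binR n k.
  by rewrite -natrB ?leqW // -!natrM mul_bin_down.
have n0 : n.+1%:R != 0 :> R by rewrite pnatr_eq0.
have d0 : n.+1%:R - k%:R != 0 :> R by rewrite subr_eq0 eqr_nat gtn_eqF.
have b0 := gt_eqF (binR_gt0 kn).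
rewrite subr0 /=; apply: (mulIf (negbT b0)); rewrite divfK ?b0 //.
apply: (mulfI d0); rewrite e mulrA; congr (_ * _).
by move: n0 d0; move: (n.+1%:R : R) (k%:R : R) => a c a0 ac0; field; rewrite a0 ac0.
Qed.

Lemma cvg_bin_lt j k : (j < k)%N -> (fun n => binR n j / binR n k) @ \oo --> (0 : R).
Proof.
have step m : (fun n => binR n m / binR n m.+1) @ \oo --> (0 : R).
  have h : (fun n => m.+1%:R * (n%:R - m%:R : R)^-1) @ \oo --> (m.+1%:R * 0 : R).
    by apply: cvgMl_tmp; exact: cvg_invn.
  rewrite mulr0 in h; apply: near_cvg h; exists m.+1 => // n /= mn.
  have e : m.+1%:R * binR n m.+1 = (n%:R - m%:R) * binR n m.
    by rewrite -natrB ?(ltnW mn) // -!natrM mul_bin_left.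
  have d0 : n%:R - m%:R != 0 :> R by rewrite subr_eq0 eqr_nat gtn_eqF.
  have b1 : binR n m.+1 != 0 by rewrite gt_eqF // binR_gt0.
  apply: (mulfI d0); rewrite [RHS]mulrA -e; field.
  by rewrite b1 d0.
elim: k => // k IH; rewrite ltnS leq_eqVlt => /predU1P[->//|/IH {}IH].
have := cvg_mul IH (step k); rewrite mulr0; apply: near_cvg.
have := near_binR_gt0 k; apply: filterS => n b0.
by rewrite /= mulrA divfK // gt_eqF.
Qed.

Lemma cvg_binM k (e : R) : 0 < e < 1 -> (fun n => binR n k * e ^+ n) @ \oo --> (0 : R).
Proof.
move=> /andP[e0 e1]; apply: (@geometric_decay _ ((e + 1) / 2)); first lra.
have h : (fun n => (binR n.+1 k / binR n k) * e) @ \oo --> (1 * e).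
  by apply: cvgMr_tmp; exact: cvg_binS.
rewrite mul1r in h.
have h2 : \forall n \near \oo, binR n.+1 k / binR n k * e <= (e + 1) / 2.
  by apply: (cvgr_le e); [exact: h | lra].
near=> n; have b0 : 0 < binR n k by near: n; exact: near_binR_gt0.
have p0 : 0 < e ^+ n by rewrite exprn_gt0.
split; first by rewrite mulr_ge0 // ltW.
have : binR n.+1 k / binR n k * e <= (e + 1) / 2 by near: n.
rewrite exprS => h3.
rewrite (_ : binR n.+1 k * (e * e ^+ n) = (binR n.+1 k / binR n k * e) * (binR n k * e ^+ n)).
  by rewrite ler_pM2r // mulr_gt0.
by field; rewrite gt_eqF.
Unshelve. all: by end_near. Qed.

(** Binomials instead of powers of [n]: Pascal's rule makes the increments of [scale k.+1 1] exactly
    [scale k 1], and the same functions appear when an eigenvalue plus a nilpotent part is raised to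
    the power [n]. *)
Definition scale k (t : R) n : R := binR n k * t ^+ n.

Lemma near_scale_gt0 k t : 0 < t -> \forall n \near \oo, 0 < scale k t n.
Proof.
move=> t0; have := near_binR_gt0 k; apply: filterS => n b0.
by rewrite mulr_gt0 // exprn_gt0.
Qed.

Lemma cvg_scaleS k t : 0 < t -> (fun n => scale k t n.+1 / scale k t n) @ \oo --> t.
Proof.
move=> t0; have h : (fun n => (binR n.+1 k / binR n k) * t) @ \oo --> (1 * t).
  by apply: cvgMr_tmp; exact: cvg_binS.
rewrite mul1r in h; apply: near_cvg h; have := near_binR_gt0 k; apply: filterS => n b0 /=.
by rewrite /scale exprS; field; rewrite !gt_eqF // exprn_gt0.
Qed.

Lemma cvg_scale_lt k t k' t' : 0 < t -> 0 < t' ->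
  (t < t') || ((t == t') && (k < k')%N) ->
  (fun n => scale k t n / scale k' t' n) @ \oo --> (0 : R).
Proof.
move=> t0 t'0 /orP[tt|/andP[/eqP<- kk]]; last first.
  apply: near_cvg (cvg_bin_lt kk); exists k' => // n /= kn.
  rewrite /scale; field; rewrite !gt_eqF ?exprn_gt0 //; exact: binR_gt0.
have q0 : 0 < t / t' by rewrite divr_gt0.
have q1 : t / t' < 1 by rewrite ltr_pdivrMr // mul1r.
have h := @cvg_binM k (t / t').
apply: (@squeeze_cvgr _ _ _ _ (fun=> 0) (fun n => binR n k * (t / t') ^+ n)); first last.
- by apply: h; rewrite q0.
- exact: cvg_cst.
exists k' => // n /= kn.
have b1 : 1 <= binR n k' by rewrite ler1n bin_gt0.
have b0 : 0 < binR n k' by exact: binR_gt0.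
have b0' : 0 <= binR n k by rewrite ler0n.
have e : scale k t n / scale k' t' n = binR n k * (t / t') ^+ n / binR n k'.
  by rewrite /scale exprMn exprVn; field; rewrite !gt_eqF // exprn_gt0.
rewrite e; apply/andP; split.
  by rewrite !mulr_ge0 ?invr_ge0 ?exprn_ge0 // ltW.
by rewrite ler_pdivrMr // ler_peMr // mulr_ge0 // exprn_ge0 // ltW.
Qed.

(** Strict positivity of [C] excludes cancellation, so a sum keeps the larger scale. The eventually
    zero case is there because morphisms may erase letters. *)
Definition regular f := (\forall n \near \oo, f n = 0) \/
  exists (k : nat) (t C : R), [/\ 0 < t, 0 < C & (fun n => f n / scale k t n) @ \oo --> C].

Lemma regular_near f g : (\forall n \near \oo, f n = g n) -> regular f -> regular g.
Proof.
move=> fg [h|[k [t [C [t0 C0 h]]]]]; [left|right].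
  by near=> n; rewrite -(near fg n) //; near: n.
exists k, t, C; split=> //; apply: near_cvg h; near=> n; congr (_ / _).
by near: n.
Unshelve. all: by end_near. Qed.

Lemma regular_ext f g : f =1 g -> regular f -> regular g.
Proof. by move=> fg; apply: regular_near; apply: nearW. Qed.

Lemma scale_total k t k' t' : 0 < t -> 0 < t' ->
  [\/ (fun n => scale k t n / scale k' t' n) @ \oo --> (0 : R),
      k = k' /\ t = t' |
      (fun n => scale k' t' n / scale k t n) @ \oo --> (0 : R)].
Proof.
move=> t0 t'0; case: (ltgtP t t') => tt.
- by apply: Or31; apply: cvg_scale_lt; rewrite ?tt.
- by apply: Or33; apply: cvg_scale_lt; rewrite ?tt.
rewrite -tt; case: (ltngtP k k') => kk.
- by apply: Or31; apply: cvg_scale_lt; rewrite ?eqxx ?kk ?orbT.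
- by apply: Or33; apply: cvg_scale_lt; rewrite ?eqxx ?kk ?orbT.
- by apply: Or32.
Qed.

Lemma cvg_scale_trans f k t k' t' (C D : R) : 0 < t ->
  (fun n => f n / scale k t n) @ \oo --> C ->
  (fun n => scale k t n / scale k' t' n) @ \oo --> D ->
  (fun n => f n / scale k' t' n) @ \oo --> C * D.
Proof.
move=> t0 h1 h2; have := cvg_mul h1 h2; apply: near_cvg.
have := near_scale_gt0 k t0; apply: filterS => n s0 /=.
by rewrite mulrA divfK // gt_eqF.
Qed.

Lemma regular_add f g : regular f -> regular g -> regular (fun n => f n + g n).
Proof.
move=> [hf|[k [t [C [t0 C0 hf]]]]].
  by apply: regular_near; apply: filterS hf => n ->; rewrite add0r.
move=> [hg|[k' [t' [C' [t'0 C'0 hg]]]]].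
  apply: (@regular_near f); first by apply: filterS hg => n ->; rewrite addr0.
  by right; exists k, t, C.
right; have [h|[kk tt]|h] := scale_total k k' t0 t'0.
- exists k', t', C'; split=> //.
  have := cvg_add (cvg_scale_trans t0 hf h) hg; rewrite mulr0 add0r; apply: near_cvg.
  by apply: nearW => n /=; rewrite mulrDl.
- subst k' t'; exists k, t, (C + C'); split=> //; first exact: addr_gt0.
  by have := cvg_add hf hg; apply: near_cvg; apply: nearW => n /=; rewrite mulrDl.
- exists k, t, C; split=> //.
  have := cvg_add hf (cvg_scale_trans t'0 hg h); rewrite mulr0 addr0; apply: near_cvg.
  by apply: nearW => n /=; rewrite mulrDl.
Qed.

Lemma regular0 : regular (fun=> 0).
Proof. by left; apply: nearW. Qed.

Lemma regular_scale (a : R) f : 0 <= a -> regular f -> regular (fun n => a * f n).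
Proof.
rewrite le_eqVlt => /predU1P[<- _|a0].
  by apply: (regular_ext _ regular0) => n; rewrite mul0r.
move=> [hf|[k [t [C [t0 C0 hf]]]]]; [left|right].
  by apply: filterS hf => n ->; rewrite mulr0.
exists k, t, (a * C); split=> //; first exact: mulr_gt0.
have : (fun n => a * (f n / scale k t n)) @ \oo --> a * C by apply: cvgMl_tmp.
by apply: near_cvg; apply: nearW => n; rewrite mulrA.
Qed.

Lemma regular_sum (I : Type) (r : seq I) (P : pred I) (F : I -> R^nat) :
  (forall i, P i -> regular (F i)) -> regular (fun n => \sum_(i <- r | P i) F i n).
Proof.
move=> h; elim: r => [|i r IH].
  by apply: (regular_ext _ regular0) => n; rewrite big_nil.
case: (boolP (P i)) => Pi.
  apply: (@regular_ext (fun n => F i n + \sum_(j <- r | P j) F j n)).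
    by move=> n; rewrite big_cons Pi.
  by apply: regular_add => //; exact: h.
by apply: regular_ext IH => n; rewrite big_cons (negbTE Pi).
Qed.

(** Serves the letters that do not occur in their own images: their values at [n.+1] are
    combinations of values of strictly lower letters at [n]. *)
Lemma regular_unshift f : regular (fun n => f n.+1) -> regular f.
Proof.
move=> [[N _ h]|[k [t [C [t0 C0 h]]]]]; [left|right].
  by exists N.+1 => // -[//|n] /= Nn; apply: h.
exists k, t, (C / t); split=> //; first exact: divr_gt0.
rewrite -cvg_shiftS.
have := cvg_mul h (cvg_inv (negbT (gt_eqF t0)) (cvg_scaleS k t0)); apply: near_cvg.
have := near_scale_gt0 k t0; apply: filterS => n s0 /=.
by rewrite invf_div mulrA divfK // gt_eqF.
Qed.

Lemma regular_geometric (a : R) f : 0 < a -> regular f -> regular (fun n => f n * a ^+ n).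
Proof.
move=> a0 [hf|[k [t [C [t0 C0 hf]]]]]; [left|right].
  by apply: filterS hf => n ->; rewrite mul0r.
exists k, (t * a), C; split=> //; first exact: mulr_gt0.
apply: near_cvg hf; have := near_binR_gt0 k; apply: filterS => n b0.
by rewrite /scale exprMn; field; rewrite !gt_eqF // exprn_gt0.
Qed.

(** Of the three comparisons of scales, the one where [f] has the larger scale would make its
    constant [C'] vanish; the two others give a limit. *)
Lemma regular_dominated f g k t (C K : R) : 0 < t -> 0 < C ->
  (forall n, 0 <= f n) -> (\forall n \near \oo, f n <= K * g n) ->
  (fun n => g n / scale k t n) @ \oo --> C -> regular f ->
  exists D : R, 0 <= D /\ (fun n => f n / scale k t n) @ \oo --> D.
Proof.
move=> t0 C0 f0 fg hg [hf|[k' [t' [C' [t'0 C'0 hf]]]]].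
  exists 0; split=> //; apply: near_cvg (cvg_cst (0 : R)).
  by apply: filterS hf => n ->; rewrite mul0r.
have [h|[kk tt]|h] := scale_total k k' t0 t'0.
- have h0 : (fun n => g n / scale k' t' n) @ \oo --> (0 : R).
    by have := cvg_scale_trans t0 hg h; rewrite mulr0.
  suff : (fun n => f n / scale k' t' n) @ \oo --> (0 : R).
    by move=> h1; move: C'0; rewrite (cvg_unique _ hf h1) // ltxx.
  have h2 : (fun n => K * (g n / scale k' t' n)) @ \oo --> (0 : R).
    by rewrite -[X in _ --> X](mulr0 K); apply: cvgMl_tmp.
  apply: (@squeeze_cvgr _ _ _ _ (fun=> 0) (fun n => K * (g n / scale k' t' n))) => //; last exact: cvg_cst.
  near=> n; have s0 : 0 < scale k' t' n by near: n; exact: near_scale_gt0.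
  apply/andP; split; first by rewrite divr_ge0 ?f0 // ltW.
  rewrite mulrA ler_pM2r ?invr_gt0 //; near: n; exact: fg.
- by subst; exists C'; split=> //; exact: ltW.
- exists 0; split=> //; have := cvg_scale_trans t'0 hf h; by rewrite mulr0.
Unshelve. all: by end_near. Qed.

Lemma stolz_cesaro s u (l : R) :
  (\forall n \near \oo, u n < u n.+1) -> u @ \oo --> +oo ->
  (fun n => (s n.+1 - s n) / (u n.+1 - u n)) @ \oo --> l ->
  (fun n => s n / u n) @ \oo --> l.
Proof.
move=> [N0 _ uinc] uoo h; apply/cvgrPdist_le => e e0.
have [N1 _ hN1] : \forall n \near \oo, `|l - (s n.+1 - s n) / (u n.+1 - u n)| <= e / 2.
  by move/cvgrPdist_le: h; apply; rewrite divr_gt0.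
pose N := maxn N0 N1.
have inc n : (N <= n)%N -> u n < u n.+1.
  by move=> Nn; apply: uinc; apply: leq_trans Nn; rewrite leq_maxl.
have key n : (N <= n)%N ->
   u N <= u n /\ `|l * (u n - u N) - (s n - s N)| <= e / 2 * (u n - u N).
  move=> /subnK <-; elim: (n - N)%N => [|m [IH1 IH2]].
    by rewrite add0n !subrr mulr0 subrr normr0 mulr0.
  have lt := inc (m + N)%N (leq_addl _ _); rewrite addSn.
  split; first by apply: le_trans IH1 (ltW _).
  have := hN1 (m + N)%N; rewrite /= => /(_ (leq_trans (leq_maxr _ _) (leq_addl _ _))).
  set d := u (m + N).+1 - u (m + N)%N => hd.
  have d0 : 0 < d by rewrite subr_gt0.
  have h2 : `|(l - (s (m + N).+1 - s (m + N)%N) / d) * d| <= e / 2 * d.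
    by rewrite normrM (gtr0_norm d0) ler_pM2r.
  rewrite mulrBl divfK ?gt_eqF // in h2.
  have -> : l * (u (m + N).+1 - u N) - (s (m + N).+1 - s N) =
    (l * (u (m + N)%N - u N) - (s (m + N)%N - s N)) + (l * d - (s (m + N).+1 - s (m + N)%N)).
    by rewrite /d; ring.
  apply: le_trans (ler_normD _ _) _; apply: le_trans (lerD IH2 h2) _.
  by rewrite /d -mulrDr ler_pM2l ?divr_gt0 //; lra.
(* The boundary terms left at [N] by the summation. As [u] tends to infinity they cost at most the
   second [e / 2]. *)
pose K := `|s N - l * u N| + e / 2 * `|u N|.
have K0 : 0 <= K by rewrite addr_ge0 // mulr_ge0 // divr_ge0 // ltW.
have : \forall n \near \oo, Num.max 1 (K / (e / 2)) <= u n by move/cvgryPge: uoo.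
move=> [N2 _ hN2]; exists (maxn N N2) => // n /=; rewrite geq_max => /andP[Nn N2n].
have := hN2 _ N2n; rewrite /= ge_max => /andP[u1 uK].
have u0 : 0 < u n by lra.
have [_ h3] := key n Nn.
suff : `|(l - s n / u n) * u n| <= e * u n by rewrite normrM (gtr0_norm u0) ler_pM2r.
rewrite mulrBl divfK ?gt_eqF //.
have h4 : K <= e / 2 * u n by rewrite mulrC -ler_pdivrMr // divr_gt0.
have -> : l * u n - s n = (l * (u n - u N) - (s n - s N)) - (s N - l * u N) by ring.
apply: le_trans (ler_normB _ _) _; apply: le_trans (lerD h3 (lexx _)) _.
have h5 : - u N <= `|u N| by rewrite -normrN ler_norm.
have h6 : e / 2 * - u N <= e / 2 * `|u N| by rewrite ler_pM2l // divr_gt0.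
rewrite /K in h4; lra.
Qed.

Lemma cvgy_scale k (t : R) : (1 < t) || ((1 == t) && (0 < k)%N) ->
  scale k t @ \oo --> +oo.
Proof.
move=> t1; have t0 : 0 < t by case/orP: t1 => [|/andP[/eqP<-]]; lra.
have : (fun n => scale 0 1 n / scale k t n) @ \oo --> (0 : R).
  exact: cvg_scale_lt.
move=> h; apply/cvgryPge => A.
have A0 : 0 < `|A| + 1 by rewrite ltr_wpDl.
have : \forall n \near \oo, scale 0 1 n / scale k t n <= (`|A| + 1)^-1.
  by apply: (cvgr_le (0 : R)) => //; rewrite invr_gt0.
move=> h1; near=> n.
have s0 : 0 < scale k t n by near: n; exact: near_scale_gt0.
have : scale 0 1 n / scale k t n <= (`|A| + 1)^-1 by near: n.
rewrite {1}/scale /binR bin0 expr1n mul1r mul1r lef_pV2 ?posrE // => h2.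
by apply: le_trans h2; rewrite (le_trans (ler_norm A)) // lerDl.
Unshelve. all: by end_near. Qed.

End Growth.

(** * Series, affine recurrences and contractions *)

Section Iteration.
Variable R : realType.
Implicit Types (f g s u e : R^nat).

(** For a rate [t < 1] the series converges. For [t > 1] the sum is comparable to its increment,
    with constant [C / (t - 1)]. At [t = 1] the binomial degree rises by one, which is where
    polynomial factors are born. The last two cases are Stolz-Cesaro. *)
Lemma regular_series s e : (forall n, s n.+1 = s n + e n) -> 0 < s 0%N ->
  (forall n, 0 <= e n) -> regular e -> regular s.
Proof.
move=> sS s0 e0 he.
have s_nd : nondecreasing_seq s by apply/nondecreasing_seqP => n; rewrite sS lerDl.
have s_gt0 n : 0 < s n by apply: lt_le_trans s0 (s_nd _ _ _).
right; case: he => [[N _ hN]|[k [t [C [t0 C0 h]]]]].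
  exists 0%N, 1, (s N); split=> //.
  apply: near_cvg (cvg_cst (s N)); exists N => // n /= Nn.
  rewrite /scale /binR bin0 expr1n mulr1 divr1 -(subnK Nn).
  by elim: (n - N)%N => [//|m ->]; rewrite addSn sS (hN (m + N)%N) ?addr0 //= leq_addl.
have [t1|t1|t1] := ltgtP t 1.
- have ratio : (fun n => e n.+1 / e n) @ \oo --> t.
    have h1 : (fun n => e n.+1 / scale k t n.+1) @ \oo --> C.
      by rewrite (@cvg_shiftS _ (fun n => e n / scale k t n)).
    have := cvg_mul (cvg_mul h1 (cvg_scaleS k t0)) (cvg_inv (negbT (gt_eqF C0)) h).
    rewrite [X in _ --> X]mulrAC divff ?gt_eqF // mul1r; apply: near_cvg.
    have h2 : \forall n \near \oo, 0 < e n / scale k t n by apply: (cvgr_gt C).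
    near=> n; have p0 : 0 < scale k t n by near: n; exact: near_scale_gt0.
    have p1 : 0 < scale k t n.+1.
      by near: n; have [N _ hN] := near_scale_gt0 k t0; exists N => // n /= Nn; apply: hN; rewrite /= leqW.
    have e1 : 0 < e n.
      by have : 0 < e n / scale k t n; [near: n | rewrite pmulr_lgt0 ?invr_gt0].
    by field; rewrite !gt_eqF.
  pose q := (t + 1) / 2; have q0 : 0 < q by rewrite /q; lra.
  have q1 : q < 1 by rewrite /q; lra.
  have [||K [K0 [N _ hK]]] := @geometric_bound _ e q => //.
    have h1 : \forall n \near \oo, e n.+1 / e n <= q by apply: (cvgr_le t) => //; rewrite /q; lra.
    have h2 : \forall n \near \oo, 0 < e n / scale k t n by apply: (cvgr_gt C).
    near=> n; have p0 : 0 < scale k t n by near: n; exact: near_scale_gt0.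
    have e1 : 0 < e n.
      by have : 0 < e n / scale k t n; [near: n | rewrite pmulr_lgt0 ?invr_gt0].
    by rewrite -ler_pdivrMr //; near: n.
  (* A telescoping bound: [s n + L * q ^+ n] does not increase from [N] on, because
     [K = L * (1 - q)]. *)
  have bnd n : s n <= s N + K / (1 - q) * q ^+ N.
    have : 0 <= K / (1 - q) by rewrite divr_ge0 // subr_ge0 ltW.
    set L := K / (1 - q) => L0.
    have KL : K = L * (1 - q) by rewrite /L divfK // subr_eq0 gt_eqF.
    have [Nn|/ltnW nN] := leqP N n; last first.
      by apply: le_trans (s_nd _ _ nN) _; rewrite lerDl mulr_ge0 // exprn_ge0 // ltW.
    suff : s n + L * q ^+ n <= s N + L * q ^+ N.
      by apply: le_trans; rewrite lerDl mulr_ge0 // exprn_ge0 // ltW.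
    rewrite -(subnK Nn); elim: (n - N)%N => [//|m IH]; apply: le_trans IH.
    rewrite addSn sS exprS.
    have := hK (m + N)%N (leq_addl _ _); rewrite KL => h3; nra.
  have cv : cvgn s.
    by apply: nondecreasing_is_cvgn => //; exists (s N + K / (1 - q) * q ^+ N) => _ [n _ <-].
  exists 0%N, 1, (limn s); split=> //.
    by apply: lt_le_trans s0 _; exact: nondecreasing_cvgn_le.
  apply: near_cvg cv; apply: nearW => n.
  by rewrite /scale /binR bin0 expr1n mulr1 divr1.
- have lt : \forall n \near \oo, 1 < scale k t n.+1 / scale k t n.
    by apply: (cvgr_gt t) => //; exact: cvg_scaleS.
  exists k, t, (C / (t - 1)); split=> //; first by rewrite divr_gt0 // subr_gt0.
  apply: stolz_cesaro.
  + near=> n; have p0 : 0 < scale k t n by near: n; exact: near_scale_gt0.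
    have : 1 < scale k t n.+1 / scale k t n by near: n.
    by rewrite ltr_pdivlMr // mul1r.
  + by apply: cvgy_scale; rewrite t1.
  have h1 : (fun n => scale k t n.+1 / scale k t n - 1) @ \oo --> t - 1.
    by apply: cvg_add; [exact: cvg_scaleS | exact: cvg_cst].
  have t1' : t - 1 != 0 by rewrite subr_eq0 gt_eqF.
  have := cvg_mul h (cvg_inv t1' h1); apply: near_cvg.
  near=> n; have p0 : 0 < scale k t n by near: n; exact: near_scale_gt0.
  have p1 : 1 < scale k t n.+1 / scale k t n by near: n.
  rewrite sS [s n + _]addrC addrK.
  have p2 : scale k t n.+1 - scale k t n != 0.
    by move: p1; rewrite ltr_pdivlMr // mul1r subr_eq0 => /gt_eqF->.
  by field; rewrite p2 gt_eqF.
- subst t; exists k.+1, 1, C; split=> //.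
  have dif n : scale k.+1 1 n.+1 - scale k.+1 1 n = scale k 1 n :> R.
    by rewrite /scale !expr1n !mulr1 /binR binS natrD addrAC subrr add0r.
  apply: stolz_cesaro.
  + near=> n; rewrite -subr_gt0 dif; near: n; exact: near_scale_gt0.
  + by apply: cvgy_scale; rewrite eqxx orbT.
  by apply: near_cvg h; apply: nearW => n; rewrite dif sS [s n + _]addrC addrK.
Unshelve. all: by end_near. Qed.

(** Dividing by [a ^+ n] turns the recurrence into a series; resonance between [a] and the rate of
    [f] is the case [t = 1] of [regular_series]. *)
Lemma regular_affine (a : R) y f : 0 < a -> (forall n, y n.+1 = a * y n + f n) ->
  0 < y 0%N -> (forall n, 0 <= f n) -> regular f -> regular y.
Proof.
move=> a0 yS y0 f0 hf.
have an0 n : a ^+ n != 0 by rewrite expf_neq0 // gt_eqF.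
apply: (@regular_ext _ (fun n => y n / a ^+ n * a ^+ n)) => [n|].
  by rewrite divfK.
apply: regular_geometric => //.
apply: (@regular_series _ (fun n => f n / a ^+ n.+1)).
- by move=> n; rewrite yS exprS; field; rewrite an0 gt_eqF.
- by rewrite expr0 divr1.
- by move=> n; rewrite divr_ge0 // exprn_ge0 // ltW.
apply: (@regular_ext _ (fun n => a^-1 * (f n * a^-1 ^+ n))) => [n|].
  by rewrite exprS exprVn; field; rewrite an0 gt_eqF.
apply: regular_scale; first by rewrite invr_ge0 ltW.
by apply: regular_geometric; rewrite ?invr_gt0.
Qed.

(** Column sums at most [q] make [a] a contraction for the l1 norm. Since [psi] is Cauchy, the
    diameter of the tails of [w] can be shrunk by a factor [r] again and again. *)
Lemma contraction_cvg (T : finType) (a : T -> T -> R) (q B : R) (w psi : nat -> T -> R) (l : T -> R) :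
  (forall c d, 0 <= a c d) -> 0 < q < 1 -> (forall d, \sum_c a c d <= q) ->
  (forall n c, w n.+1 c = \sum_d a c d * w n d + psi n c) ->
  (forall n c, `|w n c| <= B) ->
  (forall c, (fun n => psi n c) @ \oo --> l c) ->
  forall c, exists v : R, (fun n => w n c) @ \oo --> v.
Proof.
move=> a0 /andP[q0 q1] aq wS wB hpsi.
pose D (v v' : T -> R) := \sum_c `|v c - v' c|.
(* Halfway between [q] and 1: the excess [r - q] pays for the oscillation of [psi]. *)
pose r := (q + 1) / 2; have r0 : 0 < r by rewrite /r; lra.
have r1 : r < 1 by rewrite /r; lra.
pose B' := \sum_(c : T) (`|B| + `|B|) + 1.
have B'0 : 0 < B' by rewrite ltr_wpDl // sumr_ge0 // => c _; rewrite addr_ge0.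
have psiD x : 0 < x -> \forall N \near \oo, forall m m', (N <= m)%N -> (N <= m')%N ->
    D (psi m) (psi m') <= x.
  move=> x0; pose y := x / (#|T|.*2.+1)%:R.
  have y0 : 0 < y by rewrite divr_gt0.
  have h c : exists N, forall m, (N <= m)%N -> `|l c - psi m c| <= y.
    by have /cvgrPdist_le/(_ _ y0)[N _ hN] := hpsi c; exists N => m Nm; apply: hN.
  have [F hF] := choice h.
  exists (\max_c F c) => // N /= FN m m' Nm Nm'.
  apply: (@le_trans _ _ (\sum_(c : T) (y + y))).
    apply: ler_sum => c _; rewrite -[_ - _](subrKA (l c)).
    have Fc : (F c <= N)%N by apply: leq_trans FN; exact: leq_bigmax.
    apply: le_trans (ler_normD _ _) _; apply: lerD.
      by rewrite distrC; apply: hF; exact: leq_trans Nm.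
    by apply: hF; exact: leq_trans Nm'.
  rewrite sumr_const -mulr2n -mulrnA -mulr_natl /y mulrCA -[leRHS]mulr1.
  rewrite ler_pM2l // ler_pdivrMr // mul1r ler_nat cardT -cardE; lia.
have step k : exists N, forall m m', (N <= m)%N -> (N <= m')%N ->
    D (w m) (w m') <= r ^+ k * B'.
  elim: k => [|k [N IH]].
    exists 0%N => m m' _ _; rewrite mul1r; apply: (@le_trans _ _ (\sum_(c : T) (`|B| + `|B|))); last by rewrite lerDl.
    apply: ler_sum => c _; apply: le_trans (ler_normB _ _) _.
    by apply: lerD; apply: le_trans (wB _ _) (ler_norm _).
  have x0 : 0 < (r - q) * (r ^+ k * B').
    by rewrite mulr_gt0 ?mulr_gt0 ?exprn_gt0 // subr_gt0 /r; lra.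
  have [N' _ hN'] := psiD _ x0.
  exists (maxn N N').+1 => -[//|m] [//|m']; rewrite !ltnS !geq_max => /andP[Nm N'm] /andP[Nm' N'm'].
  have h1 := IH _ _ Nm Nm'; have h2 := hN' N' (leqnn _) _ _ N'm N'm'.
  apply: (@le_trans _ _ (q * D (w m) (w m') + D (psi m) (psi m'))).
    rewrite /D mulr_sumr.
    apply: (@le_trans _ _ (\sum_c (\sum_d a c d * `|w m d - w m' d| + `|psi m c - psi m' c|))).
      apply: ler_sum => c _; rewrite !wS opprD addrACA -sumrB.
      apply: le_trans (ler_normD _ _) _; apply: lerD => //.
      apply: le_trans (ler_norm_sum _ _ _) _; apply: ler_sum => d _.
      by rewrite -mulrBr normrM (ger0_norm (a0 _ _)).
    rewrite big_split /= lerD2r exchange_big /=; apply: ler_sum => d _.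
    by rewrite -mulr_suml ler_wpM2r.
  rewrite exprS -mulrA (_ : r * _ = q * (r ^+ k * B') + (r - q) * (r ^+ k * B')); last by ring.
  by apply: lerD => //; rewrite ler_pM2l.
move=> c; apply/cvg_ex/cauchy_cvgP/cauchy_exP => e e0.
have : (fun k => B' * r ^+ k) @ \oo --> (0 : R).
  by apply: cvg_geometric; rewrite ger0_norm // ltW.
move=> /(cvgr_lt (0 : R))/(_ _ e0)[k _ hk].
have [N hN] := step k; exists (w N c); exists N => // n /= Nn.
rewrite /ball /=; apply: le_lt_trans (hk k (leqnn _)); rewrite mulrC.
apply: le_trans (hN N n (leqnn _) Nn).
by rewrite /D (bigD1 c) //= lerDl sumr_ge0.
Qed.

End Iteration.

(** * Perron vectors and linear systems *)

Section Perron.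
Variable R : realType.

Lemma pos_lower_bound (T : finType) (g : T -> R) :
  (forall j, 0 < g j) -> exists e, 0 < e /\ forall j, e <= g j.
Proof.
(* An explicit bound, valid also on an empty type, where there is no minimum to take. *)
move=> g0; exists (1 + \sum_j (g j)^-1)^-1.
have s0 : 0 <= \sum_j (g j)^-1 by apply: sumr_ge0 => j _; rewrite invr_ge0 ltW.
split=> [|j]; first by rewrite invr_gt0 ltr_wpDr.
rewrite -[leRHS]invrK lef_pV2 ?posrE ?invr_gt0 ?ltr_wpDr //.
rewrite (bigD1 j) //= addrCA lerDl addr_ge0 // sumr_ge0 // => i _.
by rewrite invr_ge0 ltW.
Qed.

Lemma continuous_sumf (T : topologicalType) (I : Type) (r : seq I) (f : I -> T -> R) :
  (forall i, continuous (f i)) -> continuous (fun x => \sum_(i <- r) f i x).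
Proof.
move=> h x; elim: r => [|i r IH].
  rewrite (_ : (fun _ => _) = fun=> 0); first exact: cvg_cst.
  by apply/funext => y; rewrite big_nil.
rewrite (_ : (fun _ => _) = fun y => f i y + \sum_(j <- r) f j y).
  by apply: cvgD => //; exact: h.
by apply/funext => y; rewrite big_cons.
Qed.

Lemma continuous_coord n (i : 'I_n) : continuous (fun u : 'rV[R]_n => u ord0 i).
Proof. exact: coord_continuous. Qed.

(* Collatz-Wielandt: [l] maximises [t] subject to [t l <= l A] on the simplex. *)
Lemma perron_left n (A : 'I_n -> 'I_n -> R) : (0 < n)%N ->
  (forall i j, 0 < A i j) ->
  exists (a : R) (l : 'I_n -> R), [/\ 0 < a, forall i, 0 < l i &
    forall j, \sum_i l i * A i j = a * l j].
Proof.
move=> n0 A0.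
(* A row of length [n.+1] holds the candidate eigenvalue in coordinate 0 and the vector in the
   others, so the maximum is taken over both at once. *)
pose v (u : 'rV[R]_n.+1) i := u ord0 (lift ord0 i).
pose t (u : 'rV[R]_n.+1) := u ord0 ord0.
have vc i : continuous (v ^~ i) by exact: continuous_coord.
have tc : continuous t by exact: continuous_coord.
pose M := \sum_i \sum_j A i j.
have M0 : 0 <= M by apply: sumr_ge0 => i _; apply: sumr_ge0 => j _; exact: ltW.
pose box := [set u : 'rV[R]_n.+1 | forall k, `[0, M + 1]%classic (u ord0 k)].
pose D1 := [set u : 'rV[R]_n.+1 | \sum_i v u i = 1].
pose D2 := \bigcap_(j in [set: 'I_n]) [set u : 'rV[R]_n.+1 | 0 <= \sum_i v u i * A i j - t u * v u j].
pose D := [set u | box u /\ (D1 u /\ D2 u)].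
have in_D u : 0 <= t u -> (forall i, 0 <= v u i) -> D1 u ->
    (forall j, t u * v u j <= \sum_i v u i * A i j) -> D u.
  move=> tu vu d1 h.
  have v1 i : v u i <= 1.
    by rewrite -d1 (bigD1 i) //= lerDl sumr_ge0.
  have tM : t u <= M.
    rewrite -[leLHS]mulr1 -d1 mulr_sumr (le_trans (ler_sum _ (fun j _ => h j))) //.
    rewrite exchange_big /=; apply: ler_sum => i _; apply: ler_sum => j _.
    by rewrite ler_piMl // ltW.
  split; last by split=> // j _ /=; rewrite subr_ge0.
  move=> k /=; rewrite in_itv /=; case: (unliftP ord0 k) => [i ->|->].
    by rewrite vu /=; apply: le_trans (v1 i) _; rewrite lerDr.
  by rewrite tu (le_trans tM) // lerDl.
have D1c : closed D1.
  apply: (@closed_comp _ _ (fun u => \sum_i v u i) [set x | x = 1]); last exact: closed_eq.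
  by move=> u _; apply: continuous_sumf => i; exact: vc.
have D2c : closed D2.
  apply: closed_bigI => j _.
  apply: (@closed_comp _ _ (fun u => \sum_i v u i * A i j - t u * v u j) [set x | 0 <= x]); last exact: closed_ge.
  have c1 : continuous (fun u => \sum_i v u i * A i j).
    by apply: continuous_sumf => i x; exact: (cvgMr_tmp (vc i x)).
  by move=> u _; exact: (cvgB (c1 u) (cvgM (tc u) (vc j u))).
have Dcomp : compact D.
  apply: compact_closedI; last exact: closedI.
  by apply: (@rV_compact _ _ (fun=> `[0, M + 1]%classic)) => k; exact: segment_compact.
pose mk (x : R) (l : 'I_n -> R) : 'rV[R]_n.+1 :=
  \row_k (if unlift ord0 k is Some i then l i else x).
have mkt x l : t (mk x l) = x by rewrite /t mxE unlift_none.
have mkv x l i : v (mk x l) i = l i by rewrite /v mxE liftK.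
have Dn : D !=set0.
  exists (mk 0 (fun=> n%:R^-1)); apply: in_D; rewrite ?mkt //.
  - by move=> i; rewrite mkv invr_ge0.
  - rewrite /D1 /= (eq_bigr (fun=> n%:R^-1)) => [|i _]; last by rewrite mkv.
    by rewrite sumr_const card_ord -[LHS]mulr_natr mulVf // pnatr_eq0 -lt0n.
  - move=> j; rewrite mul0r sumr_ge0 // => i _.
    by rewrite mkv mulr_ge0 ?invr_ge0 // ltW.
have [u] := @EVT_max_rV R n.+1 t D Dn Dcomp (@continuous_subspaceT _ _ D t tc).
rewrite inE => -[bu [d1 d2]] umax.
have u0 k : 0 <= u ord0 k by have := bu k; rewrite /= in_itv /= => /andP[].
have v0 i : 0 <= v u i by exact: u0.
pose w j := \sum_i v u i * A i j.
have wge j : t u * v u j <= w j by rewrite -subr_ge0; exact: d2.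
have [i0 vi0] : exists i, 0 < v u i.
  apply: contrapT => /forallNP h; move: d1; rewrite /D1 /= big1 => [/esym/eqP|i _].
    by rewrite oner_eq0.
  by apply/eqP; rewrite eq_le v0 andbT leNgt; apply/negP/h.
have w0 j : 0 < w j.
  rewrite /w (bigD1 i0) //= ltr_wpDr ?mulr_gt0 //.
  by apply: sumr_ge0 => i _; rewrite mulr_ge0 // ltW.
have weq j : w j = t u * v u j.
  apply/eqP; rewrite eq_le wge andbT leNgt; apply/negP => lt.
  (* If the inequality is strict at [j], one more application of the positive matrix makes it strict
     everywhere. With [e] below every relative slack [g k], the value [t u + e] is still feasible
     and beats the maximum. *)
  pose g k := (\sum_i w i * A i k - t u * w k) / w k.
  have g0 k : 0 < g k.
    rewrite divr_gt0 // /w mulr_sumr -sumrB (bigD1 j) //= ltr_wpDr //.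
      apply: sumr_ge0 => i _; rewrite mulrA -mulrBl mulr_ge0 ?(ltW (A0 _ _)) //.
      by rewrite subr_ge0 wge.
    by rewrite mulrA -mulrBl mulr_gt0 // subr_gt0.
  have [e [e0 he]] := pos_lower_bound g0.
  pose s := \sum_i w i.
  have s0 : 0 < s by rewrite /s (bigD1 i0) //= ltr_wpDr // sumr_ge0 // => i _; exact: ltW.
  have := umax (mk (t u + e) (fun i => w i / s)); rewrite mkt inE => /(_ _)/wrap[].
    apply: in_D; rewrite ?mkt.
    - by rewrite addr_ge0 ?u0 // ltW.
    - by move=> i; rewrite mkv divr_ge0 // ltW.
    - rewrite /D1 /= (eq_bigr (fun i => w i / s)) => [|i _]; last by rewrite mkv.
      by rewrite -mulr_suml divff // gt_eqF.
    - move=> k; rewrite mkv (eq_bigr (fun i => (w i * A i k) / s)) => [|i _]; last by rewrite mkv mulrAC.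
      rewrite -mulr_suml mulrA ler_pM2r ?invr_gt0 // mulrDl -lerBrDl.
      by rewrite -ler_pdivlMr //; exact: he.
  by rewrite gerDl leNgt e0.
have t0 : 0 < t u.
  rewrite lt_neqAle u0 andbT eq_sym; apply/eqP => te.
  by move: (w0 i0); rewrite weq te mul0r ltxx.
exists (t u), (v u); split=> // i.
by have := w0 i; rewrite weq pmulr_rgt0.
Qed.

End Perron.

(** * Linear systems of regular sequences *)

Section System.
Variable R : realType.

Lemma cvg_sum_seq (I : Type) (r : seq I) (f : I -> R^nat) (l : I -> R) :
  (forall i, f i @ \oo --> l i) ->
  (fun n => \sum_(i <- r) f i n) @ \oo --> \sum_(i <- r) l i.
Proof.
move=> h; elim: r => [|i r IH].
  rewrite big_nil; apply: near_cvg (cvg_cst (0 : R)).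
  by apply: nearW => n; rewrite big_nil.
rewrite big_cons; apply: near_cvg (cvg_add (h i) IH).
by apply: nearW => n; rewrite big_cons.
Qed.

(* Conjugating by the left Perron vector [l] makes the system column stochastic with
   uniformly positive entries, and the scalar sequence [l . x] satisfies a one-dimensional
   recurrence; Doeblin's minorisation then turns the normalised system into a contraction. *)
Lemma regular_positive_system m (N : 'I_m -> 'I_m -> R) (x f : nat -> 'I_m -> R) :
  (forall i j, 0 < N i j) ->
  (forall n i, x n.+1 i = \sum_j N i j * x n j + f n i) ->
  (forall i, 0 < x 0%N i) -> (forall n i, 0 <= f n i) ->
  (forall i, regular (fun n => f n i)) ->
  forall i, regular (fun n => x n i).
Proof.
move=> N0 xS x0 f0 hf i0.
have m0 : (0 < m)%N by case: m i0 {N x f N0 xS x0 f0 hf} => [[]|].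
have [a [l [a0 l0 la]]] := perron_left m0 N0.
have xge0 n i : 0 <= x n i.
  elim: n i => [|n IH] i; first exact: ltW.
  by rewrite xS addr_ge0 // sumr_ge0 // => j _; rewrite mulr_ge0 // ltW.
pose y n := \sum_i l i * x n i.
pose fy n := \sum_i l i * f n i.
have yS n : y n.+1 = a * y n + fy n.
  rewrite /y (eq_bigr (fun i => \sum_j l i * N i j * x n j + l i * f n i)); last first.
    by move=> i _; rewrite xS mulrDr mulr_sumr; congr (_ + _); apply: eq_bigr => j _; rewrite mulrA.
  rewrite big_split /= exchange_big /=; congr (_ + _).
  by rewrite mulr_sumr; apply: eq_bigr => j _; rewrite -mulr_suml la mulrA.
have fy0 n : 0 <= fy n by apply: sumr_ge0 => i _; rewrite mulr_ge0 // ltW.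
have y0 : 0 < y 0%N.
  by rewrite /y (bigD1 i0) //= ltr_wpDr ?mulr_gt0 // sumr_ge0 // => i _; rewrite mulr_ge0 // ltW.
have ypos n : 0 < y n.
  by elim: n => [//|n IH]; rewrite yS ltr_wpDr // mulr_gt0.
have ry : regular y.
  apply: (@regular_affine R a y fy) => //.
  by apply: regular_sum => i _; apply: regular_scale => //; exact: ltW.
have [k [t [C [t0 C0 hy]]]] : exists (k : nat) (t C : R),
    [/\ 0 < t, 0 < C & (fun n => y n / scale k t n) @ \oo --> C].
  case: ry => // -[n0 _ /(_ n0 (leqnn _))] /= e.
  by have := ypos n0; rewrite e ltxx.
have hy1 : (fun n => y n.+1 / scale k t n) @ \oo --> C * t.
  have h1 : (fun n => y n.+1 / scale k t n.+1) @ \oo --> C.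
    by rewrite (@cvg_shiftS _ (fun n => y n / scale k t n)).
  have := cvg_mul h1 (cvg_scaleS k t0); apply: near_cvg.
  exists k => // n /= kn; rewrite mulrA divfK // gt_eqF // mulr_gt0 ?exprn_gt0 //.
  by apply: binR_gt0; rewrite leqW.
(* Since [y n.+1 >= a * y n], the rate of [y] is at least [a]; hence [s = a / t] is at most 1. *)
have at_ : a <= t.
  have h1 := cvg_mul hy1 (cvg_inv (negbT (gt_eqF C0)) hy).
  rewrite [X in _ --> X]mulrAC divff ?gt_eqF // mul1r in h1.
  apply: (ler_cvg_to (cvg_cst a) h1); have := near_scale_gt0 k t0; apply: filterS => n s0.
  rewrite invf_div mulrA divfK ?gt_eqF // ler_pdivlMr // yS lerDl //.
(* [l i * f n i] is bounded by [y n.+1], so the forcing does not exceed the scale of [y]. *)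
have hphi i : exists D : R, 0 <= D /\ (fun n => f n i / scale k t n) @ \oo --> D.
  apply: (@regular_dominated _ _ (fun n => y n.+1) _ _ (C * t) (l i)^-1) => //.
  - exact: mulr_gt0.
  - apply: nearW => n; rewrite -ler_pdivrMl ?invr_gt0 // invrK yS.
    apply: (@le_trans _ _ (fy n)); last by rewrite lerDr mulr_ge0 // ltW.
    by rewrite /fy (bigD1 i) //= lerDl sumr_ge0 // => j _; rewrite mulr_ge0 // ltW.
have [phi hphi'] := choice hphi; have {hphi hphi'} hphi i := (hphi' i).2.
(* The shift by [k] keeps the binomial, hence the denominator, nonzero from [n = 0] on. *)
pose sc n := scale k t (n + k).
have sc0 n : 0 < sc n by rewrite mulr_gt0 ?exprn_gt0 // binR_gt0 // leq_addl.
pose w n i := l i * x (n + k)%N i / sc n.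
pose S i j := l i * N i j / (a * l j).
pose sg n := a * (sc n / sc n.+1).
pose s := a / t.
have s0 : 0 < s by rewrite divr_gt0.
have s1 : s <= 1 by rewrite ler_pdivrMr // mul1r.
have hsg : sg @ \oo --> s.
  have h1 := cvg_inv (negbT (gt_eqF t0)) (cvg_scaleS k t0).
  have h2 : (fun n => scale k t n / scale k t n.+1) @ \oo --> t^-1.
    by apply: near_cvg h1; apply: nearW => n; rewrite invf_div.
  by apply: cvgMl_tmp; move: h2; rewrite -(cvg_shiftn k).
have Scol j : \sum_i S i j = 1.
  by rewrite -mulr_suml la divff // gt_eqF // mulr_gt0.
have S0 i j : 0 < S i j by rewrite divr_gt0 ?mulr_gt0.
have S1 i j : S i j <= 1.
  by rewrite -(Scol j) (bigD1 i) //= lerDl sumr_ge0 // => i' _; exact: ltW.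
have [d0 [d0_gt0 hd0]] := @pos_lower_bound R ('I_m * 'I_m)%type (fun p => S p.1 p.2) (fun p => S0 _ _).
(* Half of the lower bound, so that [q = 1 - m * d] stays positive even if all entries equal
   [1 / m]. *)
pose d := d0 / 2; have dpos : 0 < d by rewrite divr_gt0.
have dS i j : d <= S i j by apply: le_trans (hd0 (i, j)); rewrite /d; lra.
pose q := 1 - m%:R * d.
have q1 : q < 1 by rewrite /q gtrBl mulr_gt0 // ltr0n.
have q0 : 0 < q.
  have : m%:R * d0 <= \sum_i S i i0.
    rewrite mulr_natl -[X in _ *+ X](card_ord m) -sumr_const.
    by apply: ler_sum => i _; exact: (hd0 (i, i0)).
  rewrite Scol.
  have : 0 < m%:R :> R by rewrite ltr0n.
  rewrite /q /d; nra.
pose W n := \sum_i w n i.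
have Wy n : W n = y (n + k)%N / sc n by rewrite /W /w /y mulr_suml.
have hW : W @ \oo --> C.
  have : (fun n => y (n + k)%N / sc n) @ \oo --> C.
    by move: hy; rewrite -(cvg_shiftn k).
  by apply: near_cvg; apply: nearW => n; rewrite Wy.
have w0 n i : 0 <= w n i.
  by apply: divr_ge0; [apply: mulr_ge0; [apply: ltW|] | apply: ltW].
have wW n i : w n i <= W n by rewrite /W (bigD1 i) //= lerDl sumr_ge0.
(* Removing [d] from every entry changes the product only by [d * W n], and [W] is already known to
   converge. The columns that remain sum to [s * q]. *)
pose A i j := s * (S i j - d).
pose psi n i := sg n * d * W n + l i * (f (n + k)%N i / sc n) * (sc n / sc n.+1)
   + (sg n - s) * \sum_j (S i j - d) * w n j.
have wS' n i : w n.+1 i = sg n * (\sum_j S i j * w n j) + l i * (f (n + k)%N i / sc n) * (sc n / sc n.+1).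
  have sn0 := gt_eqF (sc0 n); have sn1 := gt_eqF (sc0 n.+1).
  rewrite {1}/w addSn xS mulrDr mulrDl; congr (_ + _); last by field; rewrite sn0 sn1.
  rewrite mulr_sumr mulr_suml mulr_sumr; apply: eq_bigr => j _.
  by rewrite /sg /S /w; field; rewrite sn0 sn1 !gt_eqF.
have wS n i : w n.+1 i = \sum_j A i j * w n j + psi n i.
  rewrite wS' /psi /A.
  have -> : \sum_j S i j * w n j = \sum_j (S i j - d) * w n j + d * W n.
    by rewrite /W mulr_sumr -big_split /=; apply: eq_bigr => j _; ring.
  have -> : \sum_j s * (S i j - d) * w n j = s * \sum_j (S i j - d) * w n j.
    by rewrite mulr_sumr; apply: eq_bigr => j _; rewrite mulrA.
  by ring.
have hsc : (fun n => sc n / sc n.+1) @ \oo --> a^-1 * s.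
  have : (fun n => a^-1 * sg n) @ \oo --> a^-1 * s by apply: cvgMl_tmp.
  by apply: near_cvg; apply: nearW => n; rewrite /sg mulKf // gt_eqF.
have hpsi i : (fun n => psi n i) @ \oo --> s * d * C + l i * phi i * (a^-1 * s) + 0.
  apply: cvg_add; first apply: cvg_add.
  - by apply: cvg_mul => //; exact: cvgMr_tmp.
  - apply: cvg_mul => //; apply: cvgMl_tmp.
    by have := hphi i; rewrite -(cvg_shiftn k).
  have h0 : (fun n => `|sg n - s| * W n) @ \oo --> (0 : R).
    rewrite -(mul0r C); apply: cvg_mul => //.
    rewrite -(normr0 R) -(subrr s); apply: cvg_norm; apply: cvgB => //; exact: cvg_cst.
  apply/cvgr0Pnorm_le => e e0.
  have : \forall n \near \oo, `|sg n - s| * W n <= e by apply: (cvgr_le (0 : R)).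
  apply: filterS => n; apply: le_trans; rewrite normrM ler_wpM2l //.
  rewrite ger0_norm; last by apply: sumr_ge0 => j _; rewrite mulr_ge0 // subr_ge0.
  apply: ler_sum => j _; rewrite ler_piMl //.
  by have := S1 i j; lra.
have [B hB] : exists B, forall n i, `|w n i| <= B.
  have /cvgP/cvg_has_ub[B hB] := hW; exists B => n i.
  rewrite ger0_norm //; apply: le_trans (wW n i) (le_trans (ler_norm _) _).
  by apply: hB; exists n.
have hw : forall i, exists v : R, (fun n => w n i) @ \oo --> v.
  apply: (@contraction_cvg R _ A q B w psi (fun i => s * d * C + l i * phi i * (a^-1 * s) + 0)) => //.
  - by move=> i j; apply: mulr_ge0; [exact: ltW | rewrite subr_ge0].
  - by rewrite q0.
  - move=> j; rewrite -mulr_sumr sumrB Scol sumr_const card_ord -mulr_natl -/q.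
    by rewrite ler_piMl // ltW.
have [v hv] := choice hw.
have v0 i : 0 <= v i by apply: (ler_cvg_to (cvg_cst (0 : R)) (hv i)); apply: nearW.
have vC : \sum_i v i = C by exact: (cvg_unique _ (cvg_sum_seq hv) hW).
have [e ve] : exists e, 0 < v e.
  apply: contrapT => /forallNP h; move: C0; rewrite -vC big1 ?ltxx // => i _.
  by apply/eqP; rewrite eq_le v0 andbT leNgt; apply/negP/h.
(* One limit [v e] is positive because they sum to [C]; one step of the positive matrix carries this
   to every coordinate. *)
have vpos i : 0 < v i.
  apply: (@lt_le_trans _ _ (s * (S i e * v e))); first by apply: mulr_gt0 => //; exact: mulr_gt0.
  have h1 : (fun n => sg n * (S i e * w n e)) @ \oo --> s * (S i e * v e).
    by apply: cvg_mul => //; exact: cvgMl_tmp.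
  have h2 : (fun n => w n.+1 i) @ \oo --> v i by rewrite (@cvg_shiftS _ (fun n => w n i)).
  apply: (ler_cvg_to h1 h2); apply: nearW => n; rewrite wS' ler_wpDr //.
    apply: mulr_ge0; last by apply: divr_ge0; exact: ltW.
    by apply: mulr_ge0; [exact: ltW | apply: divr_ge0; last exact: ltW].
  rewrite ler_pM2l; last by apply: mulr_gt0 => //; exact: divr_gt0.
  rewrite (bigD1 e) //= lerDl sumr_ge0 // => j _.
  by apply: mulr_ge0 => //; exact: ltW.
right; exists k, t, (v i0 / l i0); split=> //; first exact: divr_gt0.
rewrite -(cvg_shiftn k).
have : (fun n => w n i0 / l i0) @ \oo --> v i0 / l i0 by apply: cvgMr_tmp.
apply: near_cvg; apply: nearW => n; rewrite /w -/(sc n) /=.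
by rewrite mulrAC [l i0 * _]mulrC mulfK // gt_eqF.
Qed.

(** Induction along the preorder given by the support of [N], measured by the number of indices
    below [c]. If [N c c] vanishes, one step expresses [c] by strictly lower indices. Otherwise
    transitivity makes the block of the class [K] of [c] entirely positive, and what lies outside
    [K] acts on it as a regular forcing. *)
Lemma regular_system (T : finType) (N : T -> T -> R) (x : nat -> T -> R) :
  (forall c d, 0 <= N c d) ->
  (forall c d e, 0 < N c d -> 0 < N d e -> 0 < N c e) ->
  (forall n c, x n.+1 c = \sum_d N c d * x n d) ->
  (forall c, 0 < x 0%N c) ->
  forall c, regular (fun n => x n c).
Proof.
move=> N0 Ntr xS x0.
have xge0 n c : 0 <= x n c.
  elim: n c => [|n IH] c; first exact: ltW.
  by rewrite xS sumr_ge0 // => j _; rewrite mulr_ge0.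
pose below c := finset (fun d => (d == c) || (0 < N c d)).
suff : forall m c, (#|below c| <= m)%N -> regular (fun n => x n c) by move=> h c; exact: h (leqnn _).
elim=> [c|m IH c cm].
  by rewrite leqn0 finset.cards_eq0 => /eqP/finset.setP/(_ c); rewrite !inE eqxx.
have lower d : 0 < N c d -> ~~ (0 < N d c) -> regular (fun n => x n d).
  move=> cd dc; apply: IH; rewrite -ltnS; apply: leq_trans cm; apply: proper_card.
  apply/properP; split.
    by apply/fintype.subsetP => e; rewrite !inE => /predU1P[->|/(Ntr _ _ _ cd)->]; rewrite ?cd orbT.
  exists c; rewrite !inE ?eqxx //= negb_or dc andbT.
  by apply/eqP => e; move: dc; rewrite -e in cd *; rewrite cd.
have regN d e : (0 < N d e -> regular (fun n => x n e)) -> regular (fun n => N d e * x n e).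
  move=> h; have := N0 d e; rewrite le_eqVlt => /predU1P[<-|de].
    by apply: (regular_ext _ (regular0 R)) => n; rewrite mul0r.
  by apply: regular_scale => //; exact: h.
have [cc|cc] := boolP (0 < N c c); last first.
  apply: regular_unshift; apply: (@regular_ext _ (fun n => \sum_d N c d * x n d)) => //.
  apply: regular_sum => d _; apply: regN => cd; apply: lower => //.
  by apply: contra cc; exact: Ntr.
pose K := finset (fun d => (0 < N c d) && (0 < N d c)).
have cK : c \in K by rewrite inE cc.
pose v (i : 'I_#|K|) := enum_val i.
have vK i : v i \in K by exact: enum_valP.
have := @regular_positive_system #|K| (fun i j => N (v i) (v j)) (fun n i => x n (v i))
  (fun n i => \sum_(d in finset.setC K) N (v i) d * x n d).
move=> /(_ _ _ _ _ _ (enum_rank_in cK c)); rewrite /v enum_rankK_in //; apply.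
- move=> i j; have := vK i; have := vK j; rewrite !inE => /andP[cj _] /andP[_ ic].
  exact: Ntr cj.
- move=> n i; rewrite xS (bigID [in K]) /= big_enum_val /=; congr (_ + _).
  by apply: eq_bigl => d; rewrite finset.in_setC.
- by [].
- by move=> n i; apply: sumr_ge0 => d _; rewrite mulr_ge0.
move=> i; apply: regular_sum => d; rewrite finset.in_setC inE negb_and => dK; apply: regN => id.
have : v i \in K by []. rewrite inE => /andP[ci _].
have cd : 0 < N c d := Ntr _ _ _ ci id.
by apply: lower => //; move: dK; rewrite cd.
Qed.

End System.

(** * Iterated morphisms *)

Section Words.

Definition ext (A : Type) (h : A -> seq A) (s : seq A) : seq A := flatten (map h s).
Definition itm (A : Type) (h : A -> seq A) (n : nat) (s : seq A) : seq A := iter n (ext h) s.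

Lemma ext_cat (A : Type) (h : A -> seq A) s t : ext h (s ++ t) = ext h s ++ ext h t.
Proof. by rewrite /ext map_cat flatten_cat. Qed.

Lemma itm_nil (A : Type) (h : A -> seq A) n : itm h n [::] = [::].
Proof. by elim: n => //= n ->. Qed.

Lemma itm_cat (A : Type) (h : A -> seq A) n s t : itm h n (s ++ t) = itm h n s ++ itm h n t.
Proof. by elim: n => //= n ->; rewrite ext_cat. Qed.

Lemma itm_cons (A : Type) (h : A -> seq A) n c s : itm h n (c :: s) = itm h n [:: c] ++ itm h n s.
Proof. by rewrite -itm_cat. Qed.

Lemma itmD (A : Type) (h : A -> seq A) m n s : itm h (m + n) s = itm h m (itm h n s).
Proof. exact: iterD. Qed.

Lemma itmS (A : Type) (h : A -> seq A) n s : itm h n.+1 s = itm h n (ext h s).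
Proof. exact: iterSr. Qed.

Lemma ext1 (A : Type) (h : A -> seq A) c : ext h [:: c] = h c.
Proof. by rewrite /ext /= cats0. Qed.

Lemma itmS1 (A : Type) (h : A -> seq A) n c : itm h n.+1 [:: c] = itm h n (h c).
Proof. by rewrite itmS ext1. Qed.

Lemma itm_flatten (A : Type) (h : A -> seq A) n s :
  itm h n s = flatten [seq itm h n [:: c] | c <- s].
Proof. by elim: s => [|c s IH]; rewrite ?itm_nil //= itm_cons IH. Qed.

Lemma size_itm (A : Type) (h : A -> seq A) n s :
  size (itm h n s) = (\sum_(c <- s) size (itm h n [:: c]))%N.
Proof.
elim: s => [|c s IH]; first by rewrite itm_nil big_nil.
by rewrite itm_cons size_cat IH big_cons.
Qed.

Lemma mem_itm (A : eqType) (h : A -> seq A) n s d :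
  (d \in itm h n s) = has (fun c => d \in itm h n [:: c]) s.
Proof.
elim: s => [|c s IH]; first by rewrite itm_nil.
by rewrite itm_cons mem_cat IH.
Qed.

Lemma itm_power (A : Type) (h : A -> seq A) P n s :
  itm (fun c => itm h P [:: c]) n s = itm h (n * P) s.
Proof.
by elim: n => [//|n IH]; rewrite mulSn itmD -IH /= /ext -itm_flatten.
Qed.

(** Applied to the occurrence pattern of iterated images and to the effect of a transducer: in both
    cases all powers of a suitable power of the morphism look alike. *)
Lemma iter_idempotent (X : finType) (F : X -> X) (x : X) :
  exists P, (0 < P)%N /\ forall n, (0 < n)%N -> iter (n * P) F x = iter P F x.
Proof.
have [i [j [ij e]]] : exists i j, (i < j)%N /\ iter i F x = iter j F x.
  have := @leq_card _ _ (fun i : 'I_#|X|.+1 => iter i F x).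
  rewrite card_ord ltnn => h; apply: contrapT => nh; apply: notF; apply: h => i j e.
  apply: val_inj; case: (ltngtP i j) => // ij; exfalso; apply: nh.
    by exists i, j.
  by exists j, i.
have per m k : (i <= m)%N -> iter (m + k * (j - i)) F x = iter m F x.
  move=> im; elim: k => [|k IH]; first by rewrite addn0.
  rewrite mulSn addnCA -[m](subnK im) (_ : j - i + _ = m - i + k * (j - i) + j)%N; last by lia.
  by rewrite iterD -e -iterD (_ : _ + i = m + k * (j - i))%N ?subnK //; lia.
(* A multiple of the period [j - i] that lies beyond the preperiod [i]. *)
exists ((j - i) * i.+1)%N; split=> [|n n0]; first by rewrite muln_gt0 subn_gt0 ij.
rewrite -[in LHS](prednK n0) mulSn [X in _ (_ + X)%N](_ : _ = n.-1 * i.+1 * (j - i))%N; last by lia.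
by apply: per; apply: leq_trans (leqnSn i) (leq_pmull _ _); rewrite subn_gt0.
Qed.

Lemma big_count (R : pzSemiRingType) (T : finType) (s : seq T) (F : T -> R) :
  \sum_(c <- s) F c = \sum_c (count_mem c s)%:R * F c.
Proof.
elim: s => [|c s IH]; first by rewrite big_nil big1 // => d _; rewrite mul0r.
rewrite big_cons IH [RHS](eq_bigr (fun d => (c == d)%:R * F d + (count_mem d s)%:R * F d)).
  rewrite big_split /=; congr (_ + _); rewrite (bigD1 c) //= eqxx mul1r big1 ?addr0 // => d /negbTE dc.
  by rewrite eq_sym dc mul0r.
by move=> d _; rewrite -mulrDl -natrD.
Qed.

(** [P] is chosen so that the same letters occur in the images under all multiples of [P].
    Occurrence in [itm h P [:: c]] is then transitive, as [regular_system] requires, and the residue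
    [r] is absorbed into the starting word. *)
Lemma regular_sizes (R : realType) (T : finType) (h : T -> seq T) :
  exists P, (0 < P)%N /\
   forall s r, regular (fun n => (size (itm h (n * P + r) s))%:R : R).
Proof.
pose pat n : {ffun T -> {ffun T -> bool}} := [ffun c => [ffun d => d \in itm h n [:: c]]].
pose F (E : {ffun T -> {ffun T -> bool}}) : {ffun T -> {ffun T -> bool}} :=
  [ffun c => [ffun e => has (fun d => E d e) (h c)]].
have patE n : pat n = iter n F (pat 0%N).
  elim: n => [//|n IH]; rewrite iterS -IH; apply/ffunP => c; rewrite !ffunE; apply/ffunP => e.
  rewrite !ffunE itmS1 mem_itm; apply: eq_has => d; by rewrite !ffunE.
have [P [P0 hP]] := iter_idempotent F (pat 0%N).
exists P; split=> //.
pose N c d : R := (count_mem d (itm h P [:: c]))%:R.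
pose x n c : R := (size (itm h (n * P) [:: c]))%:R.
have Npos c d : (0 < N c d) = (d \in itm h P [:: c]) by rewrite ltr0n -has_count has_pred1.
have reg c : regular (fun n => x n c).
  apply: (@regular_system R T N x) => //.
  - move=> c' d e; rewrite !Npos => cd de.
    have : pat (2 * P)%N = pat P by rewrite (patE (2 * P)%N) (patE P) hP.
    move/ffunP/(_ c')/ffunP/(_ e); rewrite !ffunE => <-.
    by rewrite mul2n -addnn itmD mem_itm; apply/hasP; exists d.
  - by move=> n c'; rewrite /x mulSn addnC itmD size_itm natr_sum (big_count _ (x n)).
move=> s r; apply: (@regular_ext R (fun n => \sum_(c <- itm h r s) x n c)).
  by move=> n; rewrite itmD size_itm natr_sum.
by apply: regular_sum => c _; exact: reg.
Qed.

End Words.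

(** * The dominant eigenvalue *)

Section Dominant.
Variable R : realType.

(** A bare predicate, so that one theorem serves both for the rationals and for the algebraic
    numbers. The last clause includes 0, whose inverse is 0. *)
Definition subfield_pred (S : R -> Prop) :=
  [/\ S 1, forall x y, S x -> S y -> S (x - y), forall x y, S x -> S y -> S (x * y) &
      forall x, S x -> S x^-1].

Lemma subfield0 S : subfield_pred S -> S 0.
Proof. by case=> S1 SB _ _; rewrite -(subrr 1); exact: SB. Qed.

Lemma subfieldD S x y : subfield_pred S -> S x -> S y -> S (x + y).
Proof.
move=> hS Sx Sy; have [_ SB _ _] := hS; rewrite -[y]opprK; apply: (SB) => //.
by rewrite -[- y]add0r; apply: (SB) => //; exact: subfield0.
Qed.

Lemma subfield_nat S n : subfield_pred S -> S n%:R.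
Proof.
move=> hS; elim: n => [|n IH]; first exact: subfield0.
by rewrite -natr1; apply: subfieldD => //; case: hS.
Qed.

Lemma subfield_sum S (I : Type) (r : seq I) (P : pred I) (F : I -> R) : subfield_pred S ->
  (forall i, P i -> S (F i)) -> S (\sum_(i <- r | P i) F i).
Proof.
move=> hS h; elim/big_ind: _ => //; first exact: subfield0.
by move=> x y; exact: subfieldD.
Qed.

Definition poly_in (S : R -> Prop) (p : {poly R}) := forall i, S p`_i.

(** Synthetic division read from the top: each coefficient of the quotient is a coefficient of [p]
    plus [a] times the next higher coefficient of the quotient. *)
Lemma poly_in_divX1 S (p q : {poly R}) a : subfield_pred S -> S a -> poly_in S p ->
  p = q * ('X - a%:P) -> poly_in S q.
Proof.
move=> hS Sa Sp e; have [_ _ SM _] := hS.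
have rec i : q`_i = p`_i.+1 + a * q`_i.+1.
  by rewrite e mulrBr coefB coefMX coefMC /=; ring.
suff h k i : (size q <= i + k)%N -> S q`_i by move=> i; apply: (h (size q)); exact: leq_addl.
elim: k i => [|k IH] i; first by rewrite addn0 => /(nth_default 0) ->; exact: subfield0.
rewrite addnS -addSn => /IH Sq; rewrite rec; apply: subfieldD => //; exact: SM.
Qed.

Lemma poly_in_divX S (p q : {poly R}) a m : subfield_pred S -> S a -> poly_in S p ->
  p = q * ('X - a%:P) ^+ m -> poly_in S q.
Proof.
move=> hS Sa Sp; elim: m q => [|m IH] q e; first by rewrite mulr1 in e; rewrite -e.
by apply: (@poly_in_divX1 S (q * ('X - a%:P)) q a) => //; apply: IH; rewrite e exprS mulrA.
Qed.

Definition mx_in (S : R -> Prop) m n (M : 'M[R]_(m, n)) := forall i j, S (M i j).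

Lemma mx_in_mul S m n p (A : 'M[R]_(m, n)) (B : 'M[R]_(n, p)) :
  subfield_pred S -> mx_in S A -> mx_in S B -> mx_in S (A *m B).
Proof.
move=> hS SA SB i j; rewrite mxE; apply: subfield_sum => // k _.
by case: hS => _ _ SM _; exact: SM.
Qed.

Lemma mx_in_scalar S n a : subfield_pred S -> S a -> mx_in S (a%:M : 'M[R]_n).
Proof.
move=> hS Sa i j; rewrite mxE; case: (i == j); rewrite ?mulr1n ?mulr0n //.
exact: subfield0.
Qed.

Lemma mx_in_horner S n (A : 'M[R]_n.+1) (p : {poly R}) :
  subfield_pred S -> mx_in S A -> poly_in S p -> mx_in S (horner_mx A p).
Proof.
move=> hS SA; elim/poly_ind: p => [|p c IH] Sp.
  by rewrite rmorph0 => i j; rewrite mxE; exact: subfield0.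
have Sc : S c by have := Sp 0%N; rewrite coefD coefMX coefC /= add0r.
have Sp' : poly_in S p.
  by move=> i; have := Sp i.+1; rewrite coefD coefMX coefC /= addr0.
rewrite rmorphD rmorphM /= horner_mx_X horner_mx_C => i j; rewrite mxE.
by apply: subfieldD => //; [apply: mx_in_mul => //; exact: IH | exact: mx_in_scalar].
Qed.

Variables (m : nat) (N0 : 'M[int]_m.+1) (v0 : 'cV[R]_m.+1) (g : R^nat) (th : R)
  (r : 'I_m.+1 -> R).
Let N : 'M[R]_m.+1 := map_mx intr N0.
Hypothesis th0 : 0 < th.
Hypothesis g0 : forall n, 0 < g n.
Hypothesis hr : forall i, (fun n => (N ^+ n *m v0) i 0 / g n) @ \oo --> r i.
Hypothesis hg : (fun n => g n.+1 / g n) @ \oo --> th.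
Hypothesis rn0 : exists i, r i != 0.

(** Along [N ^+ n *m v0] one more factor [N] acts in the limit as the scalar [th], because
    [g n.+1 / g n] tends to [th]. Polynomials in [N] follow by Horner's scheme. *)
Let limit_horner (p : {poly R}) i :
  (fun n => (N ^+ n *m (horner_mx N p *m v0)) i 0 / g n) @ \oo --> p.[th] * r i.
Proof.
elim/poly_ind: p i => [|p c IH] i.
  rewrite horner0 mul0r; apply: near_cvg (cvg_cst (0 : R)); apply: nearW => n.
  by rewrite rmorph0 mul0mx mulmx0 mxE mul0r.
rewrite hornerMXaddC mulrDl.
have h1 : (fun n => (N ^+ n.+1 *m (horner_mx N p *m v0)) i 0 / g n) @ \oo --> p.[th] * th * r i.
  have h2 : (fun n => (N ^+ n.+1 *m (horner_mx N p *m v0)) i 0 / g n.+1) @ \oo --> p.[th] * r i.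
    by rewrite (@cvg_shiftS _ (fun n => (N ^+ n *m (horner_mx N p *m v0)) i 0 / g n)).
  rewrite mulrAC; apply: near_cvg (cvg_mul h2 hg); apply: nearW => n.
  by rewrite mulrA divfK // gt_eqF.
have h2 : (fun n => c * ((N ^+ n *m v0) i 0 / g n)) @ \oo --> c * r i by apply: cvgMl_tmp.
apply: near_cvg (cvg_add h1 h2); apply: nearW => n.
rewrite rmorphD rmorphM /= horner_mx_X horner_mx_C mulmxDl mulmxDr [in RHS]mxE mulrDl; congr (_ + _).
  congr (_ / _); congr (_ i 0); rewrite exprSr -!mulmxE -!mulmxA; congr (_ *m _).
  by rewrite !mulmxA; congr (_ *m _); exact: comm_mx_horner.
by rewrite mul_scalar_mx -scalemxAr [in RHS]mxE mulrA.
Qed.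

Let chi := map_poly intr (char_poly N0) : {poly R}.

Let chiE : horner_mx N chi = 0.
Proof. by rewrite /chi map_char_poly; exact: Cayley_Hamilton. Qed.

(** By Cayley-Hamilton the limit in [limit_horner] is 0 for [chi], and some [r i] is nonzero. *)
Lemma dominant_root : root chi th.
Proof.
have [i ri] := rn0; have := @limit_horner chi i.
rewrite chiE => h.
have h0 : (fun n => (N ^+ n *m (0 *m v0)) i 0 / g n) @ \oo --> (0 : R).
  apply: near_cvg (cvg_cst (0 : R)); apply: nearW => n.
  by rewrite mul0mx mulmx0 mxE mul0r.
have /eqP : chi.[th] * r i = 0 by exact: (cvg_unique _ h h0).
by rewrite mulf_eq0 (negbTE ri) orbF.
Qed.

(* With chi = q (X - th)^e and q(th) <> 0, let z be the last nonzero iterate of N - th on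
   q(N) v0; both r and z are, up to a factor, the limiting direction of N^n q(N) v0. *)
Lemma dominant_ratio (S : R -> Prop) : subfield_pred S -> S th -> mx_in S v0 ->
  forall i j, r j != 0 -> S (r i / r j).
Proof.
move=> hS Sth Sv0.
have [_ SB SM SV] := hS.
have [e [q]] := multiplicity_XsubC chi th.
have chi0 : chi != 0.
  by rewrite /chi map_char_poly monic_neq0 // char_poly_monic.
rewrite chi0 /= => qth chiq.
have Sint z : S z%:~R.
  case: z => n; first exact: subfield_nat.
  rewrite NegzE mulrNz -[- _]add0r; apply: (SB); [exact: subfield0 | exact: subfield_nat].
have SN : mx_in S N by move=> i j; rewrite mxE; exact: Sint.
have Sq : poly_in S q.
  by apply: (poly_in_divX hS Sth _ chiq) => i; rewrite coef_map; exact: Sint.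
pose v := horner_mx N q *m v0.
pose D := N - th%:M.
have DE : D = horner_mx N ('X - th%:P) by rewrite rmorphB /= horner_mx_X horner_mx_C.
have De : D ^+ e *m v = 0.
  have e1 : D ^+ e * horner_mx N q = 0.
    rewrite DE -rmorphXn -(rmorphM (horner_mx N)) -chiE chiq; congr (horner_mx N _); exact: mulrC.
  by rewrite /v mulmxA mulmxE e1 mul0mx.
have vlim i : (fun n => (N ^+ n *m v) i 0 / g n) @ \oo --> q.[th] * r i := @limit_horner q i.
have qth0 : q.[th] != 0 by [].
have v0n : v != 0.
  apply/eqP => ve; have [i ri] := rn0; have := vlim i; rewrite ve => h.
  have h0 : (fun n => (N ^+ n *m (0 : 'cV[R]_m.+1)) i 0 / g n) @ \oo --> (0 : R).
    by apply: near_cvg (cvg_cst (0 : R)); apply: nearW => n; rewrite mulmx0 mxE mul0r.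
  have /eqP : q.[th] * r i = 0 by exact: (cvg_unique _ h h0).
  by rewrite mulf_eq0 (negbTE ri) (negbTE qth0).
have exP : exists k, D ^+ k *m v == 0 by exists e; apply/eqP.
(* [k.+1] is the least power of [D] that kills [v], positive since [v] is nonzero; so [z] below is
   an eigenvector of [N] for [th]. *)
case: (ex_minnP exP) => -[|k]; first by rewrite expr0 mul1mx (negbTE v0n).
move=> /eqP Dk1 kmin.
pose z := D ^+ k *m v.
have zn0 : z != 0 by apply/negP => /kmin; rewrite ltnn.
have Dbig i : (k < i)%N -> D ^+ i *m v = 0.
  by move=> /subnK <-; rewrite exprD -mulmxE -mulmxA Dk1 mulmx0.
(* The expansion of [(th + D) ^+ n] stops at [k]. Writing [th ^+ n * th ^- i] for [th ^+ (n - i)]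
   makes the range of summation independent of [n]; for [i > n] the binomial is 0. *)
have Nexp n : N ^+ n *m v = \sum_(i < k.+1) ('C(n, i)%:R * th ^+ n * th ^- i) *: (D ^+ i *m v).
  have -> : N = th%:M + D by rewrite /D addrC subrK.
  rewrite exprDn_comm; last by rewrite /GRing.comm -!mulmxE scalar_mxC.
  have -> : (\sum_(i < n.+1) (th%:M ^+ (n - i) * D ^+ i) *+ 'C(n, i)) *m v =
    \sum_(i < n.+1) ('C(n, i)%:R * th ^+ (n - i)) *: (D ^+ i *m v).
    rewrite mulmx_suml; apply: eq_bigr => i _.
    rewrite -(rmorphXn (@scalar_mx R m.+1)) /= -mulmxE mul_scalar_mx.
    by rewrite -scaler_nat scalerA -scalemxAl.
  have E i : ('C(n, i)%:R * th ^+ (n - i)) *: (D ^+ i *m v) =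
     ('C(n, i)%:R * th ^+ n * th ^- i) *: (D ^+ i *m v).
    have [ni|ni] := leqP i n; last by rewrite bin_small // !mul0r.
    congr (_ *: _); rewrite -mulrA; congr (_ * _).
    by rewrite -{2}(subnK ni) exprD mulfK // expf_neq0 // gt_eqF.
  pose G i := ('C(n, i)%:R * th ^+ n * th ^- i) *: (D ^+ i *m v).
  rewrite (eq_bigr (fun i : 'I_n.+1 => G i)) => [|i _]; last exact: E.
  rewrite -/(G _) -[LHS](big_mkord xpredT G) -[RHS](big_mkord xpredT G).
  have [kn|nk] := leqP k n.
    rewrite (@big_cat_nat _ _ _ k.+1 0 n.+1) //= [X in _ + X]big_nat_cond [X in _ + X]big1 ?addr0 //.
    by move=> i /andP[/andP[ki _] _]; rewrite /G Dbig // scaler0.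
  rewrite [RHS](@big_cat_nat _ _ _ n.+1 0 k.+1) //=; last by rewrite ltnS ltnW.
  rewrite [X in _ + X]big_nat_cond [X in _ + X]big1 ?addr0 //.
  by move=> i /andP[/andP[ni _] _]; rewrite /G bin_small // !mul0r scale0r.
pose d n : R := scale k th n.
have zlim i : (fun n => (N ^+ n *m v) i 0 / d n) @ \oo --> th ^- k * z i 0.
  have h0 (j : 'I_k.+1) : (fun n => binR R n j / binR R n k * th ^- j * (D ^+ j *m v) i 0) @ \oo -->
     (if j == ord_max then 1 else 0) * th ^- j * (D ^+ j *m v) i 0.
    apply: cvgMr_tmp; apply: cvgMr_tmp; case: eqP => [->|/eqP jk].
      apply: near_cvg (cvg_cst (1 : R)).
      by have := near_binR_gt0 R k; apply: filterS => n b0; rewrite /= divff // gt_eqF.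
    by apply: cvg_bin_lt; have := ltn_ord j; rewrite ltnS leq_eqVlt => /predU1P[jk'|//]; case/eqP: jk; exact: val_inj.
  have <- : \sum_(j < k.+1) (if j == ord_max then 1 else 0) * th ^- j * (D ^+ j *m v) i 0 = th ^- k * z i 0.
    rewrite (bigD1 ord_max) //= eqxx mul1r big1 ?addr0 // => j /negbTE ->.
    by rewrite !mul0r.
  apply: near_cvg (@cvg_sum_seq R _ (index_enum 'I_k.+1) _ _ h0).
  have := near_binR_gt0 R k; apply: filterS => n b0.
  rewrite Nexp summxE mulr_suml; apply: eq_bigr => j _.
  rewrite [in RHS]mxE /d /scale -/(binR R n j).
  by field; rewrite !gt_eqF // exprn_gt0.
(* One vector sequence is normalised both by [g] and by [d]. Comparing products of coordinates shows
   that [r] and [z] are proportional, without relating [g] to [d]. *)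
have cross i j : r i * z j 0 = r j * z i 0.
  have e1 := cvg_mul (vlim i) (zlim j); have e2 := cvg_mul (vlim j) (zlim i).
  have : q.[th] * r i * (th ^- k * z j 0) = q.[th] * r j * (th ^- k * z i 0).
    have e2' : (fun n => (N ^+ n *m v) i 0 / g n * ((N ^+ n *m v) j 0 / d n)) @ \oo -->
        q.[th] * r j * (th ^- k * z i 0).
      by apply: near_cvg e2; apply: nearW => n; rewrite mulrACA [RHS]mulrACA; congr (_ * _); rewrite mulrC.
    exact: (cvg_unique _ e1 e2').
  have t0 : q.[th] * th ^- k != 0 by rewrite mulf_neq0 // invr_neq0 // expf_neq0 // gt_eqF.
  move=> e3; apply: (mulfI t0).
  by rewrite mulrACA e3 mulrACA.
have Sz i : S (z i 0).
  have Sv : mx_in S v by apply: mx_in_mul => //; exact: mx_in_horner.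
  have SD : mx_in S D.
    by move=> i1 i2; rewrite /D !mxE -mulr_natr; apply: (SB); [exact: Sint | apply: (SM) => //; exact: subfield_nat].
  rewrite /z; suff h : mx_in S (D ^+ k *m v) by exact: h.
  elim: (k) => [|k' IH]; first by rewrite expr0 mul1mx.
  by rewrite exprS -mulmxE -mulmxA; exact: mx_in_mul.
move=> i j rj; have zj : z j 0 != 0.
  apply/negP => /eqP zj; move: zn0; apply/negP; rewrite negbK; apply/eqP/matrixP => i' o.
  rewrite ord1 [RHS]mxE; apply/eqP; have := cross i' j; rewrite zj mulr0 => /esym/eqP.
  by rewrite mulf_eq0 (negbTE rj).
have -> : r i / r j = z i 0 / z j 0.
  by apply/eqP; rewrite eqr_div //; apply/eqP; rewrite cross mulrC.
by apply: (SM) => //; exact: SV.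
Qed.

End Dominant.

(** * Limits of ratios of image lengths *)

Section Growth_rate.
Variables (R : realType) (T : finType) (h : T -> seq T) (a : T).
Let A n := size (itm h n [:: a]).
Hypothesis A0 : forall n, (0 < A n)%N.

(** The alphabet may contain letters that outgrow [a] without occurring in its images, and their
    sizes divided by [A n] need not converge. The dominated letters do not have this defect and are
    closed under [h]. *)
Definition dominated (s : seq T) := exists K, forall n, (size (itm h n s) <= K * A n)%N.

Definition max_size := (\max_c size (h c))%N.

Lemma size_ext_le s : (size (ext h s) <= max_size * size s)%N.
Proof.
elim: s => [//|c s IH]; rewrite /ext /= size_cat mulnS.
by apply: leq_add IH; exact: leq_bigmax.
Qed.

Lemma size_itmS_le n s : (size (itm h n.+1 s) <= max_size * size (itm h n s))%N.
Proof. exact: size_ext_le. Qed.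

Lemma size_itm_mem n s c : c \in s -> (size (itm h n [:: c]) <= size (itm h n s))%N.
Proof.
by move=> cs; rewrite (size_itm _ _ s) (big_rem c) //= leq_addr.
Qed.

Lemma dominated_mem s c : dominated s -> c \in s -> dominated [:: c].
Proof.
move=> [K hK] cs; exists K => n; apply: leq_trans (hK n); exact: size_itm_mem.
Qed.

Lemma dominated_itm r s : dominated s -> dominated (itm h r s).
Proof.
move=> [K hK]; elim: r => [|r [K' IH]]; first by exists K.
exists (K' * max_size)%N => n; rewrite [itm h r.+1 s]/(ext h _) -itmS.
by apply: leq_trans (IH n.+1) _; rewrite -mulnA leq_mul2l size_itmS_le orbT.
Qed.

Lemma dominant_growth :
  exists P, (0 < P)%N /\ exists th : R,
   [/\ 0 < th, (fun n => (A (n.+1 * P))%:R / (A (n * P))%:R) @ \oo --> th,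
     exists p : {poly int}, p \is monic /\ root (map_poly intr p) th &
     forall S, subfield_pred S -> S th -> forall s r, dominated s ->
       exists rho, S rho /\
         (fun n => (size (itm h (n * P + r) s))%:R / (A (n * P))%:R) @ \oo --> rho].
Proof.
have [P [P0 reg]] := regular_sizes R h.
exists P; split=> //.
pose g n : R := (A (n * P))%:R.
have g0 n : 0 < g n by rewrite ltr0n.
have [k [t [C [t0 C0 hC]]]] : exists (k : nat) (t C : R),
    [/\ 0 < t, 0 < C & (fun n => g n / scale k t n) @ \oo --> C].
  have /(@regular_ext R _ g)[|[n0 _ /(_ n0 (leqnn _))]|//] := reg [:: a] 0%N.
    by move=> n; rewrite addn0.
  by move=> e; have := g0 n0; rewrite e ltxx.
have hg : (fun n => g n.+1 / g n) @ \oo --> t.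
  have h1 : (fun n => g n.+1 / scale k t n.+1) @ \oo --> C.
    by rewrite (@cvg_shiftS _ (fun n => g n / scale k t n)).
  have := cvg_mul (cvg_mul h1 (cvg_scaleS k t0)) (cvg_inv (negbT (gt_eqF C0)) hC).
  rewrite [X in _ --> X]mulrAC divff ?gt_eqF // mul1r; apply: near_cvg.
  exists k => // n /= kn.
  have s0 : 0 < scale k t n by rewrite mulr_gt0 ?exprn_gt0 // binR_gt0.
  have s1 : 0 < scale k t n.+1 by rewrite mulr_gt0 ?exprn_gt0 // binR_gt0 // leqW.
  by field; rewrite !gt_eqF // g0.
pose x n c : R := (size (itm h (n * P) [:: c]))%:R.
pose Z c := `[< dominated [:: c] >].
have Za : Z a by apply/asboolP; exists 1%N => n; rewrite mul1n.
have hlim c : exists rc : R, Z c -> (fun n => x n c / g n) @ \oo --> rc.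
  have [Zc|] := boolP (Z c); last by exists 0.
  have /asboolP[K hK] := Zc.
  have f0 : forall n, 0 <= x n c by move=> n; rewrite /x ler0n.
  have fK : \forall n \near \oo, x n c <= K%:R * g n.
    by apply: nearW => n; rewrite -natrM ler_nat.
  have fr : regular (fun n => x n c).
    by apply: (regular_ext _ (reg [:: c] 0%N)) => n; rewrite addn0.
  have [D [_ hD]] := regular_dominated t0 C0 f0 fK hC fr.
  exists (D / C) => _; have := cvg_mul hD (cvg_inv (negbT (gt_eqF C0)) hC); apply: near_cvg.
  have := near_scale_gt0 k t0; apply: filterS => n s0.
  by field; rewrite !gt_eqF // g0.
have [rc hrc] := choice hlim.
have rca : rc a = 1.
  have h1 : (fun n => x n a / g n) @ \oo --> (1 : R).
    by apply: near_cvg (cvg_cst (1 : R)); apply: nearW => n; rewrite /x /g divff // gt_eqF // g0.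
  exact: (cvg_unique _ (hrc _ Za) h1).
(* Polynomials are evaluated at square matrices of size [m.+1]; the letter [a] shows that the
   alphabet has such a size. *)
have cT : #|T| = #|T|.-1.+1 by rewrite prednK //; apply/card_gt0P; exists a.
pose m := #|T|.-1.
pose e (i : 'I_m.+1) := nth a (enum T) i.
have eK c : exists i, e i = c.
  have lt : (index c (enum T) < m.+1)%N by rewrite -cT cardE index_mem mem_enum.
  by exists (Ordinal lt); rewrite /e /= nth_index // mem_enum.
have sumT (F : T -> R) : \sum_c F c = \sum_(i < m.+1) F (e i).
  rewrite -big_enum (big_nth a) big_mkord -cardE /e.
  by move: cT; rewrite -/m => ->.
(* Rows outside [Z] are zero and images of letters in [Z] stay in [Z], so powers of [N] applied to
   the indicator [v0] give the image lengths on [Z]. *)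
pose N0 : 'M[int]_m.+1 := \matrix_(i, j) (if Z (e i) then (count_mem (e j) (itm h P [:: e i]))%:Z else 0).
pose v0 : 'cV[R]_m.+1 := \col_i (Z (e i))%:R.
pose N : 'M[R]_m.+1 := map_mx intr N0.
have xN n i : (N ^+ n *m v0) i 0 = if Z (e i) then x n (e i) else 0.
  elim: n i => [|n IH] i.
    by rewrite expr0 mul1mx mxE; case: (Z (e i)).
  rewrite exprS -mulmxE -mulmxA mxE.
  under eq_bigr => j _ do rewrite IH 2!mxE.
  have [Zi|Zi] := boolP (Z (e i)); last by rewrite big1 // => j _; rewrite mul0r.
  rewrite /x mulSn addnC itmD size_itm natr_sum (big_count _ (x n)).
  rewrite (sumT (fun c => (count_mem c (itm h P [:: e i]))%:R * x n c)); apply: eq_bigr => j _.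
  have [Zj|Zj] := boolP (Z (e j)) => //.
  rewrite mulr0 (count_memPn _) ?mul0r //; apply: contra Zj => mem.
  apply/asboolP; apply: dominated_mem mem; apply: dominated_itm; exact/asboolP.
pose r i := if Z (e i) then rc (e i) else 0.
have hr i : (fun n => (N ^+ n *m v0) i 0 / g n) @ \oo --> r i.
  rewrite /r; have [Zi|Zi] := boolP (Z (e i)).
    by apply: near_cvg (hrc _ Zi); apply: nearW => n; rewrite xN Zi.
  by apply: near_cvg (cvg_cst (0 : R)); apply: nearW => n; rewrite xN (negbTE Zi) mul0r.
have [ia eia] := eK a.
have ria : r ia = 1 by rewrite /r eia Za rca.
have ria0 : r ia != 0 by rewrite ria oner_neq0.
have ex0 : exists i, r i != 0 by exists ia.
exists t; split=> //.
  exists (char_poly N0); split; first exact: char_poly_monic.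
  exact: (@dominant_root R m N0 v0 g t r g0 hr hg ex0).
move=> S hS St s q ds.
(* The coordinate of [a] is 1, so the ratios of [dominant_ratio] against it are the limits
   themselves. *)
have Src c : Z c -> S (rc c).
  move=> Zc; have [i ei] := eK c.
  have := @dominant_ratio R m N0 v0 g t r t0 g0 hr hg ex0 S hS St _ i ia ria0.
  rewrite ria divr1 /r ei Zc; apply.
  by move=> i' j'; rewrite mxE; exact: subfield_nat.
exists (\sum_(c <- itm h q s | Z c) rc c); split; first exact: subfield_sum.
rewrite big_mkcond.
apply: near_cvg (@cvg_sum_seq R _ (itm h q s) (fun c n => if Z c then x n c / g n else 0) _ _).
  apply: nearW => n; rewrite itmD size_itm natr_sum mulr_suml big_seq [RHS]big_seq.
  apply: eq_bigr => c cs; rewrite ifT //; apply/asboolP.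
  by apply: dominated_mem cs; exact: dominated_itm.
move=> c; case: (boolP (Z c)) => Zc; first exact: hrc.
exact: cvg_cst.
Qed.

End Growth_rate.

(** * Marked letters in a fixed point *)

Section FixedPoint.
Variables (T : Type) (H : T -> seq T) (a : T) (X : seq T) (U : nat -> T).
Hypothesis Ha : H a = a :: X.
Hypothesis HX : forall n, itm H n X <> [::].
Hypothesis HU : forall n i, (i < size (itm H n [:: a]))%N -> U i = nth a (itm H n [:: a]) i.
Let A n := size (itm H n [:: a]).

Lemma itm_letterS n : itm H n.+1 [:: a] = itm H n [:: a] ++ itm H n X.
Proof. by rewrite itmS1 Ha itm_cons. Qed.

Lemma size_letterS n : A n.+1 = (A n + size (itm H n X))%N.
Proof. by rewrite /A itm_letterS size_cat. Qed.

Lemma size_letter_lt n : (A n < A n.+1)%N.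
Proof. by rewrite size_letterS -addn1 leq_add2l lt0n -/(nilp _); apply/nilP; exact: HX. Qed.

Lemma size_letter_mono m n : (m <= n)%N -> (A m <= A n)%N.
Proof.
move/subnK <-; elim: (n - m)%N => // k IH.
by rewrite addSn (leq_trans IH) // ltnW // size_letter_lt.
Qed.

Lemma size_letter_gt n : (n < A n)%N.
Proof. by elim: n => // n IH; apply: leq_ltn_trans IH (size_letter_lt _). Qed.

Definition pre t := mkseq U t.

Lemma size_pre t : size (pre t) = t. Proof. exact: size_mkseq. Qed.

Lemma pre_take m t : (t <= A m)%N -> pre t = take t (itm H m [:: a]).
Proof.
move=> tm; apply: (@eq_from_nth _ a); first by rewrite size_pre size_takel.
move=> i; rewrite size_pre => it; rewrite nth_mkseq // nth_take //.
by apply: HU; exact: leq_trans it tm.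
Qed.

Lemma pre_full m : pre (A m) = itm H m [:: a].
Proof. by rewrite (@pre_take m) // take_size. Qed.

Lemma preS t : pre t.+1 = rcons (pre t) (U t).
Proof. exact: mkseqS. Qed.

(** The fixed point is the concatenation of the blocks [itm H n [:: U s]], and block [t] starts at
    [pos n t]. *)
Definition pos n t := size (itm H n (pre t)).

Lemma itm_pre n t : itm H n (pre t) = pre (pos n t).
Proof.
have e : itm H (n + t) [:: a] = itm H n (pre t) ++ itm H n (drop t (itm H t [:: a])).
  rewrite itmD -{1}(cat_take_drop t (itm H t [:: a])) itm_cat -pre_take //.
  exact: ltnW (size_letter_gt t).
rewrite (@pre_take (n + t) (pos n t)); first by rewrite e; exact/esym/take_size_cat.
by rewrite /A e size_cat leq_addr.
Qed.

Lemma posS n t : pos n t.+1 = (pos n t + size (itm H n [:: U t]))%N.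
Proof. by rewrite /pos preS -cats1 itm_cat size_cat. Qed.

Lemma pos_mono n s t : (s <= t)%N -> (pos n s <= pos n t)%N.
Proof.
move/subnK <-; elim: (t - s)%N => // k IH.
by rewrite addSn posS (leq_trans IH) // leq_addr.
Qed.

Lemma pos_size n m : pos n (A m) = A (n + m).
Proof. by rewrite /pos pre_full -itmD. Qed.

Lemma pos_ge n s : (0 < s)%N -> (A n <= pos n s)%N.
Proof. by move=> s0; rewrite -(addn0 n) -pos_size addn0; exact: pos_mono. Qed.

Lemma nth_pos n t k : (k < size (itm H n [:: U t]))%N ->
  U (pos n t + k) = nth a (itm H n [:: U t]) k.
Proof.
move=> kt; have lt : (pos n t + k < pos n t.+1)%N by rewrite posS ltn_add2l.
have : nth a (pre (pos n t.+1)) (pos n t + k) = U (pos n t + k) by rewrite nth_mkseq.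
rewrite -itm_pre preS -cats1 itm_cat nth_cat -/(pos n t) ltnNge leq_addr /= addKn.
by move=> ->.
Qed.

Lemma pos_block n t : exists s, (pos n s <= t < pos n s.+1)%N.
Proof.
have h : exists s, (t < pos n s)%N.
  by exists (A t); rewrite pos_size; apply: leq_ltn_trans (leq_addl n t) (size_letter_gt _).
case: (ex_minnP h) => -[|s]; first by rewrite /pos itm_nil.
move=> ts smin; exists s; rewrite ts andbT leqNgt; apply/negP => /smin.
by rewrite ltnn.
Qed.

Lemma letter_level t : (0 < t)%N -> exists m, (A m <= t < A m.+1)%N.
Proof.
move=> t0; have h : exists m, (t < A m)%N by exists t; exact: size_letter_gt.
case: (ex_minnP h) => -[|m].
  by rewrite /A /= ltnS leqn0 => /eqP te; rewrite te in t0.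
move=> tm mmin; exists m; rewrite tm andbT leqNgt; apply/negP => /mmin.
by rewrite ltnn.
Qed.

Variable b : pred T.
Hypothesis Hb : forall c, b c = has b (H c).

Lemma has_itm_inv n s : has b (itm H n s) = has b s.
Proof.
elim: n => [//|n IH]; rewrite /itm iterS -/(itm H n s) -{}IH.
elim: (itm H n s) => [//|c w IH]; rewrite -cat1s ext_cat has_cat ext1 -Hb IH.
by rewrite has_cat /= orbF.
Qed.

Hypothesis Hinf : forall N, exists t, (N <= t)%N /\ b (U t).

(** Every letter after the first comes from some [itm H m X], and an unmarked [X] would only have
    unmarked images. *)
Lemma has_tail : has b X.
Proof.
apply: contraT => nX; have [t [t0 bt]] := Hinf 1.
have [m /andP[mt tm]] := letter_level t0.
move: bt; rewrite (HU tm) itm_letterS nth_cat ltnNge mt /= => bt.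
suff : has b (itm H m X) by rewrite has_itm_inv (negbTE nX).
apply/(has_nthP a); exists (t - A m)%N => //.
by rewrite ltn_subLR // -size_letterS.
Qed.

Lemma letter_level_marked m : exists t, [/\ (A m <= t)%N, (t < A m.+1)%N & b (U t)].
Proof.
have : has b (itm H m X) by rewrite has_itm_inv has_tail.
move=> /(has_nthP a)[k kX bk]; exists (A m + k)%N.
have lt : (A m + k < A m.+1)%N by rewrite size_letterS ltn_add2l.
split=> //; first exact: leq_addr.
by rewrite (HU lt) itm_letterS nth_cat ltnNge leq_addr /= addKn.
Qed.

End FixedPoint.

Lemma pred_neighbours (B : pred nat) t p0 q0 : (p0 < t)%N -> B p0 -> (t <= q0)%N -> B q0 ->
  exists p q, [/\ (p < t)%N, (t <= q)%N, B p && B q & forall i, (p < i < q)%N -> ~~ B i].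
Proof.
move=> p0t Bp0 tq0 Bq0.
have ex1 : exists p, (p < t)%N && B p by exists p0; rewrite p0t.
have ex2 : exists q, (t <= q)%N && B q by exists q0; rewrite tq0.
have bnd p : (p < t)%N && B p -> (p <= t)%N by case/andP => /ltnW.
case: (ex_maxnP ex1 bnd) => p /andP[pt bp] pmax; case: (ex_minnP ex2) => q /andP[tq bq] qmin.
exists p, q; split=> //; first by rewrite bp.
move=> i /andP[pi iq]; apply/negP => bi; have [ti|it] := leqP t i.
  by have := qmin i; rewrite ti bi leqNgt iq => /(_ isT).
by have := pmax i; rewrite it bi leqNgt pi => /(_ isT).
Qed.

Section FirstLast.
Variables (T : Type) (b : pred T).

(** Lengths of the prefixes that end at the first and at the last marked letter, thus positions plus
    one. Lengths are what iterated morphisms can count. *)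
Definition firstp (s : seq T) := (find b s).+1.
Definition lastp (s : seq T) := (size s - find b (rev s))%N.

Lemma firstp_cat u v w : ~~ has b u -> has b v -> firstp (u ++ v ++ w) = (size u + firstp v)%N.
Proof. by move=> /negbTE hu hv; rewrite /firstp !find_cat hu hv addnS. Qed.

Lemma lastp_cat u v w : ~~ has b w -> has b v -> lastp (u ++ v ++ w) = (size u + lastp v)%N.
Proof.
move=> /negbTE hw hv; rewrite /lastp !rev_cat -catA !find_cat !has_rev hw hv !size_cat size_rev.
by have := hv; rewrite -has_rev has_find size_rev; lia.
Qed.

Lemma firstp_eq x0 s k : (k < size s)%N -> b (nth x0 s k) ->
  (forall i, (i < k)%N -> ~~ b (nth x0 s i)) -> firstp s = k.+1.
Proof.
move=> ks bk h; rewrite /firstp; congr (_.+1); apply/eqP; rewrite eqn_leq; apply/andP; split.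
  by rewrite leqNgt; apply/negP => /(before_find x0); rewrite bk.
rewrite leqNgt; apply/negP => lt; have := h _ lt; rewrite nth_find //.
by rewrite has_find (ltn_trans lt).
Qed.

Lemma lastp_eq x0 s k : (k < size s)%N -> b (nth x0 s k) ->
  (forall i, (k < i < size s)%N -> ~~ b (nth x0 s i)) -> lastp s = k.+1.
Proof.
move=> ks bk h.
have := @firstp_eq x0 (rev s) (size s - k.+1)%N.
rewrite size_rev nth_rev; last by lia.
rewrite (_ : (size s - (size s - k.+1).+1)%N = k); last by lia.
rewrite /firstp /lastp => h1.
suff : (find b (rev s)).+1 = (size s - k.+1).+1 by lia.
apply: h1 => [|//|i ik]; first by lia.
rewrite nth_rev; last by lia.
by apply: h; lia.
Qed.

End FirstLast.

Section FirstLastMorphism.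
Variables (T : eqType) (H : T -> seq T) (b : pred T).
Hypothesis Hb : forall c, b c = has b (H c).

(* Copies 1 and 2 of a letter [c] generate the prefix of [H^n c] ending at its first, resp.
   last, marked letter; copy 0 behaves as [c]. *)
Definition lift0 (s : seq T) : seq (T * 'I_3) := [seq (c, 0) | c <- s].

Definition cut (i : 'I_3) (k : nat) (c : T) : seq (T * 'I_3) :=
  lift0 (take k (H c)) ++ [:: (nth c (H c) k, i)].

(** On copies 1 and 2 of an unmarked letter there is no mark to point at; the empty word is a
    default value. *)
Definition Hfl (p : T * 'I_3) : seq (T * 'I_3) :=
  if p.2 == 0 then lift0 (H p.1)
  else if ~~ b p.1 then [::]
  else if p.2 == 1 then cut p.2 (firstp b (H p.1)).-1 p.1
  else cut p.2 (lastp b (H p.1)).-1 p.1.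

Lemma Hfl_first c : b c -> Hfl (c, 1) = cut 1 (firstp b (H c)).-1 c.
Proof. by rewrite /Hfl /= => ->. Qed.

Lemma Hfl_last c : b c -> Hfl (c, 2) = cut 2 (lastp b (H c)).-1 c.
Proof. by rewrite /Hfl /= => ->. Qed.

Lemma itm_lift0 n s : itm Hfl n (lift0 s) = lift0 (itm H n s).
Proof.
elim: n => [//|n IH]; rewrite /itm !iterS -/(itm _ _ _) IH -/(itm _ _ _).
elim: (itm H n s) => [//|c w IHw]; rewrite /ext /= -/(ext Hfl _) IHw.
by rewrite {1}/Hfl /= -/(ext H _) /lift0 map_cat.
Qed.

(** Marks pass to images and come only from marked letters. So the first marked letter of
    [itm H n (H c)] lies in the image of the first marked letter of [H c], preceded by images free
    of marks. *)
Lemma size_itm_first n c : b c -> size (itm Hfl n [:: (c, 1)]) = firstp b (itm H n [:: c]).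
Proof.
elim: n c => [|n IH] c bc; first by rewrite /firstp /= bc.
rewrite !itmS1 Hfl_first // [_.-1]/=; set k := find b (H c).
have hk : has b (H c) by rewrite -Hb.
have ks : (k < size (H c))%N by rewrite -has_find.
have bk : b (nth c (H c) k) by rewrite nth_find.
rewrite /cut itm_cat size_cat itm_lift0 size_map IH //.
have eH : H c = take k (H c) ++ nth c (H c) k :: drop k.+1 (H c) by rewrite -drop_nth // cat_take_drop.
rewrite [in RHS]eH [in RHS]itm_cat [in RHS]itm_cons firstp_cat //.
  rewrite (has_itm_inv Hb); apply/negP => /(has_nthP c)[i].
  rewrite size_takel ?(ltnW ks) // => ik; rewrite nth_take // => bi.
  by have := before_find c ik; rewrite bi.
by rewrite (has_itm_inv Hb) /= bk.
Qed.

Lemma size_itm_last n c : b c -> size (itm Hfl n [:: (c, 2)]) = lastp b (itm H n [:: c]).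
Proof.
elim: n c => [|n IH] c bc; first by rewrite /lastp /= bc.
rewrite !itmS1 Hfl_last //.
have hk : has b (rev (H c)) by rewrite has_rev -Hb.
have ks : (find b (rev (H c)) < size (H c))%N by rewrite -[X in (_ < X)%N]size_rev -has_find.
set k := (lastp b (H c)).-1.
have ek : k = (size (H c) - (find b (rev (H c))).+1)%N by rewrite /k /lastp; lia.
have kH : (k < size (H c))%N by rewrite ek; lia.
have bk : b (nth c (H c) k) by rewrite ek -nth_rev //; exact: nth_find.
rewrite /cut itm_cat size_cat itm_lift0 size_map IH //.
have eH : H c = take k (H c) ++ nth c (H c) k :: drop k.+1 (H c) by rewrite -drop_nth // cat_take_drop.
rewrite [in RHS]eH [in RHS]itm_cat [in RHS]itm_cons lastp_cat //.
  rewrite (has_itm_inv Hb); apply/negP => /(has_nthP c)[i].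
  rewrite size_drop => ik; rewrite nth_drop => bi.
  have lt : (size (H c) - (k.+1 + i).+1 < find b (rev (H c)))%N by rewrite ek; lia.
  have := before_find c lt; rewrite nth_rev; last by lia.
  rewrite (_ : (size (H c) - (size (H c) - (k.+1 + i).+1).+1)%N = (k.+1 + i)%N); last by lia.
  by rewrite bi.
by rewrite (has_itm_inv Hb) /= bk.
Qed.

End FirstLastMorphism.

(** * Gaps between marked positions *)

Section Gaps.
Variable R : realType.

(** Quantifying over all large [t], and not only over elements of [B], makes the condition stable
    under bounded displacements of [B], up to an arbitrarily small increase of [rho]. *)
Definition gap_up (B : nat -> Prop) (rho : R) := exists N, forall t, (N <= t)%N ->
  exists s, [/\ B s, (t <= s)%N & s%:R <= rho * t%:R].

Definition is_gapsup (B : nat -> Prop) (L : R) :=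
  [/\ 1 <= L, forall rho, L < rho -> gap_up B rho &
     forall rho, 1 <= rho -> rho < L -> ~ gap_up B rho].

Lemma gap_up_mono B rho rho' : rho <= rho' -> gap_up B rho -> gap_up B rho'.
Proof.
move=> le [N h]; exists N => t /h[s [Bs ts st]]; exists s; split=> //.
by apply: le_trans st _; rewrite ler_wpM2r.
Qed.

Lemma gapsup_exists B rho : gap_up B rho -> exists L, is_gapsup B L.
Proof.
move=> h; pose E := [set r : R | 1 <= r /\ gap_up B r].
have E1 : lbound E 1 by move=> r [].
have hE : has_inf E.
  split; last by exists 1.
  exists (Num.max 1 rho); split; first by rewrite le_max lexx.
  by apply: gap_up_mono h; rewrite le_max lexx orbT.
exists (inf E); split.
- by apply: lb_le_inf => //; case: hE.
- move=> r Lr; have [] := @inf_adherent _ E (r - inf E) _ hE; first by rewrite subr_gt0.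
  move=> r' [_ hr']; rewrite addrC subrK => /ltW lt; exact: gap_up_mono hr'.
- move=> r r1 rL hr; have : inf E <= r by apply: ge_inf; [case: hE | split].
  by rewrite leNgt rL.
Qed.

End Gaps.

Section MarkedFixedPoint.
Variables (T : finType) (H : T -> seq T) (a : T) (X : seq T) (U : nat -> T).
Hypothesis Ha : H a = a :: X.
Hypothesis HX : forall n, itm H n X <> [::].
Hypothesis HU : forall n i, (i < size (itm H n [:: a]))%N -> U i = nth a (itm H n [:: a]) i.
Let A n := size (itm H n [:: a]).
Variable b : pred T.
Hypothesis Hb : forall c, b c = has b (H c).
Hypothesis Hinf : forall N, exists t, (N <= t)%N /\ b (U t).
Let pos := pos H U.
Let G := Hfl H b.

(** A gap starts after the last marked letter of a block and ends at the first marked letter of a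
    later one; these two words have images ending exactly there. *)
Definition last_word s := lift0 (pre U s) ++ [:: (U s, 2 : 'I_3)].
Definition first_word s := lift0 (pre U s) ++ [:: (U s, 1 : 'I_3)].

Lemma size_itm_G n s : size (itm G n (lift0 s)) = size (itm H n s).
Proof. by rewrite itm_lift0 size_map. Qed.

Lemma size_last_word n s : b (U s) ->
  size (itm G n (last_word s)) = (pos n s + lastp b (itm H n [:: U s]))%N.
Proof. by move=> bs; rewrite itm_cat size_cat size_itm_G size_itm_last. Qed.

Lemma size_first_word n s : b (U s) ->
  size (itm G n (first_word s)) = (pos n s + firstp b (itm H n [:: U s]))%N.
Proof. by move=> bs; rewrite itm_cat size_cat size_itm_G size_itm_first. Qed.

Lemma marked_block n s t : (pos n s <= t < pos n s.+1)%N -> b (U t) -> b (U s).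
Proof.
move=> /andP[st ts] bt; suff : has b (itm H n [:: U s]) by rewrite (has_itm_inv Hb) /= orbF.
have lt : (t - pos n s < size (itm H n [:: U s]))%N by rewrite ltn_subLR // -posS.
apply/(has_nthP a); exists (t - pos n s)%N => //.
by rewrite -(nth_pos Ha HX HU lt) subnKC.
Qed.

Lemma last_word_eq n s t : (pos n s <= t < pos n s.+1)%N -> b (U t) ->
  (forall i, (t < i < pos n s.+1)%N -> ~~ b (U i)) ->
  size (itm G n (last_word s)) = t.+1.
Proof.
move=> sts bt h; have bs := marked_block sts bt; move: sts => /andP[st ts].
have lt : (t - pos n s < size (itm H n [:: U s]))%N by rewrite ltn_subLR // -posS.
rewrite size_last_word // (@lastp_eq _ b a _ (t - pos n s)) //; first by lia.
  by rewrite -(nth_pos Ha HX HU lt) subnKC.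
move=> i /andP[i1 i2]; rewrite -(nth_pos Ha HX HU i2) -/pos; apply: h.
by rewrite /pos posS -/pos; lia.
Qed.

Lemma first_word_eq n s t : (pos n s <= t < pos n s.+1)%N -> b (U t) ->
  (forall i, (pos n s <= i < t)%N -> ~~ b (U i)) ->
  size (itm G n (first_word s)) = t.+1.
Proof.
move=> sts bt h; have bs := marked_block sts bt; move: sts => /andP[st ts].
have lt : (t - pos n s < size (itm H n [:: U s]))%N by rewrite ltn_subLR // -posS.
rewrite size_first_word // (@firstp_eq _ b a _ (t - pos n s)) //; first by lia.
  by rewrite -(nth_pos Ha HX HU lt) subnKC.
move=> i i1; have i2 : (i < size (itm H n [:: U s]))%N by exact: ltn_trans lt.
rewrite -(nth_pos Ha HX HU i2) -/pos; apply: h; lia.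
Qed.

Lemma size_letterD n k : (A (n + k) <= max_size H ^ k * A n)%N.
Proof.
elim: k => [|k IH]; first by rewrite addn0 mul1n.
rewrite addnS expnS -mulnA; apply: leq_trans (size_itmS_le _ _ _) _.
by rewrite leq_mul2l IH orbT.
Qed.

(** The prefix of length [s] lies inside [itm H s [:: a]], and [s] more iterations multiply lengths
    by at most a constant. *)
Lemma dominated_prefix s : dominated H a (pre U s).
Proof.
exists (max_size H ^ s)%N => n; apply: leq_trans (size_letterD n s).
have -> : A (n + s) = pos n (A s) by rewrite /pos (pos_size HU).
by apply: pos_mono; apply: ltnW; exact: (size_letter_gt Ha HX).
Qed.

Lemma dominated_letter s : dominated H a [:: U s].
Proof.
by apply: (dominated_mem (dominated_prefix s.+1)); rewrite preS mem_rcons mem_head.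
Qed.

Lemma lastp_le s : (lastp b s <= size s)%N. Proof. exact: leq_subr. Qed.

Lemma firstp_le s : has b s -> (firstp b s <= size s)%N. Proof. by rewrite has_find. Qed.

Lemma dominated_words s : b (U s) ->
  dominated G (a, 0 : 'I_3) (last_word s) /\ dominated G (a, 0 : 'I_3) (first_word s).
Proof.
move=> bs; have [K hK] := dominated_prefix s.+1.
have e n : size (itm G n [:: (a, 0 : 'I_3)]) = A n by exact: (size_itm_G n [:: a]).
have hb n : has b (itm H n [:: U s]) by rewrite (has_itm_inv Hb) /= bs.
have hp n : (pos n s + size (itm H n [:: U s]))%N = size (itm H n (pre U s.+1)) by rewrite -posS.
split; exists K => n; rewrite e; apply: leq_trans (hK n); rewrite -hp.
  by rewrite size_last_word // leq_add2l lastp_le.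
by rewrite size_first_word // leq_add2l firstp_le.
Qed.

Lemma marked_neighbours t : (A 1 <= t)%N -> exists p q, [/\ (p < t)%N, (t <= q)%N, b (U p) && b (U q)
  & forall i, (p < i < q)%N -> ~~ b (U i)].
Proof.
move=> At; have [p0 [_ p1 bp0]] := letter_level_marked Ha HX HU Hb Hinf 0.
have [q0 [tq0 bq0]] := Hinf t.
exact: (@pred_neighbours (fun i => b (U i)) t p0 q0 (leq_trans p1 At) bp0 tq0 bq0).
Qed.

End MarkedFixedPoint.

Section Arithmetic.
Variable R : realType.

(** Excludes that both ends of a long gap lie in one block, of length at most [y]: this would give
    [q <= p + y <= r1 * p < r * t < q]. *)
Lemma gap_too_long (r1 r p t q x y : R) : 1 < r1 -> r1 <= r -> p + 1 <= t -> r * t < q ->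
  0 <= p -> x <= p -> y <= (r1 - 1) * x -> q <= p + y -> False.
Proof.
move=> h1 h2 h3 h4 h5 h6 h7 h8.
have : r1 * (p + 1) <= r * t by apply: ler_pM => //; lra.
have : (r1 - 1) * x <= (r1 - 1) * p by rewrite ler_pM2l //; lra.
lra.
Qed.

(** One half of [eta] bounds the ratio below by the length of the gap and above by the next marked
    letter; the other half, through [2 <= p * eta], absorbs the shift from [q] to [q + 1]. *)
Lemma gap_ratio_close (L eta r p t q s : R) : 1 < L -> 0 < eta -> 0 < r -> L - eta / 2 <= r ->
  p + 1 <= t -> r * t < q -> 0 <= p -> q <= s -> s <= (L + eta / 2) * (p + 1) -> 2 <= p * eta ->
  `|(q + 1) / (p + 1) - L| < eta.
Proof.
move=> h1 e0 r0 hr hp hq p0 qs hs pe.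
have p1 : 0 < p + 1 by lra.
have k1 : r * (p + 1) <= r * t by rewrite ler_pM2l.
have k2 : (L - eta / 2) * (p + 1) <= r * (p + 1) by rewrite ler_pM2r.
have k3 : 0 < eta / 2 * (p + 1) by apply: mulr_gt0 => //; lra.
rewrite ltr_distl ltr_pdivrMr // ltr_pdivlMr //; apply/andP; split; lra.
Qed.

End Arithmetic.

Definition power_growth (R : realType) (A : nat -> nat) (P : nat) (th : R) :=
  (fun n => (A (n.+1 * P))%:R / (A (n * P))%:R) @ \oo --> th.

Section MarkedGaps.
Variables (R : realType) (T : finType) (H : T -> seq T) (a : T) (X : seq T) (U : nat -> T).
Hypothesis Ha : H a = a :: X.
Hypothesis HX : forall n, itm H n X <> [::].
Hypothesis HU : forall n i, (i < size (itm H n [:: a]))%N -> U i = nth a (itm H n [:: a]) i.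
Let A n := size (itm H n [:: a]).
Variable b : pred T.
Hypothesis Hb : forall c, b c = has b (H c).
Hypothesis Hinf : forall N, exists t, (N <= t)%N /\ b (U t).
Let pos := pos H U.
Let G := Hfl H b.
Let marked t : Prop := b (U t).
Let M := max_size H.

(** The level after that of [t] contains a marked letter, hence two levels and the factor
    [M ^ 2]. *)
Lemma gap_up_bounded : gap_up marked ((M ^ 2)%:R : R).
Proof.
exists 1%N => t t1; have [m /andP[mt tm]] := letter_level Ha HX t1.
have [s [ms sm bs]] := letter_level_marked Ha HX HU Hb Hinf m.+1.
exists s; split=> //; first by apply: leq_trans ms; exact: ltnW.
rewrite -natrM ler_nat; have := size_letterD H a m 2; rewrite addn2 -/M => h.
apply: leq_trans (ltnW sm) _; apply: leq_trans h _; exact: leq_mul.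
Qed.

Lemma geometric_letters (P : nat) (k : R) : (0 < P)%N -> 1 < k ->
  (\forall n \near \oo, k * (A (n * P))%:R <= (A (n.+1 * P))%:R) ->
  forall C : R, exists m n0, forall n, (n0 <= n)%N -> C * (A n)%:R <= (A (n + m))%:R.
Proof.
move=> P0 k1 [N _ hN] C.
have grow j n : (N <= n)%N -> k ^+ j * (A (n * P))%:R <= (A ((n + j) * P))%:R.
  move=> Nn; elim: j => [|j IH]; first by rewrite mul1r addn0.
  rewrite exprS -mulrA addnS; apply: le_trans (hN (n + j)%N _); last by rewrite /= (leq_trans Nn) // leq_addr.
  by rewrite ler_pM2l // (lt_trans _ k1).
have [j hj] : exists j, C <= k ^+ j.
  have : scale 0 k @ \oo --> +oo by apply: cvgy_scale; rewrite k1.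
  move=> /cvgryPge/(_ C)[j _ /(_ j (leqnn _))] /=; rewrite /scale /binR bin0 mul1r => h.
  by exists j.
(* The additional period pays for rounding [n] up to a multiple of [P]. *)
exists (j.+1 * P)%N, (N * P)%N => n hn.
pose q := (n %/ P)%N.
have qN : (N <= q)%N by rewrite leq_divRL.
have nq : (n <= q.+1 * P)%N by apply/ltnW; exact: ltn_ceil.
have qn : (q * P <= n)%N by exact: leq_divM.
apply: (@le_trans _ _ (k ^+ j * (A n)%:R)); first by rewrite ler_wpM2r.
apply: (@le_trans _ _ (k ^+ j * (A (q.+1 * P))%:R)).
  rewrite ler_pM2l ?exprn_gt0 ?(lt_trans _ k1) // ler_nat; exact: (size_letter_mono Ha HX).
apply: le_trans (grow j q.+1 _) _; first exact: leqW.
rewrite ler_nat; apply: (size_letter_mono Ha HX).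
by rewrite addSnnS mulnDl leq_add2r.
Qed.

(** When the limit is 1, climbing from level [m] to [m.+2] costs a factor tending to 1. Three steps
    of length [P] cover this climb after [m] is rounded down to a multiple of [P]. *)
Lemma gap_up_slow (P : nat) (rho : R) : (0 < P)%N -> 1 < rho ->
  (fun n => (A (n.+1 * P))%:R / (A (n * P))%:R) @ \oo --> (1 : R) -> gap_up marked rho.
Proof.
move=> P0 r1 h.
have A0 n : 0 < (A n)%:R :> R by rewrite ltr0n; apply: leq_ltn_trans (size_letter_gt Ha HX n).
have h1 : (fun n => (A (n.+2 * P))%:R / (A (n.+1 * P))%:R) @ \oo --> (1 : R).
  by rewrite (@cvg_shiftS _ (fun n => (A (n.+1 * P))%:R / (A (n * P))%:R : R)).
have h2 : (fun n => (A (n.+3 * P))%:R / (A (n.+2 * P))%:R) @ \oo --> (1 : R).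
  by rewrite (@cvg_shiftS _ (fun n => (A (n.+2 * P))%:R / (A (n.+1 * P))%:R : R)).
have h3 : (fun n => (A (n.+3 * P))%:R / (A (n * P))%:R) @ \oo --> (1 : R).
  have := cvg_mul h2 (cvg_mul h1 h); rewrite !mulr1; apply: near_cvg; apply: nearW => n.
  by field; rewrite !gt_eqF.
have [N _ hN] : \forall n \near \oo, (A (n.+3 * P))%:R / (A (n * P))%:R <= rho by apply: (cvgr_le (1 : R)).
exists (A (N.+1 * P)) => t ht.
have t0 : (0 < t)%N by apply: leq_trans ht; apply: leq_ltn_trans (size_letter_gt Ha HX _).
have [m /andP[mt tm]] := letter_level Ha HX t0.
have [s [ms sm bs]] := letter_level_marked Ha HX HU Hb Hinf m.+1.
exists s; split=> //; first by apply: leq_trans ms; exact: ltnW.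
have Nm : (N.+1 * P <= m)%N.
  rewrite leqNgt; apply/negP => lt; have := leq_ltn_trans ht tm.
  by rewrite ltnNge (size_letter_mono Ha HX lt).
pose n := (m %/ P)%N.
have nN : (N <= n)%N by rewrite leq_divRL //; apply: leq_trans Nm; rewrite leq_mul2r leqnSn orbT.
have nm : (n * P <= m)%N by exact: leq_divM.
have mn : (m < n.+1 * P)%N by exact: ltn_ceil.
have := hN n nN; rewrite /= ler_pdivrMr // => h4.
apply: (@le_trans _ _ (A m.+2)%:R); first by rewrite ler_nat ltnW.
apply: (@le_trans _ _ (A (n.+3 * P))%:R).
  by rewrite ler_nat; apply: (size_letter_mono Ha HX); rewrite !mulSn; move: mn; rewrite mulSn; lia.
apply: le_trans h4 _; rewrite ler_pM2l ?(lt_trans _ r1) // ler_nat.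
by apply: leq_trans mt; exact: (size_letter_mono Ha HX).
Qed.

(* Once the letter images grow geometrically, a long gap at distance between |H^(n+m) a| and
   |H^(n+m+1) a| is the n-fold image of one of finitely many gaps. *)
Lemma long_gap_ancestor (L : R) : is_gapsup marked L -> 1 < L ->
  (forall C : R, exists m n0, forall n, (n0 <= n)%N -> C * (A n)%:R <= (A (n + m))%:R) ->
  exists D, forall (eta : R) N, 0 < eta -> exists s s' n,
   [/\ (0 < s)%N && (s <= D)%N, (s' <= D)%N, b (U s) && b (U s'), (N <= n)%N &
    `|(size (itm G n (first_word U s')))%:R / (size (itm G n (last_word U s)))%:R - L| < eta].
Proof.
move=> [_ Lup Llow] L1 hgeo.
have A0 n : (0 < A n)%N by apply: leq_ltn_trans (size_letter_gt Ha HX n).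
(* A ratio strictly between 1 and [L], fixed before [eta]: it determines [m] and so the bound [D],
   which must not depend on the precision. *)
pose rho1 := (1 + L) / 2; have rho11 : 1 < rho1 by rewrite /rho1; lra.
have rho1L : rho1 < L by rewrite /rho1; lra.
have [K hK] : exists K, forall s n, (size (itm H n [:: U s]) <= K * A n)%N.
  have hk c : exists k, dominated H a [:: c] -> forall n, (size (itm H n [:: c]) <= k * A n)%N.
    have [[k hk]|nd] := pselect (dominated H a [:: c]); last by exists 0%N.
    by exists k.
  have [F hF] := choice hk.
  exists (\max_c F c)%N => s n; apply: leq_trans (hF _ (dominated_letter Ha HX HU s) n) _.
  by rewrite leq_mul2r leq_bigmax orbT.
have [m [n0 hm]] := hgeo (K%:R / (rho1 - 1)).
have KA n : (n0 <= n)%N -> K%:R * (A n)%:R <= (rho1 - 1) * (A (n + m))%:R.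
  have r0 : 0 < rho1 - 1 by rewrite subr_gt0.
  by move=> /hm; rewrite mulrAC ler_pdivrMr // => h; rewrite [leRHS]mulrC.
exists (A m.+2) => eta N eta0.
pose rho := Num.max rho1 (L - eta / 2).
have rhoL : rho < L by rewrite gt_max rho1L /=; lra.
have rho1' : rho1 <= rho by rewrite le_max lexx.
have [N1 hN1] := Lup (L + eta / 2) ltac:(lra).
have [w hw] : exists w : nat, 2 / eta <= w%:R by exists (Num.truncn (2 / eta)).+1; apply/ltW; exact: truncnS_gt.
pose N2 := (N + n0 + m + N1 + w).+1.
have nup : ~ gap_up marked rho by apply: Llow => //; apply: le_trans rho1'; exact: ltW.
have [t [tN hfree]] : exists t, (A N2.+1 <= t)%N /\ forall s, b (U s) -> (t <= s)%N -> rho * t%:R < s%:R.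
  apply: contrapT => hn; apply: nup; exists (A N2.+1) => t ht; apply: contrapT => hn2.
  apply: hn; exists t; split=> // s bs ts; rewrite ltNge; apply/negP => le; apply: hn2.
  by exists s.
have [|p [q [pt tq /andP[bp bq] pq]]] := marked_neighbours Ha HX HU Hb Hinf (t := t).
  by apply: leq_trans tN; exact: (size_letter_mono Ha HX).
have mono := size_letter_mono Ha HX.
have p0 : (A N2 <= p)%N.
  have [r [r1 r2 br]] := letter_level_marked Ha HX HU Hb Hinf N2.
  rewrite leqNgt; apply/negP => lt; have := pq r; rewrite br (leq_trans lt r1).
  by rewrite (leq_trans (leq_trans r2 tN) tq) => /(_ isT).
have p_gt : (N2 < p)%N by apply: leq_trans p0; exact: (size_letter_gt Ha HX).
have [lev [lp pl]] : exists lev, (A lev <= p)%N /\ (p < A lev.+1)%N.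
  by have [lev /andP[]] := letter_level Ha HX (leq_ltn_trans (leq0n _) p_gt); exists lev.
have levN : (N2 <= lev)%N.
  rewrite leqNgt; apply/negP => lt; have := leq_ltn_trans p0 pl.
  by rewrite ltnNge mono.
pose n := (lev - m)%N.
have en : lev = (n + m)%N by rewrite /n subnK //; move: levN; rewrite /N2; clear; lia.
have nN : (N <= n)%N by move: levN; rewrite /N2 /n; clear; lia.
have nn0 : (n0 <= n)%N by move: levN; rewrite /N2 /n; clear; lia.
have qlt : (q < A lev.+2)%N.
  have [r [r1 r2 br]] := letter_level_marked Ha HX HU Hb Hinf lev.+1.
  apply: leq_ltn_trans r2; rewrite leqNgt; apply/negP => lt; have := pq r; rewrite br lt.
  by rewrite (leq_trans pl r1) => /(_ isT).
have [s /andP[s1 s2]] := pos_block Ha HX HU n p.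
have [s' /andP[s'1 s'2]] := pos_block Ha HX HU n q.
have pmono := pos_mono H U n.
have posA k : pos n (A k) = A (n + k) by rewrite /pos (pos_size HU).
have sm : (A m <= s)%N.
  rewrite leqNgt; apply/negP => lt; have := leq_ltn_trans lp s2.
  by rewrite en -posA ltnNge pmono.
have sD : (s <= A m.+2)%N.
  rewrite leqNgt; apply/negP => lt; have := leq_ltn_trans s1 (ltn_trans (leq_trans pt tq) qlt).
  rewrite en -!addnS -posA ltnNge; move/negP; apply; exact/pmono/ltnW.
have s'D : (s' <= A m.+2)%N.
  rewrite leqNgt; apply/negP => lt; have := leq_ltn_trans s'1 qlt.
  rewrite en -!addnS -posA ltnNge; move/negP; apply; exact/pmono/ltnW.
have bs : b (U s) by apply: (@marked_block _ H a X U Ha HX HU b Hb n s p); rewrite ?s1.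
have bs' : b (U s') by apply: (@marked_block _ H a X U Ha HX HU b Hb n s' q); rewrite ?s'1.
have qbig : rho * t%:R < q%:R by apply: hfree.
have tp : p%:R + 1 <= t%:R :> R by rewrite natr1 ler_nat.
have p_ge0 : 0 <= p%:R :> R by [].
have lt_ss : (s < s')%N.
  rewrite ltnNge; apply/negP => le.
  have q_le : (q < pos n s + size (itm H n [:: U s]))%N.
    by rewrite /pos -posS; apply: leq_trans s'2 _; exact: pmono.
  have q_le2 : (q <= p + K * A n)%N by apply: leq_trans (ltnW q_le) _; exact: leq_add.
  have q_le3 : q%:R <= p%:R + K%:R * (A n)%:R :> R by rewrite -natrM -natrD ler_nat.
  have h := KA n nn0; rewrite -en in h.
  have lev_p : (A lev)%:R <= p%:R :> R by rewrite ler_nat.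
  exact: (gap_too_long rho11 rho1' tp qbig p_ge0 lev_p h q_le3).
(* The blocks [s] and [s'] being distinct, [p] is the last marked position of the first one and [q]
   the first marked position of the second. *)
have ss1 : (pos n s.+1 <= pos n s')%N by exact: pmono.
have e1 : size (itm G n (last_word U s)) = p.+1.
  apply: (last_word_eq Ha HX HU Hb) => //; first by rewrite s1.
  by move=> i /andP[i1 i2]; apply: pq; rewrite i1 (leq_trans i2) // (leq_trans ss1).
have e2 : size (itm G n (first_word U s')) = q.+1.
  apply: (first_word_eq Ha HX HU Hb) => //; first by rewrite s'1.
  by move=> i /andP[i1 i2]; apply: pq; rewrite i2 andbT (leq_trans s2) // (leq_trans ss1).
exists s, s', n; rewrite bs bs' sD s'D nN e1 e2.
have s_gt0 : (0 < s)%N by apply: leq_trans sm.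
split=> //; first by rewrite s_gt0.
have [r [br pr rle]] : exists r, [/\ marked r, (p.+1 <= r)%N & r%:R <= (L + eta / 2) * p.+1%:R].
  by apply: hN1; move: p_gt; rewrite /N2; clear; lia.
have qr : (q <= r)%N.
  rewrite leqNgt; apply/negP => lt; have := pq r; rewrite lt andbT => /(_ pr).
  by rewrite br.
have qr' : q%:R <= r%:R :> R by rewrite ler_nat.
have wp : 2 / eta <= p%:R.
  by apply: le_trans hw _; rewrite ler_nat; move: p_gt; rewrite /N2; clear; lia.
rewrite ler_pdivrMr // in wp.
have pS : p.+1%:R = p%:R + 1 :> R by rewrite natr1.
have qS : q.+1%:R = q%:R + 1 :> R by rewrite natr1.
rewrite pS in rle *; rewrite qS.
have p1 : 0 < p%:R + 1 :> R by rewrite ltr_wpDl.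
have rhoL' : L - eta / 2 <= rho by rewrite le_max lexx orbT.
have rho_gt0 : 0 < rho by apply: lt_le_trans rho1'; lra.
exact: (gap_ratio_close L1 eta0 rho_gt0 rhoL' tp qbig p_ge0 qr' rle wp).
Qed.

(** There are finitely many triples of [s], [s'] and [n] modulo [P], and each ratio sequence
    converges to an element of [S]. If [L] were outside [S], all of them would eventually keep a
    common positive distance from [L], against [long_gap_ancestor]. *)
Theorem marked_gapsup (S : R -> Prop) : subfield_pred S ->
  (forall P (th : R) (p : {poly int}), (0 < P)%N -> 0 < th ->
     power_growth A P th -> p \is monic -> root (map_poly intr p) th -> S th) ->
  exists L, is_gapsup marked L /\ S L.
Proof.
move=> hS Sth; have [L hL] := gapsup_exists gap_up_bounded.
exists L; split=> //; have [L1 _ Llow] := hL.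
have [eL|L1'] := eqVneq L 1; first by rewrite eL; case: hS.
have {L1 L1'} L1 : 1 < L by rewrite lt_neqAle eq_sym L1' L1.
have A0 n : (0 < A n)%N by apply: leq_ltn_trans (size_letter_gt Ha HX n).
have AR0 n : 0 < (A n)%:R :> R by rewrite ltr0n.
have eA n : size (itm G n [:: (a, 0 : 'I_3)]) = A n by exact: (size_itm_G H b n [:: a]).
have GA0 n : (0 < size (itm G n [:: (a, 0%R : 'I_3)]))%N by rewrite eA.
have [P [P0 [th [th0 hth [p [pm pr]] hdom]]]] := dominant_growth R GA0.
have hthA : (fun n => (A (n.+1 * P))%:R / (A (n * P))%:R) @ \oo --> th.
  by apply: near_cvg hth; apply: nearW => n; rewrite !eA.
have Sth' := Sth P th p P0 th0 hthA pm pr.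
have th1 : 1 <= th.
  apply: (ler_cvg_to (cvg_cst (1 : R)) hthA); apply: nearW => n.
  rewrite ler_pdivlMr // mul1r ler_nat; apply: (size_letter_mono Ha HX).
  by rewrite leq_mul2r leqnSn orbT.
have th1' : 1 < th.
  rewrite lt_neqAle th1 andbT; apply/eqP => e; rewrite -e in hthA.
  apply: (Llow ((1 + L) / 2)); [by lra|by lra|].
  by apply: (gap_up_slow P0 _ hthA); lra.
have hgeo : forall C : R, exists m n0, forall n, (n0 <= n)%N -> C * (A n)%:R <= (A (n + m))%:R.
  apply: (@geometric_letters P ((1 + th) / 2)) => //; first by lra.
  have : \forall n \near \oo, (1 + th) / 2 <= (A (n.+1 * P))%:R / (A (n * P))%:R.
    by apply: (cvgr_ge th) => //; lra.
  by apply: filterS => n; rewrite ler_pdivlMr.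
have [D hD] := long_gap_ancestor hL L1 hgeo.
pose f (s s' n : nat) : R := (size (itm G n (first_word U s')))%:R / (size (itm G n (last_word U s)))%:R.
have flim s s' r : (0 < s)%N -> b (U s) -> b (U s') ->
    exists l, S l /\ (fun n => f s s' (n * P + r)%N) @ \oo --> l.
  move=> s0 bs bs'.
  have [dl _] := dominated_words Ha HX HU Hb bs; have [_ df] := dominated_words Ha HX HU Hb bs'.
  have [l1 [Sl1 h1]] := hdom S hS Sth' _ r df; have [l2 [Sl2 h2]] := hdom S hS Sth' _ r dl.
  (* Here [0 < s] matters: the prefix then contains [a], so the denominator is at least comparable
     to [A] and its limit is not 0. *)
  have l2_1 : 1 <= l2.
    apply: (ler_cvg_to (cvg_cst (1 : R)) h2); apply: nearW => n.
    rewrite eA ler_pdivlMr // mul1r ler_nat size_last_word //.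
    apply: leq_trans (leq_addr _ _); apply: leq_trans (pos_ge HU _ s0).
    by apply: (size_letter_mono Ha HX); exact: leq_addr.
  have l20 : l2 != 0 by rewrite gt_eqF // (lt_le_trans _ l2_1).
  exists (l1 / l2); split; first by case: hS => _ _ SM SV; apply: SM => //; exact: SV.
  apply: near_cvg (cvg_mul h1 (cvg_inv l20 h2)); apply: nearW => n.
  by rewrite /f eA invf_div mulrA divfK // gt_eqF.
apply: contrapT => nSL.
have sep (x : 'I_D.+1 * 'I_D.+1 * 'I_P) : exists en : R * nat, 0 < en.1 /\
   ((0 < x.1.1)%N -> b (U x.1.1) -> b (U x.1.2) ->
     forall n, (en.2 <= n)%N -> en.1 <= `|f x.1.1 x.1.2 (n * P + x.2)%N - L|).
  case: x => [[s s'] r] /=.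
  have [[s0 [bs bs']]|nh] := pselect ((0 < s)%N /\ (b (U s) /\ b (U s'))); last first.
    by exists (1, 0%N); split=> // s0 bs bs'; exfalso; apply: nh.
  have [l [Sl hl]] := flim s s' r s0 bs bs'.
  have lL : l != L by apply: contra_not_neq nSL => <-.
  have d0 : 0 < `|l - L| / 2 by rewrite divr_gt0 // normr_gt0 subr_eq0.
  have [N _ hN] : \forall n \near \oo, `|l - f s s' (n * P + r)%N| <= `|l - L| / 2.
    by move/cvgrPdist_le: hl; apply.
  exists (`|l - L| / 2, N); split=> // _ _ _ n /= Nn; have := hN n Nn.
  rewrite /= => h1.
  have := ler_normD (l - f s s' (n * P + r)%N) (f s s' (n * P + r)%N - L).
  by rewrite addrA subrK => h2; lra.
have [F hF] := choice sep.
have [e [e0 he]] := pos_lower_bound (fun x => (hF x).1).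
pose N := (\max_x (F x).2)%N.
have [s [s' [n [/andP[s0 sD] s'D /andP[bs bs'] nN]]]] := hD e (N.+1 * P)%N e0.
pose x : 'I_D.+1 * 'I_D.+1 * 'I_P :=
  (Ordinal (sD : (s < D.+1)%N), Ordinal (s'D : (s' < D.+1)%N), Ordinal (ltn_pmod n P0)).
have [_ hx] := hF x; have := hx s0 bs bs' (n %/ P)%N.
have le1 : ((F x).2 <= n %/ P)%N.
  apply: (@leq_trans N); first exact: (leq_bigmax x).
  by rewrite leq_divRL //; apply: leq_trans nN; rewrite leq_mul2r leqnSn orbT.
move=> /(_ le1) /=; rewrite -divn_eq /f => h1 h2.
by have := le_lt_trans (le_trans (he x) h1) h2; rewrite ltxx.
Qed.

End MarkedGaps.

(** * Transducers *)

Section CloseSets.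
Variable R : realType.

Definition close (B B' : nat -> Prop) := exists K, forall t, B t ->
  exists t', [/\ B' t', (t <= t' + K)%N & (t' <= t + K)%N].

(** A displacement by [K] is a vanishing relative error, absorbed for large [t] by the excess
    [rho' - rho]. *)
Lemma gap_up_close B B' (rho rho' : R) : close B B' -> 0 <= rho -> rho < rho' ->
  gap_up B rho -> gap_up B' rho'.
Proof.
move=> [K hK] r0 rr [N hN].
have d0 : 0 < rho' - rho by rewrite subr_gt0.
have [m hm] : exists m : nat, (rho * K%:R + K%:R) / (rho' - rho) <= m%:R.
  by exists (Num.truncn ((rho * K%:R + K%:R) / (rho' - rho))).+1; apply/ltW; exact: truncnS_gt.
exists (maxn N m) => t; rewrite geq_max => /andP[Nt mt].
have [s [Bs ts st]] := hN (t + K)%N (leq_trans Nt (leq_addr _ _)).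
have [s' [Bs' ss' s's]] := hK _ Bs.
exists s'; split=> //; first by rewrite -(leq_add2r K) (leq_trans ts).
have h1 : s'%:R <= s%:R + K%:R :> R by rewrite -natrD ler_nat.
have h2 : m%:R <= t%:R :> R by rewrite ler_nat.
have := le_trans hm h2; rewrite ler_pdivrMr // => h3.
by rewrite natrD in st; lra.
Qed.

Lemma gapsup_close B B' (L : R) : close B B' -> close B' B ->
  is_gapsup B L -> is_gapsup B' L.
Proof.
move=> BB' B'B [L1 Lup Llow]; split=> // rho.
  move=> Lr; apply: (gap_up_close BB' (rho := (L + rho) / 2)); [lra|lra|].
  by apply: Lup; lra.
move=> r1 rL h; apply: (Llow ((L + rho) / 2)); [lra|lra|].
by apply: (gap_up_close B'B _ _ h); lra.
Qed.

End CloseSets.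

Section Transducer.
Variables (T Q : finType) (h : T -> seq T) (dl : Q -> T -> Q) (bad : pred Q).

Definition flag q s := has bad (scanl dl q s).

Lemma flag_cat q s t : flag q (s ++ t) = flag q s || flag (foldl dl q s) t.
Proof. by rewrite /flag scanl_cat has_cat. Qed.

(** All that the transducer can tell of an image: for each entry state, the exit state and whether a
    bad state was met on the way. *)
Definition effect n : {ffun T -> {ffun Q -> Q * bool}} :=
  [ffun c => [ffun q => (foldl dl q (itm h n [:: c]), flag q (itm h n [:: c]))]].

Lemma effectE n c q :
  effect n c q = (foldl dl q (itm h n [:: c]), flag q (itm h n [:: c])).
Proof. by rewrite !ffunE. Qed.

Definition act (k : {ffun T -> {ffun Q -> Q * bool}}) (p : Q * bool) d :=
  ((k d p.1).1, p.2 || (k d p.1).2).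

Lemma act_effect n q e s :
  foldl (act (effect n)) (q, e) s = (foldl dl q (itm h n s), e || flag q (itm h n s)).
Proof.
elim: s q e => [|d s IH] q e; first by rewrite itm_nil orbF.
have -> : foldl (act (effect n)) (q, e) (d :: s) =
  foldl (act (effect n)) (foldl dl q (itm h n [:: d]), e || flag q (itm h n [:: d])) s.
  by rewrite /= [act _ _ d]/act effectE.
by rewrite IH (itm_cons _ _ d s) foldl_cat flag_cat orbA.
Qed.

(** The effect of [n.+1] iterations is computed from that of [n] by a fixed map on a finite type,
    namely by composing along [h c]. *)
Lemma effect_idempotent : exists P, (0 < P)%N /\ forall n, (0 < n)%N -> effect (n * P) = effect P.
Proof.
pose F k : {ffun T -> {ffun Q -> Q * bool}} := [ffun c => [ffun q => foldl (act k) (q, false) (h c)]].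
have FE k c q : F k c q = foldl (act k) (q, false) (h c) by rewrite !ffunE.
have eF n : effect n = iter n F (effect 0).
  elim: n => [//|n IH]; rewrite iterS -IH; apply/ffunP => c; apply/ffunP => q.
  by rewrite FE effectE itmS1 act_effect.
have [P [P0 hP]] := iter_idempotent F (effect 0).
by exists P; split=> // n n0; rewrite (eF (n * P)%N) hP // -eF.
Qed.

Variables (P : nat) (HP : forall n, (0 < n)%N -> effect (n * P) = effect P).

Let g c := itm h P [:: c].
Let D q c := foldl dl q (g c).

Definition mark (p : T * Q) := flag p.2 (itm h P [:: p.1]).

Lemma foldl_power n q s : (0 < n)%N -> foldl dl q (itm h (n * P) s) = foldl D q s.
Proof.
move=> n0; elim: s q => [|c s IH] q; first by rewrite itm_nil.
rewrite itm_cons foldl_cat IH /=; congr (foldl D _ s).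
have : effect (n * P) c q = effect P c q by rewrite HP.
by rewrite !effectE => -[].
Qed.

Lemma flag_power n q c : (0 < n)%N -> flag q (itm h (n * P) [:: c]) = mark (c, q).
Proof.
move=> n0; have : effect (n * P) c q = effect P c q by rewrite HP.
by rewrite !effectE => -[].
Qed.

Fixpoint annotate q s := if s is c :: s' then (c, q) :: annotate (D q c) s' else [::].

Definition Hann (p : T * Q) := annotate p.2 (g p.1).

Lemma size_annotate q s : size (annotate q s) = size s.
Proof. by elim: s q => //= c s IH q; rewrite IH. Qed.

Lemma annotate_cat q s t : annotate q (s ++ t) = annotate q s ++ annotate (foldl D q s) t.
Proof. by elim: s q => //= c s IH q; rewrite IH. Qed.

Lemma nth_annotate p0 c0 q s i : (i < size s)%N ->
  nth p0 (annotate q s) i = (nth c0 s i, foldl D q (take i s)).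
Proof. by elim: s q i => // c s IH q [|i] //= /IH. Qed.

(** Both sides are the exit state from an image of [c], under [2 * P] and under [P] iterations. This
    makes annotation by states commute with the morphism. *)
Lemma foldl_image q c : foldl D q (g c) = D q c.
Proof.
rewrite -(@foldl_power 1) // mul1n /g -itmD addnn -mul2n.
by rewrite -/(g c) foldl_power.
Qed.

Lemma ext_annotate q s : ext Hann (annotate q s) = annotate q (ext g s).
Proof.
elim: s q => //= c s IH q; rewrite -cat1s ext_cat ext1 IH -[c :: s]cat1s ext_cat ext1.
by rewrite annotate_cat foldl_image.
Qed.

Lemma itm_annotate n q s : itm Hann n (annotate q s) = annotate q (itm h (n * P) s).
Proof.
rewrite -itm_power; elim: n => [//|n IH]; rewrite /itm !iterS -/(itm _ _ _) IH.
exact: ext_annotate.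
Qed.

Lemma has_mark_annotate q s : has mark (annotate q s) = flag q (itm h P s).
Proof.
elim: s q => [|c s IH] q; first by rewrite itm_nil.
by rewrite itm_cons flag_cat /= IH.
Qed.

(** The letters of [Hann p] are marked according to what happens in the image under [2 * P]
    iterations, where the effect is the same as under [P]. *)
Lemma mark_image p : mark p = has mark (Hann p).
Proof.
case: p => c q; rewrite has_mark_annotate /= /g -itmD addnn -mul2n flag_power //.
Qed.

End Transducer.

(** * From bad states to marked letters *)

Section TransducedGaps.
Variables (R : realType) (T Q : finType) (h : T -> seq T) (a : T) (x : seq T) (u : nat -> T).
Hypothesis ha : h a = a :: x.
Hypothesis hx : forall n, itm h n x <> [::].
Hypothesis hu : forall n i, (i < size (itm h n [:: a]))%N -> u i = nth a (itm h n [:: a]) i.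
Variables (dl : Q -> T -> Q) (bad : pred Q) (q0 : Q).

Definition state t := foldl dl q0 (pre u t).

Let A n := size (itm h n [:: a]).

(** A mark at [t] announces a bad state in the image of the letter at [t], which lies far away. By
    heredity the parent [U s] is marked as well, and its image block contains [t] itself and has
    bounded length. So marks and bad states are within bounded distance of each other. *)
Lemma transducer_gapsup (S : R -> Prop) : subfield_pred S ->
  (forall N, exists t, (N <= t)%N /\ bad (state t.+1)) ->
  (forall P (th : R) (p : {poly int}), (0 < P)%N -> 0 < th ->
     power_growth A P th -> p \is monic -> root (map_poly intr p) th -> S th) ->
  exists L, is_gapsup (fun t => bad (state t.+1)) L /\ S L.
Proof.
move=> hS hinf Sth.
have [P [P0 HP]] := effect_idempotent h dl bad.
pose g c := itm h P [:: c].
pose D q c := foldl dl q (g c).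
pose H := Hann h dl P; pose b := mark h dl bad P.
pose U t := (u t, foldl D q0 (pre u t)).
have annU s : annotate h dl P q0 (pre u s) = pre U s.
  apply: (@eq_from_nth _ (a, q0)); first by rewrite size_annotate !size_pre.
  move=> i; rewrite size_annotate size_pre => is_.
  rewrite (nth_annotate h dl P _ a) ?size_pre // !nth_mkseq //; congr (_, foldl _ _ _).
  apply: (@eq_from_nth _ a); first by rewrite size_takel ?size_pre // ltnW.
  move=> j; rewrite size_takel ?size_pre ?(ltnW is_) // => ji.
  by rewrite nth_take // !nth_mkseq // (ltn_trans ji).
have eA n : itm H n [:: (a, q0)] = annotate h dl P q0 (itm h (n * P) [:: a]).
  by rewrite -(itm_annotate HP).
have [x1 ex1] : exists x1, g a = a :: x1.
  rewrite /g; elim: (P) => [|n [y IH]]; first by exists [::].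
  exists (y ++ itm h n x); rewrite (itm_letterS ha) IH //.
have HU n i : (i < size (itm H n [:: (a, q0)]))%N -> U i = nth (a, q0) (itm H n [:: (a, q0)]) i.
  rewrite eA size_annotate => lt; rewrite (nth_annotate h dl P _ a) // /U (hu lt); congr (_, _).
  by rewrite (pre_take hu (ltnW lt)).
have Ha : H (a, q0) = (a, q0) :: annotate h dl P (D q0 a) x1.
  by rewrite /H /Hann /= -/(g a) ex1.
have HX n : itm H n (annotate h dl P (D q0 a) x1) <> [::].
  move=> e; have : size (itm H n.+1 [:: (a, q0)]) = size (itm H n [:: (a, q0)]).
    by rewrite (itm_letterS Ha) e cats0.
  rewrite !eA !size_annotate => /eqP; rewrite gtn_eqF //.
  apply: leq_trans (size_letter_lt ha hx _) (size_letter_mono ha hx _).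
  by rewrite mulSn -addn1 addnC leq_add2r.
have Hb c : b c = has b (H c) by exact: (mark_image HP).
have posE s : pos H U 1 s = pos h u P s.
  by rewrite /pos -annU (itm_annotate HP) size_annotate mul1n.
have stateE s : state (pos h u P s) = foldl D q0 (pre u s).
  by rewrite /state -(itm_pre ha hx hu) -(foldl_power HP (n := 1)) // mul1n.
have state_block s i : (i < size (itm h P [:: u s]))%N ->
    state (pos h u P s + i).+1 = nth q0 (scanl dl (U s).2 (itm h P [:: u s])) i.
  move=> isz; rewrite nth_scanl // -[(U s).2]stateE /state -foldl_cat -(itm_pre ha hx hu).
  congr (foldl dl q0 _).
  have lt : ((pos h u P s + i).+1 <= pos h u P s.+1)%N by rewrite posS -addnS leq_add2l.
  have -> : pre u (pos h u P s + i).+1 = take (pos h u P s + i).+1 (pre u (pos h u P s.+1)).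
    apply: (@eq_from_nth _ a); first by rewrite size_takel size_pre.
    by move=> j; rewrite size_pre => jl; rewrite nth_take // !nth_mkseq // (leq_trans jl).
  rewrite -(itm_pre ha hx hu) preS -cats1 itm_cat take_cat -/(pos h u P s) -addnS.
  by rewrite ltnNge leq_addr /= addKn.
pose K := (\max_c size (g c))%N.
have blkK s : (pos h u P s.+1 <= pos h u P s + K)%N.
  by rewrite posS leq_add2l; exact: (leq_bigmax (u s)).
have toBad : close (fun t => b (U t)) (fun t => bad (state t.+1)).
  exists K => t bt; have [s st] := pos_block Ha HX HU 1 t.
  have := marked_block Ha HX HU Hb st bt; rewrite !posE in st.
  move: st (blkK s) => /andP[s1 s2] s3 /(has_nthP q0)[i]; rewrite size_scanl /= => isz bi.
  exists (pos h u P s + i)%N; rewrite state_block //.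
  have : (pos h u P s + i < pos h u P s.+1)%N by rewrite posS ltn_add2l.
  by split=> //; lia.
have ofBad : close (fun t => bad (state t.+1)) (fun t => b (U t)).
  exists K => t bt; have [s /andP[s1 s2]] := pos_block ha hx hu P t.
  have isz : (t - pos h u P s < size (itm h P [:: u s]))%N by rewrite ltn_subLR // -posS.
  have bs : b (U s).
    apply/(has_nthP q0); exists (t - pos h u P s)%N; first by rewrite size_scanl.
    by rewrite -state_block // subnKC.
  have : has b (itm H 1 [:: U s]) by rewrite (has_itm_inv Hb) /= bs.
  move=> /(has_nthP (a, q0))[k ksz bk]; exists (pos H U 1 s + k)%N.
  rewrite (nth_pos Ha HX HU ksz); have : (pos H U 1 s + k < pos H U 1 s.+1)%N.
    by rewrite posS ltn_add2l.
  by rewrite !posE => s4; have := blkK s; split=> //; lia.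
have Uinf N : exists t, (N <= t)%N /\ b (U t).
  have [K' hK'] := ofBad; have [t [Nt bt]] := hinf (N + K')%N.
  have [t' [bt' tt' _]] := hK' t bt; exists t'; split=> //.
  by rewrite -(leq_add2r K') (leq_trans Nt).
have [|L [hL SL]] := @marked_gapsup R _ H (a, q0) _ U Ha HX HU b Hb Uinf S hS.
  move=> P' th p P'0 th0 hth; apply: (Sth (P' * P)%N) => //; first by rewrite muln_gt0 P'0.
  have e n : size (itm H (n * P') [:: (a, q0)]) = A (n * (P' * P)).
    by rewrite eA size_annotate mulnA.
  by apply: near_cvg hth; apply: nearW => n; rewrite !e.
by exists L; split=> //; exact: (gapsup_close toBad ofBad hL).
Qed.

End TransducedGaps.

(** * Maximal blocks *)

Section Windows.
Variables (w : nat -> nat) (x : seq nat).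
Hypothesis x0 : x <> [::].
Let p := size x.

Definition window t : seq nat := mkseq (fun i => w (t + i)) (size x).
Definition good t := window t \in [seq rot r x | r <- iota 0 (size x)].

Let p_gt0 : (0 < p)%N.
Proof. by rewrite lt0n -/(nilp _); apply/nilP. Qed.

Lemma nth_rot d r k (s : seq nat) : (r <= size s)%N -> (k < size s)%N ->
  nth d (rot r s) k = nth d s ((k + r) %% size s).
Proof.
move=> rp kp; rewrite /rot nth_cat size_drop nth_drop; case: ltnP => h.
  by rewrite addnC modn_small //; lia.
rewrite nth_take; last by lia.
congr nth; have -> : (k + r = k - (size s - r) + size s)%N by lia.
by rewrite modnDr modn_small //; lia.
Qed.

Lemma goodP t : reflect (exists2 r, (r < p)%N & forall k, (k < p)%N -> w (t + k) = nth 0%N x ((k + r) %% p))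
  (good t).
Proof.
apply: (iffP mapP) => -[r].
  rewrite mem_iota /= add0n => rp e; exists r => // k kp.
  have := congr1 (fun s => nth 0%N s k) e.
  by rewrite nth_mkseq // nth_rot // ltnW.
move=> rp h; exists r; first by rewrite mem_iota.
apply: (@eq_from_nth _ 0%N); first by rewrite size_mkseq size_rot.
move=> k; rewrite size_mkseq => kp.
by rewrite nth_mkseq // nth_rot // ?(ltnW rp) // h.
Qed.

(* Rotations of x have the same letters, so the letter entering the window is the one leaving it. *)
Lemma good_step t : good t -> good t.+1 -> w (t + p) = w t.
Proof.
move=> /mapP[r _ e1] /mapP[r' _ e2].
have pe : perm_eq (window t) (window t.+1).
  rewrite e1 e2; apply: (@perm_trans _ x); first by rewrite perm_rot.
  by rewrite perm_sym perm_rot.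
pose m := mkseq (fun i => w (t + i.+1)) p.-1.
have w1 : window t = w t :: m.
  by rewrite /window -/p -(prednK p_gt0) /mkseq /= addn0 (iotaDl 1 0) -map_comp.
have w2 : window t.+1 = rcons m (w (t + p)).
  rewrite /window -/p -[X in mkseq _ X](prednK p_gt0) mkseqS; congr rcons.
    by apply: eq_mkseq => i; rewrite addSnnS.
  by rewrite addSnnS prednK.
move: pe; rewrite w1 w2 perm_sym perm_rcons -(cat1s (w (t + p)) m) -(cat1s (w t) m) perm_cat2r.
by move=> /perm_mem/(_ (w (t + p))); rewrite !inE eqxx => /esym/eqP.
Qed.

(** With [good_prev] a converse of [good_step]: a block that could be extended by a letter would
    have a good window beyond its end. *)
Lemma good_next t : good t -> w (t + p) = w t -> good t.+1.
Proof.
move=> /goodP[r rp h] e; apply/goodP; exists (r.+1 %% p)%N; first by rewrite ltn_mod.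
move=> k kp; rewrite modnDmr addnS -addSn addSnnS; have [kp'|] := ltnP k.+1 p; first exact: h.
move=> pk; have -> : k.+1 = p by apply/eqP; rewrite eqn_leq pk andbT.
rewrite e -[t in LHS]addn0 h // add0n modnDl modn_small //.
Qed.

Lemma good_prev t : good t.+1 -> w (t + p) = w t -> good t.
Proof.
move=> /goodP[r rp h] e; apply/goodP; exists ((r + p.-1) %% p)%N; first by rewrite ltn_mod.
have h' k : (k < p)%N -> w (t.+1 + k) = nth 0%N x ((k.+1 + (r + p.-1)) %% p).
  move=> kp; rewrite h // addSnnS -addnS prednK // addnA modnDr //.
case=> [|k] kp; last by rewrite modnDmr addnS -addSn h' // ltnW.
rewrite addn0 modnDmr add0n -e -[p in LHS](prednK p_gt0) -addSnnS h' ?prednK //.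
by rewrite modnDl.
Qed.

Lemma good_stretch_from s r : (forall k, (k < p)%N -> w (s + k) = nth 0%N x ((k + r) %% p)) ->
  forall e, (forall t, (s <= t <= e)%N -> good t) ->
  forall k, (s + k < e + p)%N -> w (s + k) = nth 0%N x ((k + r) %% p).
Proof.
move=> hr e h k; have [n] := ubnP k; elim: n k => // n IH k; rewrite ltnS => kn ske.
have [kp|pk] := ltnP k p; first exact: hr.
have ek : (s + k = s + (k - p) + p)%N by lia.
rewrite ek good_step; [|by apply: h; lia|by apply: h; lia].
rewrite IH; [|by move: p_gt0; lia|by lia].
by rewrite -[in RHS](subnK pk) addnAC modnDr.
Qed.

(** The offset is taken between 1 and [p], not between 0 and [p - 1], so that [drop r x] is a proper
    suffix. *)
Lemma good_stretch s e : (s <= e)%N -> (forall t, (s <= t <= e)%N -> good t) ->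
  exists2 r, (0 < r <= p)%N & forall k, (s + k < e + p)%N -> w (s + k) = nth 0%N x ((k + r) %% p).
Proof.
move=> se h; have /goodP[r rp hr] : good s by apply: h; rewrite leqnn.
have main := good_stretch_from hr h.
case: r rp {hr} main => [|r] rp main; last by exists r.+1 => //; exact: ltnW.
exists p; first by rewrite p_gt0 leqnn.
by move=> k /main ->; rewrite addn0 modnDr.
Qed.

Lemma app_cat (s t : seq nat) : app s t = s ++ t.
Proof. by []. Qed.

Lemma nth_nth (s : seq nat) n d : List.nth n s d = nth d s n.
Proof. by elim: s n => [|y s IH] [|n] /=. Qed.

Lemma factorE i j : Defs.factor w i j = mkseq (fun k => w (i + k)) (j.+1 - i).
Proof.
suff gen n k : List.map w (List.seq k n) = mkseq (fun m => w (k + m)) n by exact: gen.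
elim: n k => [//|n IH] k /=; rewrite IH /mkseq /= addn0 (iotaDl 1 0) -map_comp; congr (_ :: _).
by apply: eq_map => m /=; rewrite addSnnS.
Qed.

Lemma size_lpow n : size (Defs.lpow x n) = (n * p)%N.
Proof.
by elim: n => // n IH; rewrite /Defs.lpow /= app_cat size_cat -/(Defs.lpow x n) IH mulSn.
Qed.

Lemma nth_lpow n k : (k < n * p)%N -> nth 0%N (Defs.lpow x n) k = nth 0%N x (k %% p).
Proof.
elim: n k => // n IH k lt; rewrite /Defs.lpow /= app_cat -/(Defs.lpow x n) nth_cat -/p.
case: ltnP => [kp|pk]; first by rewrite modn_small.
by rewrite IH ?ltn_subLR // -[in RHS](subnK pk) modnDr.
Qed.

(** A block reads the periodic word of [x] from offset [size u] on, [u] being the part missing from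
    its first copy. *)
Lemma nth_block x' x'' u v n k : x = u ++ x' -> x = x'' ++ v ->
  (k < size (x' ++ Defs.lpow x n ++ x''))%N ->
  nth 0%N (x' ++ Defs.lpow x n ++ x'') k = nth 0%N x ((k + size u) %% p).
Proof.
move=> e1 e2; rewrite !size_cat size_lpow => kl.
have -> : nth 0%N (x' ++ Defs.lpow x n ++ x'') k = nth 0%N (u ++ x' ++ Defs.lpow x n ++ x'') (k + size u).
  by rewrite [RHS]nth_cat ltnNge leq_addl /= addnK.
have sp : (size u + size x' = p)%N by rewrite -size_cat -e1.
have sp2 : (size x'' + size v = p)%N by rewrite -size_cat -e2.
rewrite catA -e1 nth_cat -/p; case: ltnP => h; first by rewrite modn_small.
rewrite -[in RHS](subnK h) modnDr nth_cat size_lpow.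
case: ltnP => h2; first exact: nth_lpow.
have lt : (k + size u - p - n * p < size x'')%N by lia.
have -> : ((k + size u - p) %% p = k + size u - p - n * p)%N.
  rewrite -[in LHS](subnK h2) addnC modnMDl modn_small //; apply: leq_trans lt _; lia.
by rewrite e2 nth_cat lt.
Qed.

Lemma maximal_block_good i j t : Defs.maximal_x_block w x i j -> (i <= t)%N -> (t + p <= j.+1)%N -> good t.
Proof.
move=> [ij [x' [x'' [n [[u [u0 e1]] [[v [v0 e2]] [n1 [ef _]]]]]]]] it tj.
rewrite factorE !app_cat in ef.
apply/goodP; exists ((t - i + size u) %% p)%N; first by rewrite ltn_mod.
move=> k kp; rewrite modnDmr.
have lt : (t - i + k < j.+1 - i)%N by lia.
have := congr1 (fun s => nth 0%N s (t - i + k)) ef.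
rewrite nth_mkseq // (nth_block e1 e2); last by rewrite -ef size_mkseq.
by rewrite addnA subnKC // => ->; congr (nth _ _ (_ %% _)); lia.
Qed.

Lemma maximal_block_le i j : Defs.maximal_x_block w x i j -> (i <= j)%N.
Proof. by case=> /ssrnat.leP. Qed.

Lemma good_maximal_block s e : (s + p <= e.+1)%N -> (forall t, (s <= t <= e)%N -> good t) ->
  ~~ good e.+1 -> s = 0%N \/ ~~ good s.-1 -> Defs.maximal_x_block w x s (e + p.-1).
Proof.
move=> spe h he hs.
have se : (s <= e)%N by move: p_gt0; lia.
have [r /andP[r0 rp] hr] := good_stretch se h.
pose l := (e + p - s - (p - r))%N.
have el : l = (e - s + r)%N by rewrite /l; lia.
have jS : ((e + p.-1).+1 = e + p)%N by rewrite -addnS prednK.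
have e1 : x = take r x ++ drop r x by rewrite cat_take_drop.
have e2 : x = take (l %% p) x ++ drop (l %% p) x by rewrite cat_take_drop.
have lp : (l %% p < p)%N by rewrite ltn_mod.
have sz1 : size (drop r x) = (p - r)%N by rewrite size_drop.
have sz2 : size (take (l %% p) x) = (l %% p)%N by rewrite size_takel // ltnW.
have sz3 : size (take r x) = r by rewrite size_takel.
(* At least [p] consecutive good windows and [r >= 1] guarantee one full copy of [x] after the
   suffix [drop r x]. *)
have n1 : (0 < l %/ p)%N by rewrite divn_gt0 //; rewrite el; lia.
split; first by apply/ssrnat.leP; lia.
exists (drop r x), (take (l %% p) x), (l %/ p)%N.
split; first by exists (take r x); split=> // e0; move: sz3 r0; rewrite e0 /= => <-.
split.
  exists (drop (l %% p) x); split=> // e0; have := size_drop (l %% p) x.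
  by rewrite e0 -/p /=; lia.
split; first exact/ssrnat.leP.
split.
  rewrite factorE !app_cat jS.
  have ss : size (drop r x ++ Defs.lpow x (l %/ p) ++ take (l %% p) x) = (e + p - s)%N.
    rewrite !size_cat size_lpow sz1 sz2 -divn_eq /l; lia.
  apply: (@eq_from_nth _ 0%N); first by rewrite size_mkseq ss.
  move=> k; rewrite size_mkseq => kl; rewrite nth_mkseq // (nth_block e1 e2) ?ss // sz3.
  by apply: hr; lia.
split.
  move=> [v ev]; move/negP: he; apply; apply: good_next; first by apply: h; rewrite se leqnn.
  have := congr1 (fun s => nth 0%N s (l %% p)) ev.
  rewrite !app_cat -catA nth_cat sz2 ltnn subnn /= => h1.
  have -> : (e + p = (e + p.-1).+1)%N by rewrite jS.
  rewrite -h1 -(subnKC se) hr; last by lia.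
  by rewrite el.
case: hs => [->|hs]; [by left|right] => -[u eu].
have s0 : (0 < s)%N by case: (s) hs se h => // h0 _ h1; rewrite h1 // in h0.
move/negP: hs; apply; apply: good_prev; first by rewrite prednK //; apply: h; rewrite leqnn.
have := congr1 (fun s => nth 0%N s r.-1) eu.
have su : size u = r.-1.
  have := congr1 size eu; rewrite app_cat size_cat /= sz1 -/p; lia.
rewrite app_cat nth_cat su ltnn subnn /= => h1.
have <- : (s - 1 = s.-1)%N by lia.
rewrite -[RHS]h1 (_ : (s - 1 + p = s + p.-1)%N); last by lia.
rewrite hr; last by lia.
congr nth; rewrite (_ : (p.-1 + r = r.-1 + p)%N); last by lia.
by rewrite modnDr modn_small //; lia.
Qed.

Lemma modE (n m : nat) : (0 < m)%N -> PeanoNat.Nat.modulo n m = (n %% m)%N.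
Proof.
move=> m0; apply/esym/(PeanoNat.Nat.mod_unique _ _ (n %/ m)).
  by apply/ssrnat.ltP; rewrite ltn_mod.
by rewrite {1}(divn_eq n m) mulnC.
Qed.

Lemma bad_infinitely_often : ~ Defs.has_suffix_xomega w x ->
  forall N, exists t, (N <= t)%N /\ ~~ good t.
Proof.
move=> nsuf N; apply: contrapT => hN; apply: nsuf.
have hg t : (N <= t)%N -> good t.
  by move=> Nt; apply: contraT => ng; exfalso; apply: hN; exists t.
have /goodP[r rp hr] := hg N (leqnn N).
have main k : w (N + k) = nth 0%N x ((k + r) %% p).
  by apply: (good_stretch_from hr (e := (N + k)%N)) => [t /andP[Nt _]|]; [exact: hg | rewrite -[X in (X < _)%N]addn0 ltn_add2l].
(* Skipping [p - r] letters brings the offset back to the beginning of [x]. *)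
exists (N + (p - r))%N => n; rewrite nth_nth modE //.
change (N + (p - r) + n)%coq_nat with (N + (p - r) + n)%N.
by rewrite -addnA main addnAC subnK ?(ltnW rp) // modnDl.
Qed.

End Windows.

Section Blocks.
Variables (R : realType) (w : nat -> nat) (x : seq nat).
Hypothesis x0 : x <> [::].
Let p := size x.

Let p_gt0 : (0 < p)%N.
Proof. by rewrite lt0n -/(nilp _); apply/nilP. Qed.

Lemma nat_upper (y : R) : exists n : nat, y <= n%:R.
Proof. by exists (Num.truncn y).+1; apply/ltW; exact: truncnS_gt. Qed.

(** A block ends less than [p] after any bad position beyond its start, which gives the upper bound.
    Conversely a long gap between bad positions [b] and [q] is the maximal block from [b.+1] to
    [q - 2 + p]. The bounded errors vanish in the ratio. *)
Lemma blocks_limsup (ib jb : nat -> nat) (L : R) :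
  (forall k, (ib k < ib k.+1)%N) ->
  (forall k, Defs.maximal_x_block w x (ib k) (jb k)) ->
  (forall s t, Defs.maximal_x_block w x s t -> exists k, ib k = s /\ jb k = t) ->
  is_gapsup (fun t => ~~ good w x t) L ->
  (forall e, 0 < e -> exists N, forall k, (N <= k)%N -> (jb k)%:R / (ib k)%:R < L + e) /\
  (forall e, 0 < e -> forall N, exists k, (N <= k)%N /\ L - e < (jb k)%:R / (ib k)%:R).
Proof.
move=> ibS blk enum [L1 Lup Llow].
have ibk k : (k <= ib k)%N by elim: k => // k IH; exact: leq_ltn_trans (ibS k).
have ibm m n : (m <= n)%N -> (ib m <= ib n)%N.
  by move/subnK <-; elim: (n - m)%N => // k IH; rewrite addSn (leq_trans IH) // ltnW.
split=> e e0.
  have [N hN] := Lup (L + e / 2) ltac:(lra).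
  have [m hm] := nat_upper (p%:R / (e / 2)).
  exists (maxn N m).+1 => k; rewrite gtn_max => /andP[Nk mk].
  have i0 : (0 < ib k)%N by apply: leq_trans (ibk k); exact: leq_ltn_trans mk.
  have [s [bs ks sk]] := hN (ib k) (leq_trans (ltnW Nk) (ibk k)).
  have js : (jb k < s + p)%N.
    rewrite ltnNge; apply/negP => le; move/negP: bs; apply.
    by apply: (maximal_block_good x0 (blk k)) => //; exact: leqW.
  have js' : (jb k)%:R < s%:R + p%:R :> R by rewrite -natrD ltr_nat.
  have mk' : m%:R <= (ib k)%:R :> R by rewrite ler_nat (leq_trans (ltnW mk)).
  have := le_trans hm mk'; rewrite ler_pdivrMr ?divr_gt0 // => pe.
  rewrite ltr_pdivrMr ?ltr0n //; lra.
(* For a target below 1 any block that starts after position 0 will do; the index [N.+1] ensures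
   this. *)
move=> N; have [Le|Le] := ltP (L - e) 1.
  exists N.+1; split=> //; apply: lt_le_trans Le _.
  have i0 : (0 < ib N.+1)%N by exact: leq_ltn_trans (ibk N.+1).
  by rewrite ler_pdivlMr ?ltr0n // mul1r ler_nat; exact: maximal_block_le (blk _).
have nup : ~ gap_up (fun t => ~~ good w x t) (L - e / 2) by apply: Llow; lra.
have [N0 hN0] := Lup (L + 1) ltac:(lra).
have [m hm] := nat_upper (2 / e).
(* A bad position [b0] beyond [q0] is fixed before [t]. The last bad position before [t] is then at
   least [b0], so the block found starts after [ib N]. *)
pose q0 := (N0 + (ib N).+1 + m)%N.
have q0N : (ib N <= q0)%N.
  by rewrite /q0 -addnA addnCA; exact: leq_trans (leqnSn _) (leq_addr _ _).
have [m1 hm1] := nat_upper ((L + 1) * q0%:R).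
have [m2 hm2] := nat_upper (p%:R / (e / 2)).
have [t [tN hfree]] : exists t, (m1 + m2 < t)%N /\
    forall s, ~~ good w x s -> (t <= s)%N -> (L - e / 2) * t%:R < s%:R.
  apply: contrapT => hn; apply: nup; exists (m1 + m2).+1 => t ht; apply: contrapT => hn2.
  apply: hn; exists t; split=> // s bs ts; rewrite ltNge; apply/negP => le; apply: hn2.
  by exists s.
have t_m1 : m1%:R < t%:R :> R by rewrite ltr_nat (leq_ltn_trans _ tN) // leq_addr.
have t_m2 : m2%:R < t%:R :> R by rewrite ltr_nat (leq_ltn_trans _ tN) // leq_addl.
have [b0 [bb0 qb0 b0q]] := hN0 q0 ltac:(by rewrite /q0 -addnA leq_addr).
have b0t : (b0 < t)%N by rewrite -(ltr_nat R); lra.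
have tN0 : (N0 <= t)%N by apply: leq_trans (ltnW b0t); apply: leq_trans qb0; rewrite /q0 -addnA leq_addr.
have [b1 [bb1 tb1 _]] := hN0 t tN0.
have [b [q [bt tq /andP[bb bq] free]]] := @pred_neighbours (fun t => ~~ good w x t) _ _ _ b0t bb0 tb1 bb1.
have b0b : (b0 <= b)%N.
  rewrite leqNgt; apply/negP => lt; have := free b0; rewrite lt (leq_trans b0t tq) bb0.
  by move=> /(_ isT).
have qt : (L - e / 2) * t%:R < q%:R by exact: hfree.
have t0 : 0 <= t%:R :> R by [].
have tp : t%:R + p%:R <= q%:R :> R.
  move: hm2; rewrite ler_pdivrMr ?divr_gt0 // => hm2.
  have : 1 * t%:R <= (L - e) * t%:R by rewrite ler_wpM2r.
  have : m2%:R * (e / 2) <= t%:R * (e / 2) by rewrite ler_pM2r ?divr_gt0 // ltW.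
  lra.
have tpq : (t + p <= q)%N by rewrite -(ler_nat R) natrD.
have q_gt0 : (0 < q)%N by apply: leq_trans tq; apply: leq_ltn_trans b0t.
have qE : q.-1.+1 = q by rewrite prednK.
have [k [ik jk]] : exists k, ib k = b.+1 /\ jb k = (q.-1 + p.-1)%N.
  apply: enum; apply: (good_maximal_block x0).
  - by rewrite qE (leq_trans _ tpq) // leq_add2r.
  - move=> i /andP[i1 i2]; have := free i; rewrite negbK; apply.
    by rewrite i1 -qE ltnS.
  - by rewrite qE.
  - by right.
have Nk : (N < k)%N.
  rewrite ltnNge; apply/negP => /ibm; rewrite ik leqNgt => /negP; apply.
  by rewrite ltnS (leq_trans _ b0b) // (leq_trans q0N).
exists k; split; first exact: ltnW.
rewrite ik jk ltr_pdivlMr ?ltr0n //.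
have h1 : q%:R <= (q.-1 + p.-1)%:R + 1 :> R.
  by rewrite natr1 ler_nat -addSn qE leq_addr.
have h2 : b.+1%:R <= t%:R :> R by rewrite ler_nat.
have h3 : m%:R <= b.+1%:R :> R.
  by rewrite ler_nat leqW // (leq_trans _ b0b) // (leq_trans _ qb0) // leq_addl.
have := le_trans hm h3; rewrite ler_pdivrMr // => h4.
have : (L - e / 2) * b.+1%:R <= (L - e / 2) * t%:R by rewrite ler_pM2l //; lra.
lra.
Qed.

End Blocks.

Section Morphic.
Variables (R : realType) (T : finType) (h : T -> seq T) (a : T) (y : seq T) (u : nat -> T).
Hypothesis ha : h a = a :: y.
Hypothesis hy : forall n, itm h n y <> [::].
Hypothesis hu : forall n i, (i < size (itm h n [:: a]))%N -> u i = nth a (itm h n [:: a]) i.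
Variables (tau : T -> nat) (w : nat -> nat) (x : seq nat).
Hypothesis wE : forall n, w n = tau (u n).
Hypothesis x0 : x <> [::].
Let A n := size (itm h n [:: a]).

(* The transducer remembers the last |x| letters read. *)
Lemma morphic_gapsup (S : R -> Prop) : subfield_pred S ->
  (forall N, exists t, (N <= t)%N /\ ~~ good w x t) ->
  (forall P (th : R) (p : {poly int}), (0 < P)%N -> 0 < th ->
     power_growth A P th -> p \is monic -> root (map_poly intr p) th -> S th) ->
  exists L, is_gapsup (fun t => ~~ good w x t) L /\ S L.
Proof.
move=> hS hinf Sth.
have [p sx] : exists p, size x = p.+1.
  by exists (size x).-1; rewrite prednK // lt0n -/(nilp _); apply/nilP.
pose dl (q : p.+1.-tuple T) c : p.+1.-tuple T := [tuple of rcons (behead q) c].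
pose bad (q : p.+1.-tuple T) := [seq tau c | c <- q] \notin [seq rot r x | r <- iota 0 (size x)].
(* An arbitrary filling; it is visible only in the first [p] states that are tested. *)
pose q0 : p.+1.-tuple T := [tuple of nseq p.+1 a].
have foldE s q : val (foldl dl q s) = drop (size s) (val q ++ s).
  elim: s q => [|c s IH] q; first by rewrite cats0 drop0.
  rewrite /= IH /=; case: q => -[//|d q] _ /=.
  by rewrite cat_rcons.
have stateE t : bad (state u dl q0 (t + p.+1)) = ~~ good w x t.
  suff e : [seq tau c | c <- state u dl q0 (t + p.+1)] = window w x t by rewrite /bad e.
  rewrite /state foldE size_pre drop_cat size_nseq ltnNge leq_addl /= addnK.
  apply: (@eq_from_nth _ 0%N); first by rewrite size_map size_drop size_pre size_mkseq sx addKn.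
  move=> i; rewrite size_map size_drop size_pre addKn => ip.
  rewrite (nth_map a) ?size_drop ?size_pre ?addKn // nth_drop !nth_mkseq ?sx ?ltn_add2l //.
pose B t : Prop := bad (state u dl q0 t.+1).
have ofB : close B (fun t => ~~ good w x t).
  have [t0 [_ bt0]] := hinf 0%N; exists (t0 + p)%N => t Bt.
  (* Before [p] the memory still contains the filling; a fixed bad position [t0] is then near
     enough, with distance at most [t0 + p]. *)
  have [tp|pt] := ltnP t p; first by exists t0; split=> //; lia.
  exists (t - p)%N; rewrite -stateE; have -> : (t - p + p.+1 = t.+1)%N by lia.
  by split=> //; lia.
have toB : close (fun t => ~~ good w x t) B.
  by exists p => t; rewrite -stateE addnS => bt; exists (t + p)%N; split=> //; lia.
have Binf N : exists t, (N <= t)%N /\ bad (state u dl q0 t.+1).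
  by have [t [Nt bt]] := hinf N; exists (t + p)%N; rewrite -addnS stateE; split=> //; lia.
have [L [hL SL]] := transducer_gapsup ha hy hu hS Binf Sth.
by exists L; split=> //; exact: (gapsup_close ofB toB hL).
Qed.

End Morphic.

(** * Transfer to the real numbers of the standard library *)

Section Stdlib.
Notation RR := Rdefinitions.R.

Definition Z_of_int (z : int) : BinNums.Z :=
  match z with Posz n => BinInt.Z.of_nat n | Negz n => BinInt.Z.opp (BinInt.Z.of_nat n.+1) end.

Lemma IZR_of_int z : Rdefinitions.IZR (Z_of_int z) = z%:~R :> RR.
Proof.
case: z => n /=; first by rewrite -RIneq.INR_IZR_INZ INRE.
have -> : Rdefinitions.IZR (BinNums.Zneg (BinPos.Pos.of_succ_nat n)) =
    Rdefinitions.Ropp (Rdefinitions.IZR (BinInt.Z.of_nat n.+1)) by rewrite -RIneq.opp_IZR.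
by rewrite -RIneq.INR_IZR_INZ INRE NegzE mulrNz.
Qed.

Lemma Z_of_int_neq0 z : z != 0 -> Z_of_int z <> BinNums.Z0.
Proof.
move=> z0 e; have := IZR_of_int z; rewrite e R0E => /esym/eqP.
by rewrite intr_eq0 (negbTE z0).
Qed.

Definition rational (r : RR) := exists q : rat, r = ratr q.

Lemma rational_subfield : subfield_pred rational.
Proof.
split; first by exists 1; rewrite rmorph1.
- by move=> _ _ [q ->] [q' ->]; exists (q - q'); rewrite rmorphB.
- by move=> _ _ [q ->] [q' ->]; exists (q * q'); rewrite rmorphM.
- by move=> _ [q ->]; exists q^-1; rewrite fmorphV.
Qed.

Lemma rational_is_rational r : rational r -> Defs.is_rational r.
Proof.
move=> [q ->]; exists (Z_of_int (numq q)), (Z_of_int (denq q)); split.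
  by apply: Z_of_int_neq0; exact: denq_neq0.
by rewrite !IZR_of_int RdivE.
Qed.

Definition algebraic (r : RR) := algebraicOver (ratr : rat -> RR) r.

Lemma algebraic_subfield : subfield_pred algebraic.
Proof.
split; first exact: algebraic1.
- by move=> x y; exact: algebraic_sub.
- by move=> x y; exact: algebraic_mul.
- by move=> x; exact: algebraic_inv.
Qed.

Lemma zpoly_evalE (s : seq int) r :
  Defs.zpoly_eval (map Z_of_int s) r = horner_rec (map intr s) r.
Proof.
rewrite /Defs.zpoly_eval; elim: s => [|z s IH] //=.
by rewrite IH IZR_of_int RplusE RmultE addrC mulrC.
Qed.

Lemma algebraic_is_algebraic r : algebraic r -> Defs.is_algebraic r.
Proof.
move=> [p p0 rp]; have [q [a a0 ep]] := rat_poly_scale p.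
have q0 : q != 0.
  by apply: contraNneq p0 => q0; rewrite ep q0 map_poly0 scaler0.
have rq : root (map_poly intr q : {poly RR}) r.
  move: rp; rewrite ep linearZ /= rootZ; last first.
    by rewrite fmorph_eq0 invr_eq0 intr_eq0.
  by rewrite -map_poly_comp (eq_map_poly (g := intr)) // => z /=; rewrite ratr_int.
exists (map Z_of_int q); split.
  exists (Z_of_int (lead_coef q)); split; last by apply: Z_of_int_neq0; rewrite lead_coef_eq0.
  apply: List.in_map; have : lead_coef q \in (q : seq int).
    by rewrite lead_coefE mem_nth // prednK // size_poly_gt0.
  elim: (q : seq int) => //= z s IH; rewrite inE => /predU1P[->|/IH]; [by left | by right].
rewrite zpoly_evalE -horner_Poly -map_polyE; exact/rootP.
Qed.

Lemma limsup_of_order (f : nat -> RR) (L : RR) :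
  (forall e : RR, 0 < e -> exists N, forall k, (N <= k)%N -> f k < L + e) ->
  (forall e : RR, 0 < e -> forall N, exists k, (N <= k)%N /\ L - e < f k) ->
  Defs.is_finite_limsup f L.
Proof.
move=> h1 h2; split=> e /RltP e0.
  have [N hN] := h1 e e0; exists N => k /ssrnat.leP Nk; apply/RltP; exact: hN.
move=> N; have [k [Nk hk]] := h2 e e0 N; exists k; split; first exact/ssrnat.leP.
exact/RltP.
Qed.

Lemma sizeE (A : Type) (s : seq A) : length s = size s.
Proof. by elim: s => //= _ s ->. Qed.

Lemma Nat_iterE (A : Type) n (f : A -> A) s : PeanoNat.Nat.iter n f s = iter n f s.
Proof. by elim: n => //= n ->. Qed.

Section Letters.
Variables (c : nat) (h : nat -> seq nat) (a : nat) (u : nat -> nat).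
Hypothesis hmor : Defs.morphism_on c h.
Hypothesis hpro : Defs.prolongable c h a.
Hypothesis hfix : Defs.is_fixed_point_word h a u.

Lemma prolongable_lt : (a < c)%N.
Proof. by case: hpro => /ssrnat.ltP. Qed.

Let a' : 'I_c := Ordinal prolongable_lt.

(** Brings the letters below [c] into a finite type. [pmap insub] would drop letters out of range,
    but [morphism_on] leaves none to drop. *)
Definition ord_morphism (i : 'I_c) : seq 'I_c := pmap insub (h i).

Lemma map_val_pmap (s : seq nat) : (forall y, List.In y s -> (y < c)%N) ->
  map val (pmap insub s : seq 'I_c) = s.
Proof.
elim: s => //= y s IH hs; have yc : (y < c)%N by apply: hs; left.
by rewrite insubT /= IH // => z zs; apply: hs; right.
Qed.

Lemma map_val_ord i : map val (ord_morphism i) = h i.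
Proof.
apply: map_val_pmap => y hy; apply/ssrnat.ltP; apply: (hmor _ hy).
exact/ssrnat.ltP.
Qed.

Lemma map_val_ext s : map val (ext ord_morphism s) = Defs.hlist h (map val s).
Proof.
elim: s => [//|i s IH]; rewrite /ext /= map_cat map_val_ord.
by rewrite /Defs.hlist /=; congr cat; exact: IH.
Qed.

Lemma map_val_itm n s : map val (itm ord_morphism n s) = PeanoNat.Nat.iter n (Defs.hlist h) (map val s).
Proof. by rewrite Nat_iterE; elim: n => //= n <-; rewrite map_val_ext. Qed.

Lemma size_itm_ord n s : size (itm ord_morphism n s) = size (PeanoNat.Nat.iter n (Defs.hlist h) (map val s)).
Proof. by rewrite -map_val_itm size_map. Qed.

Lemma ord_prolongable : exists y, ord_morphism a' = a' :: y /\ forall n, itm ord_morphism n y <> [::].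
Proof.
have [_ [x [ex [_ hx]]]] := hpro.
have e : map val (ord_morphism a') = a :: x by rewrite map_val_ord.
case E : (ord_morphism a') e => [//|i y] /= [ei ey]; exists y; split.
  by congr (_ :: _); exact: val_inj.
move=> n en; apply: (hx n); by rewrite -ey -map_val_itm en.
Qed.

Lemma val_fixed n i : (i < size (itm ord_morphism n [:: a']))%N ->
  u i = val (nth a' (itm ord_morphism n [:: a']) i).
Proof.
move=> lt.
have lt' : (i < length (PeanoNat.Nat.iter n (Defs.hlist h) [:: a]))%coq_nat.
  by apply/ssrnat.ltP; rewrite sizeE; move: lt; rewrite size_itm_ord.
rewrite (hfix lt') nth_nth -[[:: a]]/(map val [:: a']) -map_val_itm.
by rewrite -[RHS](nth_map a' 0%N).
Qed.

Definition ord_word (i : nat) : 'I_c := insubd a' (u i).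

Lemma ord_word_fixed n i : (i < size (itm ord_morphism n [:: a']))%N ->
  ord_word i = nth a' (itm ord_morphism n [:: a']) i.
Proof. by move=> lt; rewrite /ord_word (val_fixed lt) valKd. Qed.

Lemma val_ord_word i : val (ord_word i) = u i.
Proof.
have [y [ey hy]] := ord_prolongable.
have lt := size_letter_gt ey hy i.
by rewrite (ord_word_fixed lt) -val_fixed.
Qed.

Lemma blocks_limsup_of_morphic (tau : nat -> nat) (w : nat -> nat) (x : seq nat) (ib jb : nat -> nat)
  (S : RR -> Prop) :
  (forall n, w n = tau (u n)) -> x <> [::] -> ~ Defs.has_suffix_xomega w x ->
  Defs.enumerates_maximal_blocks w x ib jb -> subfield_pred S ->
  (forall P (th : RR) (p : {poly int}), (0 < P)%N -> 0 < th ->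
     power_growth (fun n => size (itm ord_morphism n [:: a'])) P th -> p \is monic -> root (map_poly intr p) th -> S th) ->
  exists L, Defs.is_finite_limsup (fun k => Rdefinitions.Rdiv (Raxioms.INR (jb k)) (Raxioms.INR (ib k))) L /\ S L.
Proof.
move=> wE x0 nsuf [ibS [blk enum]] hS Sth.
have [y [ey hy]] := ord_prolongable.
have wE' n : w n = tau (val (ord_word n)) by rewrite val_ord_word.
have [L [hL SL]] := @morphic_gapsup _ _ _ _ _ _ ey hy ord_word_fixed (fun i => tau (val i)) w x wE' x0 S hS (bad_infinitely_often x0 nsuf) Sth.
exists L; split=> //.
have ibS' k : (ib k < ib k.+1)%N by apply/ssrnat.ltP.
have [h1 h2] := blocks_limsup x0 ibS' blk enum hL.
apply: limsup_of_order => e e0.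
  have [N hN] := h1 e e0; exists N => k Nk; rewrite RdivE !INRE; exact: hN.
by move=> N; have [k [Nk hk]] := h2 e e0 N; exists k; rewrite RdivE !INRE.
Qed.

(** The images of [a] have length [m ^ n], so the growth ratio along multiples of [P] is constantly
    [m ^ P]. *)
Lemma uniform_growth (R : realType) P (th : R) : Defs.uniform_on c h ->
  power_growth (fun n => size (itm ord_morphism n [:: a'])) P th -> exists m : nat, th = m%:R.
Proof.
move=> [m hm] hth.
have sz i : size (ord_morphism i) = m.
  by rewrite -(size_map val) map_val_ord -sizeE hm //; apply/ssrnat.ltP.
have sext s : size (ext ord_morphism s) = (m * size s)%N.
  by elim: s => [|i s IH]; rewrite ?muln0 // /ext /= size_cat sz mulnS; congr addn.
have sitm n : size (itm ord_morphism n [:: a']) = (m ^ n)%N.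
  by elim: n => [//|n IH]; rewrite /itm iterS sext -/(itm _ _ _) IH expnS.
have [y [ey hy]] := ord_prolongable.
have m0 : (0 < m)%N by rewrite -(sz a') ey.
exists (m ^ P)%N.
have h1 : power_growth (fun n => size (itm ord_morphism n [:: a'])) P ((m ^ P)%:R : R).
  apply: near_cvg (cvg_cst ((m ^ P)%:R : R)); apply: nearW => n.
  by rewrite (sitm (n.+1 * P)%N) (sitm (n * P)%N) mulSn expnD natrM mulfK // pnatr_eq0 -lt0n expn_gt0 m0.
exact: (cvg_unique _ hth h1).
Qed.

Lemma algebraic_monic_root (th : RR) (p : {poly int}) :
  p \is monic -> root (map_poly intr p) th -> algebraic th.
Proof.
move=> pm pr; exists (map_poly intr p : {poly rat}).
  by rewrite monic_neq0 // monic_map.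
by rewrite -map_poly_comp (eq_map_poly (g := intr)) // => z /=; rewrite ratr_int.
Qed.

End Letters.

Lemma automatic_limsup w x ib jb : x <> [::] -> ~ Defs.has_suffix_xomega w x ->
  Defs.enumerates_maximal_blocks w x ib jb -> Defs.automatic w ->
  exists L, Defs.is_finite_limsup (fun k => Rdefinitions.Rdiv (Raxioms.INR (jb k)) (Raxioms.INR (ib k))) L /\
    Defs.is_rational L.
Proof.
move=> x0 nsuf enum [c [h [a [u [tau [hm [hu [hp [hf wE]]]]]]]]].
have growth P (th : RR) (p : {poly int}) : (0 < P)%N -> 0 < th ->
    power_growth (fun n => size (itm (ord_morphism h) n [:: Ordinal (prolongable_lt hp)])) P th ->
    p \is monic -> root (map_poly intr p) th -> rational th.
  by move=> _ _ /(uniform_growth hm hu)[m ->] _ _; exact: subfield_nat rational_subfield.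
have [L [hL SL]] := blocks_limsup_of_morphic hm hf wE x0 nsuf enum rational_subfield growth.
by exists L; split=> //; exact: rational_is_rational.
Qed.

Lemma morphic_limsup w x ib jb : x <> [::] -> ~ Defs.has_suffix_xomega w x ->
  Defs.enumerates_maximal_blocks w x ib jb -> Defs.morphic w ->
  exists L, Defs.is_finite_limsup (fun k => Rdefinitions.Rdiv (Raxioms.INR (jb k)) (Raxioms.INR (ib k))) L /\
    Defs.is_algebraic L.
Proof.
move=> x0 nsuf enum [c [h [a [u [tau [hm [hp [hf wE]]]]]]]].
have growth P (th : RR) (p : {poly int}) : (0 < P)%N -> 0 < th ->
    power_growth (fun n => size (itm (ord_morphism h) n [:: Ordinal (prolongable_lt hp)])) P th ->
    p \is monic -> root (map_poly intr p) th -> algebraic th.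
  by move=> _ _ _; exact: algebraic_monic_root.
have [L [hL SL]] := blocks_limsup_of_morphic hm hf wE x0 nsuf enum algebraic_subfield growth.
by exists L; split=> //; exact: algebraic_is_algebraic.
Qed.

End Stdlib.

End Gaps.

Require Import Defs.
From Stdlib Require Import Reals ZArith Arith List.
Import ListNotations.
Open Scope R_scope.

Theorem theorem6 (b : nat) (w : nat -> nat) (x : list nat)
  (ib jb : nat -> nat)
  (Hb : (2 <= b)%nat)
  (Hw : word_over b w)
  (Hx : x <> [])
  (Hxb : fword_over b x)
  (Hnosuf : ~ has_suffix_xomega w x)
  (Hinf : infinitely_many_maximal_blocks w x)
  (Henum : enumerates_maximal_blocks w x ib jb) :
  (automatic w ->
     exists L, is_finite_limsup (fun k => INR (jb k) / INR (ib k)) L /\ is_rational L) /\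
  (morphic w ->
     exists L, is_finite_limsup (fun k => INR (jb k) / INR (ib k)) L /\ is_algebraic L).
Proof.
split; intros H.
- exact (Gaps.automatic_limsup Hx Hnosuf Henum H).
- exact (Gaps.morphic_limsup Hx Hnosuf Henum H).
Qed.
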